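(* Let $\{\vec\xi(t),t\in\mathbb R\}$ and $\{\vec\eta(t),t\in\mathbb R\}$ be uncorrelated multidimensional stationary stochastic processes with spectral density matrices $F(\lambda)$ and $G(\lambda)$ satisfying the minimality condition $$\int_{-\infty}^{\infty}(b(\lambda))^{\top}(F(\lambda)+G(\lambda))^{-1}\overline{b(\lambda)}\,d\lambda<\infty$$ for a nontrivial function of exponential type $b(\lambda)=\sum_{l=1}^{s}\int_{-M_l-N_l}^{-M_l}\vec\alpha(t)e^{it\lambda}dt$. Suppose that the operator $\mathbf B_s$ is invertible. Then the spectral characteristic $h(\lambda)$ and the mean-square error $\Delta(F,G)$ of the optimal linear estimate of the functional $A_s\vec\xi=\sum_{l=1}^{s}\int_{-M_l-N_l}^{-M_l}\vec a(t)^{\top}\vec\xi(t)\,dt$, based on observations of $\vec\xi(t)+\vec\eta(t)$ at points $t\in\mathbb R\setminus S$, are given by $$(h(\lambda))^{\top}=(A_s(\lambda))^{\top}F(\lambda)(F(\lambda)+G(\lambda))^{-1}-(C_s(\lambda))^{\top}(F(\lambda)+G(\lambda))^{-1},\qquad C_s(\lambda)=\sum_{l=1}^{s}\int_{-M_l-N_l}^{-M_l}(\mathbf B_s^{-1}\mathbf R_s\mathbf a)(t)e^{it\lambda}dt,$$ and $$\Delta(F,G)=\frac1{2\pi}\int_{-\infty}^{\infty}\big(A_s^{\top}G+C_s^{\top}\big)(F+G)^{-1}F(F+G)^{-1}\big(A_s^{\top}G+C_s^{\top}\big)^{*}d\lambda+\frac1{2\pi}\int_{-\infty}^{\infty}\big(A_s^{\top}F-C_s^{\top}\big)(F+G)^{-1}G(F+G)^{-1}\big(A_s^{\top}F-C_s^{\top}\big)^{*}d\lambda$$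 $$=\langle(\mathbf R_s\mathbf a)(t),(\mathbf B_s^{-1}\mathbf R_s\mathbf a)(t)\rangle+\langle(\mathbf Q_s\mathbf a)(t),\vec a(t)\rangle,$$ where the argument $\lambda$ is omitted in the integrands.
   Context: Setting. $T\ge1$; $S=\bigcup_{l=1}^{s}[-M_l-N_l,-M_l]$ is a finite union of non-overlapping bounded intervals. $\vec\xi(t)=\{\xi_k(t)\}_{k=1}^T$ and $\vec\eta(t)=\{\eta_k(t)\}_{k=1}^T$, $t\in\mathbb R$, are uncorrelated, zero-mean, mean-square continuous stationary processes with correlation functions $R_\xi(t)=\frac1{2\pi}\int_{-\infty}^{\infty}e^{it\lambda}F(\lambda)d\lambda$, $R_\eta(t)=\frac1{2\pi}\int_{-\infty}^{\infty}e^{it\lambda}G(\lambda)d\lambda$, where $F,G$ are the ($T\times T$) spectral density matrices. They have spectral representations $\vec\xi(t)=\int e^{it\lambda}Z_\xi(d\lambda)$, $\vec\eta(t)=\int e^{it\lambda}Z_\eta(d\lambda)$ with orthogonal vector random measures satisfying $EZ_\xi(\Delta_1)Z_\xi(\Delta_2)^*=\frac1{2\pi}\int_{\Delta_1\cap\Delta_2}F\,d\lambda$ and $EZ_\eta(\Delta_1)Z_\eta(\Delta_2)^*=\frac1{2\pi}\int_{\Delta_1\cap\Delta_2}G\,d\lambda$. The weight $\vec a\in L_2(S)$ ($\mathbb C^T$-valued) satisfies $\sum_{k=1}^T\sum_{l=1}^s\int_{-M_l-N_l}^{-M_l}|a_k(t)|dt<\infty$ and $\sum_{l=1}^s\int_{-M_l-N_l}^{-M_l}|t|\,\|\vec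 a(t)\|^2dt<\infty$; $A_s(\lambda)=\sum_{l=1}^s\int_{-M_l-N_l}^{-M_l}\vec a(t)e^{it\lambda}dt$. Estimates. Let $H^s(\xi+\eta)$ be the closed linear span of $\{\xi_k(t)+\eta_k(t):t\in\mathbb R\setminus S,\,k=1,\dots,T\}$ in the Hilbert space of zero-mean square-integrable random variables with $(\xi,\eta)=E\xi\overline\eta$. The optimal linear estimate $\hat A_s\vec\xi$ is the orthogonal projection of $A_s\vec\xi$ onto $H^s(\xi+\eta)$. Let $L_2(F+G)$ be the Hilbert space of vector functions $\vec a(\lambda)$ with $\int\vec a(\lambda)^{\top}(F(\lambda)+G(\lambda))\overline{\vec a(\lambda)}d\lambda<\infty$ and $L_2^s(F+G)$ its closed subspace generated by $e^{it\lambda}\delta_k$, $t\in\mathbb R\setminus S$, $k=1,\dots,T$, where $\delta_k=\{\delta_{kl}\}_{l=1}^T$. The spectral characteristic of $\hat A_s\vec\xi$ is $h\in L_2^s(F+G)$ with $\hat A_s\vec\xi=\int(h(\lambda))^{\top}(Z_\xi(d\lambda)+Z_\eta(d\lambda))$; $\Delta(F,G)=E|A_s\vec\xi-\hat A_s\vec\xi|^2$. Operators. For $\vec a\in L_2(S)$, $t\in S$, $(\mathbf B_s\mathbf a)(t)=\frac1{2\pi}\sum_{l}\int_{-M_l-N_l}^{-M_l}\int_{-\infty}^{\infty}(\vec a(u))^{\top}(F+G)^{-1}e^{i\lambda(u-t)}d\lambda du$, $(\mathbf R_s\mathbf a)(t)=\frac1{2\pi}\sum_{l}\int_{-M_l-N_l}^{-M_l}\int_{-\infty}^{\infty}(\vec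 a(u))^{\top}F(F+G)^{-1}e^{i\lambda(u-t)}d\lambda du$, $(\mathbf Q_s\mathbf a)(t)=\frac1{2\pi}\sum_{l}\int_{-M_l-N_l}^{-M_l}\int_{-\infty}^{\infty}(\vec a(u))^{\top}F(F+G)^{-1}G\,e^{i\lambda(u-t)}d\lambda du$, with $F,G$ evaluated at $\lambda$. These are regarded as linear operators in $L_2(S)$ (row and column vectors being identified). $\langle\cdot,\cdot\rangle$ is the inner product of $L_2(S)$, and $^*$ is conjugate transpose.
   Formalization: The λ-integrals in B_s and R_s, which diverge in general as F+G is integrable, are read as weak limits in L_2(S) of integrals over [-L,L]; B_s acts on functions whose transform satisfies the minimality integral, and invertible means bijective from that domain onto L_2(S). *)

(* Defs.v *)
From HB Require Import structures.
From mathcomp Require Import all_boot all_order all_algebra.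
From mathcomp Require Import all_classical all_reals all_analysis.
From mathcomp Require Export complex.

Set Implicit Arguments.
Unset Strict Implicit.
Unset Printing Implicit Defensive.
Import Order.TTheory GRing.Theory Num.Theory.
Import numFieldNormedType.Exports.

Local Open Scope classical_set_scope.
Local Open Scope ring_scope.
Local Open Scope complex_scope.

Section complex_integrals.
Context {R : realType}.

Definition cabs2 (z : R[i]) : R := complex.Re z ^+ 2 + complex.Im z ^+ 2.
Definition expi (x : R) : R[i] := cos x +i* sin x.
Definition inv2pi : R[i] := ((2 * pi)^-1)%:C.

Definition conjmx m n (A : 'M[R[i]]_(m, n)) : 'M[R[i]]_(m, n) :=
  map_mx (@conjc R) A.
Definition adjmx m n (A : 'M[R[i]]_(m, n)) : 'M[R[i]]_(n, m) := conjmx A^T.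
Definition mx11 (A : 'M[R[i]]_1) : R[i] := A ord0 ord0.

(* v^T M conj(v); only used for Hermitian M, for which this number is real. *)
Definition qform n (M : 'M[R[i]]_n) (v : 'cV[R[i]]_n) : R :=
  complex.Re (mx11 (v^T *m M *m conjmx v)).
Definition vnorm2 n (v : 'cV[R[i]]_n) : R := \sum_k cabs2 (v k ord0).
Definition psdmx n (M : 'M[R[i]]_n) : Prop :=
  adjmx M = M /\ forall v, 0 <= qform M v.

Context {d : measure_display} {X : measurableType d}.

Definition cmeasurable (D : set X) (f : X -> R[i]) : Prop :=
  measurable_fun D (fun x => complex.Re (f x)) /\
  measurable_fun D (fun x => complex.Im (f x)).
Definition mxmeasurable (D : set X) m n (f : X -> 'M[R[i]]_(m, n)) : Prop :=
  forall i j, cmeasurable D (fun x => f x i j).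

Variable mu : {measure set X -> \bar R}.

Definition cintegrable (D : set X) (f : X -> R[i]) : Prop :=
  mu.-integrable D (EFin \o (fun x => complex.Re (f x))) /\
  mu.-integrable D (EFin \o (fun x => complex.Im (f x))).
Definition cint (D : set X) (f : X -> R[i]) : R[i] :=
  Rintegral mu D (fun x => complex.Re (f x)) +i*
  Rintegral mu D (fun x => complex.Im (f x)).
Definition mxintegrable (D : set X) m n (f : X -> 'M[R[i]]_(m, n)) : Prop :=
  forall i j, cintegrable D (fun x => f x i j).
Definition mxint (D : set X) m n (f : X -> 'M[R[i]]_(m, n)) : 'M[R[i]]_(m, n) :=
  \matrix_(i, j) cint D (fun x => f x i j).

End complex_integrals.

Notation leb R := (@lebesgue_measure R).

Section random_variables.
Context {R : realType} {d : measure_display} {Omega : measurableType d}.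
Variable P : probability Omega R.

(* E|X - Y|^2 *)
Definition msdist (X Y : Omega -> R[i]) : \bar R :=
  (\int[P]_w (cabs2 (X w - Y w))%:E)%E.

(* The Hilbert space of zero-mean square-integrable random variables. *)
Definition rv2 (X : Omega -> R[i]) : Prop :=
  [/\ cmeasurable setT X,
      (\int[P]_w (cabs2 (X w))%:E < +oo)%E &
      cint P setT X = 0].

Definition corr (X Y : Omega -> R[i]) : R[i] :=
  cint P setT (fun w => X w * conjc (Y w)).
Definition corrmx n (X Y : Omega -> 'cV[R[i]]_n) : 'M[R[i]]_n :=
  mxint P setT (fun w => X w *m adjmx (Y w)).

Context {T : nat}.
Implicit Types (xi eta zeta : R -> Omega -> 'cV[R[i]]_T).
Implicit Types (F : R -> 'M[R[i]]_T) (Z : set R -> Omega -> 'cV[R[i]]_T).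
Implicit Types (S : set R).

Definition stationary xi (Rxi : R -> 'M[R[i]]_T) : Prop :=
  (forall t k, rv2 (fun w => xi t w k ord0)) /\
  (forall s t, corrmx (xi (s + t)) (xi s) = Rxi t).

Definition ms_continuous xi : Prop :=
  forall t k,
    msdist (fun w => xi u w k ord0) (fun w => xi t w k ord0)
      @[u --> t] --> 0%E.

Definition uncorrelated xi eta : Prop :=
  forall s t, corrmx (xi s) (eta t) = 0.

Definition spectral_density F (Rxi : R -> 'M[R[i]]_T) : Prop :=
  [/\ {ae leb R, forall l, psdmx (F l)},
      mxintegrable (leb R) setT F &
      forall t, Rxi t =
        inv2pi *: mxint (leb R) setT (fun l => expi (t * l) *: F l)].

Definition orthogonal_measure Z F : Prop :=
  (forall D k, measurable D -> rv2 (fun w => Z D w k ord0)) /\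
  (forall D1 D2, measurable D1 -> measurable D2 ->
     corrmx (Z D1) (Z D2) = inv2pi *: mxint (leb R) (D1 `&` D2) F).

(* L_2(F) *)
Definition L2spec F (h : R -> 'cV[R[i]]_T) : Prop :=
  mxmeasurable setT h /\ (\int[leb R]_l (qform (F l) (h l))%:E < +oo)%E.

(* X is the integral of h^T against Z, for an orthogonal measure Z with
   spectral density F: h is approximated in L_2(F) by simple functions whose
   integrals approximate X in mean square. *)
Definition is_stoch_int Z F (h : R -> 'cV[R[i]]_T) (X : Omega -> R[i]) : Prop :=
  [/\ L2spec F h, rv2 X &
   forall e : R, 0 < e -> exists (n : nat) (D : 'I_n -> set R)
       (c : 'I_n -> 'cV[R[i]]_T),
     [/\ (forall j, measurable (D j)),
         (\int[leb R]_l (qform (F l)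
            (h l - \sum_j (\1_(D j) l : R)%:C *: c j))%:E < e%:E)%E &
         (msdist X (fun w => (\sum_j mx11 ((c j)^T *m Z (D j) w))%R)
            < e%:E)%E]].

Definition spectral_representation xi Z F : Prop :=
  forall t k, is_stoch_int Z F (fun l => expi (t * l) *: delta_mx k ord0)
                (fun w => xi t w k ord0).

(* The closed linear span of the zeta_k(t), t outside S. *)
Definition obs_space S zeta (Y : Omega -> R[i]) : Prop :=
  rv2 Y /\
  forall e : R, 0 < e -> exists (n : nat) (t : 'I_n -> R) (k : 'I_n -> 'I_T)
      (c : 'I_n -> R[i]),
    (forall j, ~ S (t j)) /\
    (msdist Y (fun w => (\sum_j c j * zeta (t j) w (k j) ord0)%R) < e%:E)%E.

(* L_2^s(F): the closed span in L_2(F) of e^{it.} delta_k, t outside S. *)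
Definition L2spec_obs S F (h : R -> 'cV[R[i]]_T) : Prop :=
  L2spec F h /\
  forall e : R, 0 < e -> exists (n : nat) (t : 'I_n -> R) (k : 'I_n -> 'I_T)
      (c : 'I_n -> R[i]),
    (forall j, ~ S (t j)) /\
    (\int[leb R]_l (qform (F l)
       (h l - \sum_j c j *: (expi (t j * l) *: delta_mx (k j) ord0)))%:E
       < e%:E)%E.

Definition is_projection (H : (Omega -> R[i]) -> Prop) (X Y : Omega -> R[i]) :
    Prop :=
  H Y /\ forall V, H V -> corr (fun w => X w - Y w) V = 0.

(* X is the mean-square integral over S of a(t)^T xi(t) dt, taken in the weak
   sense in the Hilbert space [rv2]. *)
Definition is_functional S (a : R -> 'cV[R[i]]_T) xi (X : Omega -> R[i]) :
    Prop :=
  rv2 X /\ forall Y, rv2 Y ->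
    corr X Y = cint (leb R) S (fun t => corr (fun w => mx11 ((a t)^T *m xi t w)) Y).

Definition is_spectral_characteristic S Z F (Y : Omega -> R[i])
    (h : R -> 'cV[R[i]]_T) : Prop :=
  L2spec_obs S F h /\ is_stoch_int Z F h Y.

End random_variables.

Section operators.
Context {R : realType} {T : nat}.
Variable S : set R.
Implicit Types (F G K : R -> 'M[R[i]]_T) (x y w : R -> 'cV[R[i]]_T).

(* The intervals composing S do not overlap, so the sum over l of the
   integrals over the l-th interval is the integral over S.  Elements of L_2(S)
   are represented by functions on the line, of which only the values on S
   matter. *)
Definition L2S x : Prop :=
  mxmeasurable S x /\ (\int[leb R]_(t in S) (vnorm2 (x t))%:E < +oo)%E.
Definition eqS x y : Prop := {ae leb R, forall t, S t -> x t = y t}.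
Definition innerS x y : R[i] :=
  cint (leb R) S (fun t => mx11 ((x t)^T *m conjmx (y t))).

Definition fourierS x (l : R) : 'cV[R[i]]_T :=
  mxint (leb R) S (fun t => expi (t * l) *: x t).

(* The functions x of L_2(S) whose transform satisfies the integrability
   condition of the minimality condition; equivalently, (F+G)^{-1} applied to
   the transform lies in L_2(F+G). *)
Definition finite_energy F G x : Prop :=
  L2S x /\
  (\int[leb R]_l (qform (invmx (F l + G l)) (fourierS x l))%:E < +oo)%E.

Definition minimality F G : Prop :=
  {ae leb R, forall l, F l + G l \in unitmx} /\
  exists alpha, finite_energy F G alpha /\ exists l, fourierS alpha l != 0.

(* (1/2pi) int_S int_D x(u)^T K(l) e^{il(u-t)} dl du, as a column. *)
Definition kernel_int (D : set R) K x (t : R) : 'cV[R[i]]_T :=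
  inv2pi *: (mxint (leb R) S (fun u =>
    mxint (leb R) D (fun l => expi (l * (u - t)) *: ((x u)^T *m K l))))^T.

(* As F + G is integrable, (F+G)^{-1} never is: the inner integral over the
   whole line in the formulas for B_s and R_s does not converge and is read as
   the limit, for L -> +oo, of the integrals over [-L, L].  The limit is taken
   weakly in t against the functions of finite energy.  A limit in the norm of
   L_2(S) would leave out the x for which the inverse transform of
   (F+G)^{-1} applied to the transform of x has point masses at end points of
   S.  For T = 1, S an interval and F + G = 1/(1 + l^2), the weak limit gives
   B_s x = x - x'' with Dirichlet conditions, a bijection of its domain onto
   L_2(S); with the limit in norm B_s would not be surjective. *)
Definition kernel_op F G K x y : Prop :=
  [/\ forall L : R, mxintegrable (leb R) `[- L, L] K,
      L2S x, L2S y &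
      forall w, finite_energy F G w ->
        cabs2 (innerS (kernel_int `[- L, L] K x) w - innerS y w)
          @[L --> +oo] --> (0 : R)].

(* The graphs of B_s (an unbounded operator) and R_s. *)
Definition graph_B F G x y : Prop :=
  finite_energy F G x /\ kernel_op F G (fun l => invmx (F l + G l)) x y.
Definition graph_R F G x y : Prop :=
  kernel_op F G (fun l => F l *m invmx (F l + G l)) x y.

(* F(F+G)^{-1}G is integrable, and the integrals defining Q_s converge. *)
Definition op_Q F G x : R -> 'cV[R[i]]_T :=
  kernel_int setT (fun l => F l *m invmx (F l + G l) *m G l) x.

(* The relation is a single-valued bijection from its domain onto L_2(S). *)
Definition invertible_op (A : (R -> 'cV[R[i]]_T) -> (R -> 'cV[R[i]]_T) -> Prop) :
    Prop :=
  [/\ forall x y y', A x y -> A x y' -> eqS y y',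
      forall y, L2S y -> exists x, A x y &
      forall x x' y, A x y -> A x' y -> eqS x x'].

End operators.

(* Main.v *)
Require Import Defs.
From HB Require Import structures.
From mathcomp Require Import all_boot all_order all_algebra.
From mathcomp Require Import all_classical all_reals all_analysis.
From mathcomp Require Import measurable_realfun.
From mathcomp Require Import ring lra.

Set Implicit Arguments.
Unset Strict Implicit.
Unset Printing Implicit Defensive.
Import Order.TTheory GRing.Theory Num.Theory.
Import numFieldNormedType.Exports.

Local Open Scope classical_set_scope.
Local Open Scope ring_scope.
Local Open Scope complex_scope.

(* Put H = F + G.  The spectral isometry maps the estimate to an element p of
   L_2(H), in the closed span of the e^{itl} delta_k with t outside S, for which
   the integrals of F^T A - H^T p against these functions vanish: its Fourier
   transform is supported in S.  By Fourier inversion (obtained by damping with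
   exp(- e |t|), whose transform is the Poisson kernel) F^T A - H^T p is itself
   the transform of some w in L_2(S), of finite energy.  Conversely, p is
   orthogonal to (H^{-1})^T U for the transform U of any u of finite energy,
   and so is h, by the defining relations of R_s and B_s tested against u.  As
   h - p is of the form (H^{-1})^T U with u = w - c, it is orthogonal to itself.
   The formulas for the error are then identities between inner products. *)

(** H is integrable but its inverse is not, so [B_s] and [R_s] exist only as weak limits, and all
    one can use of them is their pairing with functions of finite energy. This is why the argument
    lives in L_2(H): a function u of finite energy enters through (H^{-1})^T U, which has finite
    norm there, and the pairings become inner products. That w has finite energy comes for free: F^T
    A - H^T p is H^T applied to an element of L_2(H). Its coordinates are integrable because the
    constant vectors lie in L_2(H); hence w is bounded, and S has finite measure. The element p is
    the limit of the spectral images of combinations approximating the estimate, which requires the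
    completeness of L_2(H). Functions and random variables are not identified when they agree almost
    everywhere: all spaces carry semi-inner products, and h = p means that h - p has norm 0. Squared
    norms are kept throughout, with |x + y|^2 <= 2|x|^2 + 2|y|^2 in place of the triangle
    inequality. *)

Local Notation conjmx := Defs.conjmx.

(** * Complex numbers through their real and imaginary parts *)

Section complex_parts.
Context {R : realType}.
Implicit Types (x y : R[i]) (r : R).

Lemma Re_add x y : complex.Re (x + y) = complex.Re x + complex.Re y.
Proof. by case: x; case: y. Qed.
Lemma Im_add x y : complex.Im (x + y) = complex.Im x + complex.Im y.
Proof. by case: x; case: y. Qed.
Lemma Re_opp x : complex.Re (- x) = - complex.Re x.
Proof. by case: x. Qed.
Lemma Im_opp x : complex.Im (- x) = - complex.Im x.
Proof. by case: x. Qed.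
Lemma Re_mul x y : complex.Re (x * y) =
  complex.Re x * complex.Re y - complex.Im x * complex.Im y.
Proof. by case: x; case: y. Qed.
Lemma Im_mul x y : complex.Im (x * y) =
  complex.Re x * complex.Im y + complex.Im x * complex.Re y.
Proof. by case: x => a b; case: y => c e /=. Qed.
Lemma Re_conj x : complex.Re (conjc x) = complex.Re x.
Proof. by case: x. Qed.
Lemma Im_conj x : complex.Im (conjc x) = - complex.Im x.
Proof. by case: x. Qed.

Definition partsE := (Re_add, Im_add, Re_opp, Im_opp, Re_mul, Im_mul, Re_conj,
  Im_conj).

Lemma eq_parts x y :
  complex.Re x = complex.Re y -> complex.Im x = complex.Im y -> x = y.
Proof. by case: x => a b; case: y => c e /= -> ->. Qed.

Lemma cabs2_ge0 x : 0 <= cabs2 x.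
Proof. by rewrite addr_ge0 ?sqr_ge0. Qed.
Lemma cabs2M x y : cabs2 (x * y) = cabs2 x * cabs2 y.
Proof. by rewrite /cabs2 !partsE; ring. Qed.
Lemma cabs2_conj x : cabs2 (conjc x) = cabs2 x.
Proof. by rewrite /cabs2 !partsE sqrrN. Qed.
Lemma cabs2N x : cabs2 (- x) = cabs2 x.
Proof. by rewrite /cabs2 !partsE !sqrrN. Qed.
Lemma cabs2_real r : cabs2 r%:C = r ^+ 2.
Proof. by rewrite /cabs2 /= expr0n addr0. Qed.
Lemma cabs2_eq0 x : cabs2 x = 0 -> x = 0.
Proof.
move=> h; apply: eq_parts => /=; apply/eqP; rewrite -sqrf_eq0; apply/eqP;
  apply/le_anti; rewrite sqr_ge0 andbT -h /cabs2.
- by rewrite lerDl sqr_ge0.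
- by rewrite lerDr sqr_ge0.
Qed.
Lemma conjcM x y : conjc (x * y) = conjc x * conjc y.
Proof. exact: rmorphM. Qed.
Lemma mulconj x : x * conjc x = (cabs2 x)%:C.
Proof. by apply: eq_parts; rewrite !partsE /cabs2 /=; ring. Qed.
Lemma cabs2D x y : cabs2 (x + y) <= 2 * cabs2 x + 2 * cabs2 y.
Proof.
rewrite /cabs2 !partsE.
set a := complex.Re x; set b := complex.Im x; set c := complex.Re y.
set e := complex.Im y.
have := sqr_ge0 (a - c); have := sqr_ge0 (b - e); nra.
Qed.
Lemma cabs2_expi r : cabs2 (expi r) = 1.
Proof. by rewrite /cabs2 /expi /= cos2Dsin2. Qed.
Lemma expiD r s : expi (r + s) = expi r * expi s.
Proof. by apply: eq_parts; rewrite !partsE /expi /= (cosD, sinD); ring. Qed.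
Lemma expiN r : expi (- r) = conjc (expi r).
Proof. by rewrite /expi cosN sinN. Qed.
Lemma expi0 : expi 0 = 1 :> R[i].
Proof. by rewrite /expi cos0 sin0. Qed.
Lemma normr_Re x : `|complex.Re x| <= Num.sqrt (cabs2 x).
Proof. by rewrite -sqrtr_sqr ler_wsqrtr// lerDl sqr_ge0. Qed.
Lemma normr_Im x : `|complex.Im x| <= Num.sqrt (cabs2 x).
Proof. by rewrite -sqrtr_sqr ler_wsqrtr// lerDr sqr_ge0. Qed.

End complex_parts.

(** * Real integrals under almost everywhere hypotheses *)

Section real_integrals.
Context {R : realType} {d : measure_display} {X : measurableType d}.
Variable mu : {measure set X -> \bar R}.
Variables (D : set X) (mD : measurable D).
Implicit Types f g : X -> R.

Lemma ae_le_integrable f g : measurable_fun D f ->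
  mu.-integrable D (EFin \o g) ->
  {ae mu, forall x, D x -> `|f x| <= g x} -> mu.-integrable D (EFin \o f).
Proof.
move=> mf /integrableP[mg ig] fg; apply/integrableP; split.
  exact/measurable_EFinP.
apply: le_lt_trans ig; apply: ae_ge0_le_integral => //=.
- by apply/measurable_EFinP; exact: measurableT_comp.
- by apply/measurable_EFinP; move/measurable_EFinP: mg => mg;
    exact: measurableT_comp.
- apply: filterS fg => x /= h Dx; rewrite lee_fin.
  by apply: le_trans (h Dx) _; exact: ler_norm.
Qed.

Lemma ae_eq_Rintegral f g : measurable_fun D f -> measurable_fun D g ->
  {ae mu, forall x, D x -> f x = g x} -> Rintegral mu D f = Rintegral mu D g.
Proof.
move=> mf mg fg; rewrite /Rintegral; congr fine.
apply: ae_eq_integral => //; try exact/measurable_EFinP.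
by apply: filterS fg => x /= h Dx; rewrite h.
Qed.

Lemma ae_ge0_Rintegral f : measurable_fun D f ->
  {ae mu, forall x, D x -> 0 <= f x} -> 0 <= Rintegral mu D f.
Proof.
move=> mf f0; rewrite (ae_eq_Rintegral (g := fun x => `|f x|)) //.
- exact: Rintegral_ge0.
- exact: measurableT_comp.
- by apply: filterS f0 => x h Dx; rewrite ger0_norm// h.
Qed.

Lemma integrable_mfun f : mu.-integrable D (EFin \o f) -> measurable_fun D f.
Proof. by move=> /measurable_int /measurable_EFinP. Qed.

Lemma ae_le_Rintegral f g : mu.-integrable D (EFin \o f) ->
  mu.-integrable D (EFin \o g) ->
  {ae mu, forall x, D x -> f x <= g x} ->
  Rintegral mu D f <= Rintegral mu D g.
Proof.
move=> fi gi fg; rewrite -subr_ge0 -RintegralB//.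
apply: ae_ge0_Rintegral.
  by apply: measurable_funB; exact: integrable_mfun.
by apply: filterS fg => x h Dx; rewrite subr_ge0 h.
Qed.

Lemma integrableD_EFin f g : mu.-integrable D (EFin \o f) ->
  mu.-integrable D (EFin \o g) -> mu.-integrable D (EFin \o (fun x => f x + g x)).
Proof. by move=> fi gi; apply: eq_integrable (integrableD mD fi gi). Qed.
Lemma integrableN_EFin f : mu.-integrable D (EFin \o f) ->
  mu.-integrable D (EFin \o (fun x => - f x)).
Proof. by move=> fi; apply: eq_integrable (integrableN fi). Qed.
Lemma integrableZ_EFin r f : mu.-integrable D (EFin \o f) ->
  mu.-integrable D (EFin \o (fun x => r * f x)).
Proof. by move=> fi; apply: eq_integrable (integrableZl mD r fi). Qed.

Lemma ge0_fin_integrable f : measurable_fun D f ->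
  {ae mu, forall x, D x -> 0 <= f x} ->
  (\int[mu]_(x in D) (f x)%:E < +oo)%E -> mu.-integrable D (EFin \o f).
Proof.
move=> mf f0 h; apply/integrableP; split; first exact/measurable_EFinP.
rewrite (ae_eq_integral (EFin \o f))//.
- by apply: measurableT_comp => //; exact/measurable_EFinP.
- exact/measurable_EFinP.
- by apply: filterS f0 => x /= h0 Dx; rewrite ger0_norm ?h0.
Qed.

Lemma integrable_EFin_Rintegral f : mu.-integrable D (EFin \o f) ->
  (\int[mu]_(x in D) (f x)%:E = (Rintegral mu D f)%:E)%E.
Proof. by move=> fi; rewrite /Rintegral fineK//; exact: integrable_fin_num. Qed.

End real_integrals.

(** * Measurability of complex functions *)

Section cmeasurable.
Context {R : realType} {d : measure_display} {X : measurableType d}.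
Variable D : set X.
Implicit Types (f g : X -> R[i]) (h : X -> R).

Lemma cmeasurable_cst z : cmeasurable D (fun _ : X => z : R[i]).
Proof. by split; exact: measurable_cst. Qed.
Lemma cmeasurableD f g : cmeasurable D f -> cmeasurable D g ->
  cmeasurable D (fun x => f x + g x).
Proof.
by move=> [f1 f2] [g1 g2]; split; [under eq_fun do rewrite Re_add
  |under eq_fun do rewrite Im_add]; exact: measurable_funD.
Qed.
Lemma cmeasurableN f : cmeasurable D f -> cmeasurable D (fun x => - f x).
Proof.
by move=> [f1 f2]; split; [under eq_fun do rewrite Re_opp
  |under eq_fun do rewrite Im_opp]; exact: measurableT_comp.
Qed.
Lemma cmeasurableM f g : cmeasurable D f -> cmeasurable D g ->
  cmeasurable D (fun x => f x * g x).
Proof.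
move=> [f1 f2] [g1 g2]; split.
  under eq_fun do rewrite Re_mul.
  by apply: measurable_funB; exact: measurable_funM.
under eq_fun do rewrite Im_mul.
by apply: measurable_funD; exact: measurable_funM.
Qed.
Lemma cmeasurable_conj f : cmeasurable D f -> cmeasurable D (fun x => conjc (f x)).
Proof.
move=> [f1 f2]; split; first by under eq_fun do rewrite Re_conj.
by under eq_fun do rewrite Im_conj; exact: measurableT_comp.
Qed.
Lemma cmeasurable_sum I (s : seq I) (Q : pred I) (F : I -> X -> R[i]) :
  (forall i, Q i -> cmeasurable D (F i)) ->
  cmeasurable D (fun x => \sum_(i <- s | Q i) F i x).
Proof.
move=> h; elim: s => [|i s ih].
  by under eq_fun do rewrite big_nil; exact: cmeasurable_cst.
under eq_fun do rewrite big_cons; case: (boolP (Q i)) => // Qi.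
by apply: cmeasurableD => //; exact: h.
Qed.
Lemma cmeasurable_prod I (s : seq I) (Q : pred I) (F : I -> X -> R[i]) :
  (forall i, Q i -> cmeasurable D (F i)) ->
  cmeasurable D (fun x => \prod_(i <- s | Q i) F i x).
Proof.
move=> h; elim: s => [|i s ih].
  by under eq_fun do rewrite big_nil; exact: cmeasurable_cst.
under eq_fun do rewrite big_cons; case: (boolP (Q i)) => // Qi.
by apply: cmeasurableM => //; exact: h.
Qed.
Lemma cmeasurable_real h : measurable_fun D h -> cmeasurable D (fun x => (h x)%:C).
Proof. by move=> mh; split => //; exact: measurable_cst. Qed.
Lemma measurable_cabs2 f : cmeasurable D f -> measurable_fun D (fun x => cabs2 (f x)).
Proof.
move=> [f1 f2]; apply: measurable_funD;
  by under eq_fun do rewrite expr2; exact: measurable_funM.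
Qed.
(** Uses 1/z = |z|^{-2} conj(z), where the real power [powR] is measurable on the whole line. At z =
    0 both sides are 0, whatever the value of the power there. *)
Lemma cmeasurableV f : cmeasurable D f -> cmeasurable D (fun x => (f x)^-1).
Proof.
move=> mf; have -> : (fun x => (f x)^-1) =
    (fun x => (powR (cabs2 (f x)) (-1))%:C * conjc (f x)).
  apply/funext => x; case: (eqVneq (f x) 0) => [->|fx0].
    by rewrite invr0 conjc0 mulr0.
  apply: (mulfI fx0); rewrite divff// mulrCA mulconj -rmorphM /=.
  rewrite powR_inv1 ?cabs2_ge0// mulVf//.
  by apply: contra_neq fx0 => h; exact: cabs2_eq0.
apply: cmeasurableM; last exact: cmeasurable_conj.
apply: cmeasurable_real.
apply: (@measurableT_comp _ _ _ _ _ _ (fun r : R => powR r (-1))).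
  exact: measurable_powR.
exact: measurable_cabs2.
Qed.

End cmeasurable.

(** * Integrals of complex functions *)

Section cintegral.
Context {R : realType} {d : measure_display} {X : measurableType d}.
Variable mu : {measure set X -> \bar R}.
Variables (D : set X) (mD : measurable D).
Implicit Types f g : X -> R[i].

Lemma cintegrable_meas f : cintegrable mu D f -> cmeasurable D f.
Proof. by move=> [/integrable_mfun f1 /integrable_mfun f2]. Qed.

Lemma cintegrable_dom f (h : X -> R) : cmeasurable D f ->
  mu.-integrable D (EFin \o h) ->
  {ae mu, forall x, D x -> Num.sqrt (cabs2 (f x)) <= h x} -> cintegrable mu D f.
Proof.
move=> [f1 f2] hi fh; split; apply: ae_le_integrable hi _ => //;
  apply: filterS fh => x h1 Dx; apply: le_trans (h1 Dx).
- exact: normr_Re.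
- exact: normr_Im.
Qed.

Lemma cintegrable_abs f : cintegrable mu D f ->
  mu.-integrable D (EFin \o (fun x => Num.sqrt (cabs2 (f x)))).
Proof.
move=> fi; have mf := cintegrable_meas fi; case: fi => f1 f2.
apply: (@ae_le_integrable _ _ _ _ _ mD _ (fun x => `|complex.Re (f x)| + `|complex.Im (f x)|)).
- apply: (measurable_comp measurableT) => //; last exact: measurable_cabs2.
  by apply: continuous_measurable_fun; exact: sqrt_continuous.
- apply: integrableD_EFin => //; first exact: (integrable_abse f1).
  exact: (integrable_abse f2).
- apply: aeW => x _; rewrite ger0_norm ?sqrtr_ge0//.
  rewrite -(@ler_pXn2r _ 2)// ?nnegrE ?addr_ge0 ?sqrtr_ge0//.
  rewrite sqr_sqrtr ?cabs2_ge0// sqrrD !real_normK ?num_real// /cabs2.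
  by rewrite addrAC lerDl mulrn_wge0// mulr_ge0.
Qed.

Lemma eq_cintegrable f g : {in D, f =1 g} -> cintegrable mu D f ->
  cintegrable mu D g.
Proof.
by move=> fg [f1 f2]; split; [move: f1|move: f2]; apply: eq_integrable => // x xD /=;
  rewrite fg.
Qed.
Lemma eq_cint f g : {in D, f =1 g} -> cint mu D f = cint mu D g.
Proof.
by move=> fg; rewrite /cint; congr Complex; apply: eq_Rintegral => x xD; rewrite fg.
Qed.
Lemma ae_eq_cint f g : cmeasurable D f -> cmeasurable D g ->
  {ae mu, forall x, D x -> f x = g x} -> cint mu D f = cint mu D g.
Proof.
move=> [f1 f2] [g1 g2] fg; rewrite /cint; congr Complex; apply: ae_eq_Rintegral => //;
  by apply: filterS fg => x h Dx; rewrite h.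
Qed.
Lemma ae_eq_cintegrable f g : cintegrable mu D f -> cmeasurable D g ->
  {ae mu, forall x, D x -> f x = g x} -> cintegrable mu D g.
Proof.
move=> fi mg fg; apply: (cintegrable_dom mg (cintegrable_abs fi)).
by apply: filterS fg => x h Dx; rewrite h.
Qed.

Lemma cintegrable0 : cintegrable mu D (fun _ => 0).
Proof. by split; exact: integrable0. Qed.
Lemma cintegrableD f g : cintegrable mu D f -> cintegrable mu D g ->
  cintegrable mu D (fun x => f x + g x).
Proof.
by move=> [f1 f2] [g1 g2]; split; [under eq_fun do rewrite Re_add
  |under eq_fun do rewrite Im_add]; exact: integrableD_EFin.
Qed.
Lemma cintegrableN f : cintegrable mu D f -> cintegrable mu D (fun x => - f x).
Proof.
by move=> [f1 f2]; split; [under eq_fun do rewrite Re_opp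
  |under eq_fun do rewrite Im_opp]; exact: integrableN_EFin.
Qed.
Lemma cintegrableB f g : cintegrable mu D f -> cintegrable mu D g ->
  cintegrable mu D (fun x => f x - g x).
Proof. by move=> fi gi; apply: cintegrableD => //; exact: cintegrableN. Qed.
Lemma cintegrableZ z f : cintegrable mu D f -> cintegrable mu D (fun x => z * f x).
Proof.
move=> [f1 f2]; split.
  under eq_fun do rewrite Re_mul.
  apply: (integrableD_EFin mD (integrableZ_EFin mD _ f1)).
  exact: (integrableN_EFin mD (integrableZ_EFin mD _ f2)).
under eq_fun do rewrite Im_mul.
exact: (integrableD_EFin mD (integrableZ_EFin mD _ f2) (integrableZ_EFin mD _ f1)).
Qed.
Lemma cintegrable_conj f : cintegrable mu D f ->
  cintegrable mu D (fun x => conjc (f x)).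
Proof.
move=> [f1 f2]; split; first by under eq_fun do rewrite Re_conj.
by under eq_fun do rewrite Im_conj; exact: integrableN_EFin.
Qed.
Lemma cintegrable_sum I (s : seq I) (Q : pred I) (F : I -> X -> R[i]) :
  (forall i, Q i -> cintegrable mu D (F i)) ->
  cintegrable mu D (fun x => \sum_(i <- s | Q i) F i x).
Proof.
move=> h; elim: s => [|i s ih].
  by under eq_fun do rewrite big_nil; exact: cintegrable0.
under eq_fun do rewrite big_cons; case: (boolP (Q i)) => // Qi.
by apply: cintegrableD => //; exact: h.
Qed.
Lemma cintegrableM_bounded f g (M : R) : cintegrable mu D f -> cmeasurable D g ->
  (forall x, D x -> cabs2 (g x) <= M) -> cintegrable mu D (fun x => g x * f x).
Proof.
move=> fi mg gM.
apply: (@cintegrable_dom _ (fun x => Num.sqrt M * Num.sqrt (cabs2 (f x)))).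
- by apply: cmeasurableM => //; exact: cintegrable_meas.
- by apply: integrableZ_EFin => //; exact: cintegrable_abs.
- apply: aeW => x Dx; rewrite cabs2M sqrtrM ?cabs2_ge0//.
  by rewrite ler_wpM2r ?sqrtr_ge0// ler_wsqrtr// gM.
Qed.

Lemma cint0 : cint mu D (fun _ => 0 : R[i]) = 0.
Proof. by rewrite /cint /= /Rintegral integral0. Qed.
Lemma cintD f g : cintegrable mu D f -> cintegrable mu D g ->
  cint mu D (fun x => f x + g x) = cint mu D f + cint mu D g.
Proof.
move=> [f1 f2] [g1 g2]; apply: eq_parts; rewrite !partsE /= -RintegralD//;
  by apply: eq_Rintegral => x _; rewrite partsE.
Qed.
Lemma cintZ z f : cintegrable mu D f ->
  cint mu D (fun x => z * f x) = z * cint mu D f.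
Proof.
move=> [f1 f2]; apply: eq_parts; rewrite !partsE /= -!RintegralZl//.
- by rewrite -RintegralB// ?partsE//; try exact: integrableZ_EFin;
  apply: eq_Rintegral => x _; rewrite partsE.
- by rewrite -RintegralD// ?partsE//; try exact: integrableZ_EFin;
  apply: eq_Rintegral => x _; rewrite partsE.
Qed.
Lemma cintN f : cintegrable mu D f -> cint mu D (fun x => - f x) = - cint mu D f.
Proof.
move=> fi; rewrite -mulN1r -cintZ//.
by apply: eq_cint => x _; rewrite mulN1r.
Qed.
Lemma cintB f g : cintegrable mu D f -> cintegrable mu D g ->
  cint mu D (fun x => f x - g x) = cint mu D f - cint mu D g.
Proof.
by move=> fi gi; rewrite cintD ?cintN//; exact: cintegrableN.
Qed.
Lemma cint_conj f : cintegrable mu D f ->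
  cint mu D (fun x => conjc (f x)) = conjc (cint mu D f).
Proof.
move=> [f1 f2]; apply: eq_parts; rewrite !partsE /=.
  by apply: eq_Rintegral => x _; rewrite partsE.
rewrite -mulN1r -RintegralZl//.
by apply: eq_Rintegral => x _; rewrite partsE mulN1r.
Qed.
Lemma cint_sum I (s : seq I) (Q : pred I) (F : I -> X -> R[i]) :
  (forall i, Q i -> cintegrable mu D (F i)) ->
  cint mu D (fun x => \sum_(i <- s | Q i) F i x) =
  \sum_(i <- s | Q i) cint mu D (F i).
Proof.
move=> h; elim: s => [|i s ih].
  by rewrite big_nil -[RHS]cint0; apply: eq_cint => x _; rewrite big_nil.
rewrite big_cons; under eq_cint do rewrite big_cons.
case: (boolP (Q i)) => // Qi; rewrite cintD ?ih//; first exact: h.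
exact: cintegrable_sum.
Qed.
Lemma cint_real (h : X -> R) : cint mu D (fun x => (h x)%:C) = (Rintegral mu D h)%:C.
Proof. by rewrite /cint /= /Rintegral integral0. Qed.

End cintegral.

(** * Semi-inner product spaces *)

Section semi_inner_product.
Context {R : realType} {V : lmodType R[i]}.
Variables (W : V -> Prop) (ip : V -> V -> R[i]).

(** Neither definiteness nor a quotient is built in, and [W] cuts the space out of an ambient
    module. The form of a positive semidefinite matrix, a weighted L_2 space and the space of random
    variables are then instances of one notion. *)
Record semi_inner_product : Prop := SemiInnerProduct {
  sip0 : W 0;
  sipD : forall x y, W x -> W y -> W (x + y);
  sipZ : forall z x, W x -> W (z *: x);
  ipDl : forall x y u, W x -> W y -> W u -> ip (x + y) u = ip x u + ip y u;
  ipZl : forall z x u, W x -> W u -> ip (z *: x) u = z * ip x u;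
  ip_conj : forall x y, W x -> W y -> ip y x = conjc (ip x y);
  ip_ge0 : forall x, W x -> 0 <= complex.Re (ip x x)
}.

Hypothesis hip : semi_inner_product.

Definition sqn x := complex.Re (ip x x).

Lemma sipN x : W x -> W (- x).
Proof. by move=> hx; rewrite -scaleN1r; exact: sipZ. Qed.
Lemma sipB x y : W x -> W y -> W (x - y).
Proof. by move=> hx hy; apply: sipD => //; exact: sipN. Qed.
Lemma sip_sum I (s : seq I) (F : I -> V) : (forall i, W (F i)) ->
  W (\sum_(i <- s) F i).
Proof.
by move=> h; elim: s => [|i s ih]; rewrite ?big_nil ?big_cons;
  [exact: sip0|exact: sipD].
Qed.
Lemma ipNl x u : W x -> W u -> ip (- x) u = - ip x u.
Proof. by move=> hx hu; rewrite -scaleN1r ipZl// mulN1r. Qed.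
Lemma ipBl x y u : W x -> W y -> W u -> ip (x - y) u = ip x u - ip y u.
Proof. by move=> hx hy hu; rewrite ipDl ?ipNl//; exact: sipN. Qed.
Lemma ipDr x u v : W x -> W u -> W v -> ip x (u + v) = ip x u + ip x v.
Proof.
move=> hx hu hv; rewrite (ip_conj hip (sipD hip hu hv) hx) ipDl// rmorphD.
by rewrite /= -!(ip_conj hip).
Qed.
Lemma ipZr z x u : W x -> W u -> ip x (z *: u) = conjc z * ip x u.
Proof.
move=> hx hu; rewrite (ip_conj hip (sipZ hip _ hu) hx) ipZl// rmorphM.
by rewrite /= -!(ip_conj hip).
Qed.
Lemma ipNr x u : W x -> W u -> ip x (- u) = - ip x u.
Proof. by move=> hx hu; rewrite -scaleN1r ipZr// rmorphN1 mulN1r. Qed.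
Lemma ipBr x u v : W x -> W u -> W v -> ip x (u - v) = ip x u - ip x v.
Proof. by move=> hx hu hv; rewrite ipDr ?ipNr//; exact: sipN. Qed.
Lemma ip0l u : W u -> ip 0 u = 0.
Proof. by move=> hu; rewrite -(scale0r 0) ipZl ?mul0r//; exact: sip0. Qed.
Lemma ip_suml I (s : seq I) (F : I -> V) u : (forall i, W (F i)) -> W u ->
  ip (\sum_(i <- s) F i) u = \sum_(i <- s) ip (F i) u.
Proof.
move=> h hu; elim: s => [|i s ih]; first by rewrite !big_nil ip0l.
by rewrite !big_cons ipDl ?ih//; exact: sip_sum.
Qed.
Lemma ip_sqn x : W x -> ip x x = (sqn x)%:C.
Proof.
move=> hx; have := ip_conj hip hx hx => /(congr1 (@complex.Im R)).
rewrite Im_conj => h; apply: eq_parts => //=.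
lra.
Qed.
Lemma sqn_ge0 x : W x -> 0 <= sqn x.
Proof. exact: ip_ge0. Qed.
Lemma sqnZ z x : W x -> sqn (z *: x) = cabs2 z * sqn x.
Proof.
move=> hx; have hzx := sipZ hip z hx.
by rewrite /sqn ipZr// ipZl// mulrA mulrC (mulrC (conjc z)) mulconj ip_sqn//
  !partsE/=; ring.
Qed.
Lemma sqnN x : W x -> sqn (- x) = sqn x.
Proof. by move=> hx; rewrite -scaleN1r sqnZ// cabs2N -[1]/(1%:C) cabs2_real expr1n mul1r. Qed.
Lemma sqnD x y : W x -> W y ->
  sqn (x + y) = sqn x + sqn y + 2 * complex.Re (ip x y).
Proof.
move=> hx hy; have hxy := sipD hip hx hy.
rewrite /sqn ipDl// !ipDr// (ip_conj hip hx hy) !partsE; ring.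
Qed.
(** The parallelogram identity with the square of x - y dropped. *)
Lemma sqnDr_le x y : W x -> W y -> sqn (x + y) <= 2 * sqn x + 2 * sqn y.
Proof.
move=> hx hy; have := sqn_ge0 (sipB hx hy).
rewrite sqnD ?sqnN ?ipNr ?partsE//; last exact: sipN.
rewrite sqnD//; lra.
Qed.
Lemma sqnC x y : W x -> W y -> sqn (x - y) = sqn (y - x).
Proof. by move=> hx hy; rewrite -opprB sqnN//; exact: sipB. Qed.
Lemma sqn_trans x y z : W x -> W y -> W z ->
  sqn (x - z) <= 2 * sqn (x - y) + 2 * sqn (y - z).
Proof.
move=> hx hy hz; have -> : x - z = (x - y) + (y - z) by rewrite addrA subrK.
by apply: sqnDr_le; exact: sipB.
Qed.

(** Positivity of the square of x - t<x,y>y for real t. As the form may be degenerate, a vector y of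
    norm 0 is a separate case: letting t grow then forces <x,y> = 0. Otherwise t = 1/|y|^2 is
    optimal. *)
Lemma ip_cauchy_schwarz x y : W x -> W y -> cabs2 (ip x y) <= sqn x * sqn y.
Proof.
move=> hx hy; set b := ip x y.
have key (z : R[i]) : 0 <= sqn x + cabs2 z * sqn y - 2 * complex.Re (conjc z * b).
  have := sqn_ge0 (sipB hx (sipZ hip z hy)).
  have hzy := sipZ hip z hy; have hnzy := sipN hzy.
  by rewrite sqnD// sqnN// sqnZ// ipNr// ipZr// -/b !partsE; lra.
have bb : complex.Re (conjc b * b) = cabs2 b by rewrite mulrC mulconj.
have q0 := sqn_ge0 hy; have c0 := cabs2_ge0 b.
have key2 (t : R) : 0 <= sqn x + t ^+ 2 * cabs2 b * sqn y - 2 * t * cabs2 b.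
  have := key (t%:C * b); rewrite cabs2M cabs2_real.
  have -> : complex.Re (conjc (t%:C * b) * b) = t * complex.Re (conjc b * b).
    by rewrite !partsE /=; ring.
  by rewrite bb; lra.
have [q1|q1] := eqVneq (sqn y) 0.
  rewrite q1 mulr0 leNgt; apply/negP => c1.
  (* This t makes the linear term equal to 2|x|^2 + 2, which exceeds |x|^2. *)
  have := key2 ((sqn x + 1) / (cabs2 b)); rewrite q1 mulr0 addr0.
  rewrite -mulrA divfK ?gt_eqF//; have := sqn_ge0 hx; lra.
have qp : 0 < sqn y by rewrite lt_def q1.
have := key2 ((sqn y)^-1).
have -> : (sqn y)^-1 ^+ 2 * cabs2 b * sqn y = (sqn y)^-1 * cabs2 b.
  by rewrite expr2; field.
have -> : sqn x + (sqn y)^-1 * cabs2 b - 2 * (sqn y)^-1 * cabs2 b =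
  (sqn x * sqn y - cabs2 b) / sqn y by field.
by rewrite pmulr_lge0 ?invr_gt0// subr_ge0.
Qed.

(** Applied pointwise to a matrix weight, this gives the integrable majorant that makes the inner
    product of two L_2 functions converge. *)
Lemma ip_sqrt_le x y : W x -> W y -> Num.sqrt (cabs2 (ip x y)) <= sqn x + sqn y.
Proof.
move=> hx hy; have h1 := sqn_ge0 hx; have h2 := sqn_ge0 hy.
rewrite -(@ler_pXn2r _ 2)// ?nnegrE ?sqrtr_ge0 ?addr_ge0//.
rewrite sqr_sqrtr ?cabs2_ge0//; apply: (le_trans (ip_cauchy_schwarz hx hy)).
nra.
Qed.

(* A telescoping sum with geometric weights: no square roots are needed. *)
Lemma sqn_sum_geo (f : nat -> V) n k : (forall i, W (f i)) ->
  sqn (\sum_(0 <= i < k) f (n + i)%N) <=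
  \sum_(0 <= i < k) 2 ^+ i.+1 * sqn (f (n + i)%N).
Proof.
move=> h; elim: k n => [|k ih] n.
  by rewrite !big_nil /sqn ip0l//; exact: sip0.
rewrite !big_nat_recl// expr1; apply: (le_trans (sqnDr_le (h _) (sip_sum _ _))) => //.
rewrite lerD2l; under eq_bigr do rewrite -addSnnS.
under [leRHS]eq_bigr do rewrite exprS -mulrA.
under [X in sqn X]eq_bigr do rewrite -addSnnS.
by rewrite -mulr_sumr ler_wpM2l// ih.
Qed.

End semi_inner_product.

(** * The sesquilinear form of a matrix *)

Section bilinear_form.
Context {R : realType} {n : nat}.
Implicit Types (M : 'M[R[i]]_n) (x y u : 'cV[R[i]]_n).

(** As there is no adjoint on the left, a factor of M passes to the first argument transposed and to
    the second conjugated; hence the transposes of inverses in everything that follows. *)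
Definition bform M x y : R[i] := mx11 (x^T *m M *m conjmx y).

Lemma qformE M x : qform M x = complex.Re (bform M x x).
Proof. by []. Qed.

Lemma bform_sum M x y :
  bform M x y = \sum_i \sum_j x i ord0 * M i j * conjc (y j ord0).
Proof.
rewrite /bform /mx11 mxE exchange_big /=; apply: eq_bigr => j _.
rewrite !mxE big_distrl /=; apply: eq_bigr => i _.
by rewrite !mxE.
Qed.

Lemma bformDl M x y u : bform M (x + y) u = bform M x u + bform M y u.
Proof. by rewrite /bform linearD /= !mulmxDl /mx11 mxE. Qed.
Lemma bformZl M z x u : bform M (z *: x) u = z * bform M x u.
Proof. by rewrite /bform linearZ /= -!scalemxAl /mx11 mxE. Qed.

Lemma bform_addmx M M' x y : bform (M + M') x y = bform M x y + bform M' x y.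
Proof. by rewrite /bform mulmxDr mulmxDl /mx11 mxE. Qed.

Lemma conjmxM m p q (A : 'M[R[i]]_(m, p)) (B : 'M[R[i]]_(p, q)) :
  conjmx (A *m B) = conjmx A *m conjmx B.
Proof. by rewrite /conjmx map_mxM. Qed.
Lemma conjmxK m p (A : 'M[R[i]]_(m, p)) : conjmx (conjmx A) = A.
Proof. by apply/matrixP => i j; rewrite !mxE conjcK. Qed.
Lemma conjmx_tr m p (A : 'M[R[i]]_(m, p)) : conjmx A^T = (conjmx A)^T.
Proof. by rewrite /conjmx map_trmx. Qed.

Lemma bform_adj M x y : bform (adjmx M) y x = conjc (bform M x y).
Proof.
rewrite !bform_sum exchange_big rmorph_sum /=; apply: eq_bigr => i _.
rewrite rmorph_sum /=; apply: eq_bigr => j _.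
by rewrite /adjmx /conjmx !mxE !rmorphM /= conjcK; ring.
Qed.

Lemma bform_mull M N x y : bform (N *m M) x y = bform M (N^T *m x) y.
Proof. by rewrite /bform trmx_mul trmxK !mulmxA. Qed.
Lemma bform_mulr M N x y : bform (M *m N) x y = bform M x (conjmx N *m y).
Proof. by rewrite /bform conjmxM conjmxK !mulmxA. Qed.

Lemma psd_sip M : psdmx M ->
  semi_inner_product (fun _ : 'cV[R[i]]_n => True) (bform M).
Proof.
move=> [hM pM]; split => //.
- by move=> *; exact: bformDl.
- by move=> *; exact: bformZl.
- by move=> x y _ _; rewrite -bform_adj hM.
- by move=> x _; exact: pM.
Qed.

Lemma sqn_bform M x : sqn (bform M) x = qform M x.
Proof. by []. Qed.

Lemma psdmxD M M' : psdmx M -> psdmx M' -> psdmx (M + M').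
Proof.
move=> [h p] [h' p']; split; first by rewrite -{2}h -{2}h' /adjmx /conjmx linearD /= map_mxD.
by move=> v; rewrite qformE bform_addmx partsE addr_ge0// ?p ?p'.
Qed.

Lemma adjmx_inv M : adjmx (invmx M) = invmx (adjmx M).
Proof. by rewrite /adjmx /conjmx trmx_inv map_invmx. Qed.

Lemma psdmx_inv M : psdmx M -> psdmx (invmx M).
Proof.
move=> [h p]; case: (boolP (M \in unitmx)) => uM; last first.
  by rewrite /invmx (negbTE uM).
have hi : adjmx (invmx M) = invmx M by rewrite adjmx_inv h.
split=> // v.
have hc : conjmx (invmx M) = (invmx M)^T.
  by rewrite -{2}hi /adjmx conjmx_tr trmxK.
have -> : invmx M = invmx M *m M *m invmx M by rewrite mulVmx// mul1mx.
by rewrite qformE bform_mulr bform_mull hc; exact: p.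
Qed.

Lemma qform0 M : qform M 0 = 0.
Proof. by rewrite /qform /mx11 trmx0 !mul0mx mxE. Qed.

End bilinear_form.

(** * Measurability of matrix functions *)

Section matrix_measurability.
Context {R : realType} {d : measure_display} {X : measurableType d}.
Variable D : set X.

Lemma mxmeasurableD m n (f g : X -> 'M[R[i]]_(m, n)) : mxmeasurable D f ->
  mxmeasurable D g -> mxmeasurable D (fun x => f x + g x).
Proof.
by move=> mf mg i j; under eq_fun do rewrite mxE; exact: cmeasurableD.
Qed.
Lemma mxmeasurableN m n (f : X -> 'M[R[i]]_(m, n)) : mxmeasurable D f ->
  mxmeasurable D (fun x => - f x).
Proof. by move=> mf i j; under eq_fun do rewrite mxE; exact: cmeasurableN. Qed.
Lemma mxmeasurableB m n (f g : X -> 'M[R[i]]_(m, n)) : mxmeasurable D f ->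
  mxmeasurable D g -> mxmeasurable D (fun x => f x - g x).
Proof. by move=> mf mg; apply: mxmeasurableD => //; exact: mxmeasurableN. Qed.
Lemma mxmeasurableZ m n (c : X -> R[i]) (f : X -> 'M[R[i]]_(m, n)) :
  cmeasurable D c -> mxmeasurable D f -> mxmeasurable D (fun x => c x *: f x).
Proof.
by move=> mc mf i j; under eq_fun do rewrite mxE; exact: cmeasurableM.
Qed.
Lemma mxmeasurable_cst m n (A : 'M[R[i]]_(m, n)) : mxmeasurable D (fun=> A).
Proof. by move=> i j; exact: cmeasurable_cst. Qed.
Lemma mxmeasurable_tr m n (f : X -> 'M[R[i]]_(m, n)) : mxmeasurable D f ->
  mxmeasurable D (fun x => (f x)^T).
Proof. by move=> mf i j; under eq_fun do rewrite mxE; exact: mf. Qed.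
Lemma mxmeasurable_conj m n (f : X -> 'M[R[i]]_(m, n)) : mxmeasurable D f ->
  mxmeasurable D (fun x => conjmx (f x)).
Proof.
by move=> mf i j; under eq_fun do rewrite mxE; exact: cmeasurable_conj.
Qed.
Lemma mxmeasurableM m n p (f : X -> 'M[R[i]]_(m, n)) (g : X -> 'M[R[i]]_(n, p)) :
  mxmeasurable D f -> mxmeasurable D g -> mxmeasurable D (fun x => f x *m g x).
Proof.
move=> mf mg i j; under eq_fun do rewrite mxE.
by apply: cmeasurable_sum => k _; exact: cmeasurableM.
Qed.
Lemma cmeasurable_det n (f : X -> 'M[R[i]]_n) : mxmeasurable D f ->
  cmeasurable D (fun x => \det (f x)).
Proof.
move=> mf; apply: cmeasurable_sum => s _; apply: cmeasurableM.
  exact: cmeasurable_cst.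
by apply: cmeasurable_prod => i _; exact: mf.
Qed.
Lemma mxmeasurable_inv n (f : X -> 'M[R[i]]_n) : mxmeasurable D f ->
  mxmeasurable D (fun x => invmx (f x)).
Proof.
move=> mf; have md := cmeasurable_det mf.
(* [0^-1 = 0], so that this formula also covers the singular matrices. *)
have -> : (fun x => invmx (f x)) = (fun x => (\det (f x))^-1 *: \adj (f x) +
    (1 - (\det (f x))^-1 * \det (f x)) *: f x).
  apply/funext => x; rewrite /invmx unitmxE unitfE.
  case: eqVneq => [->|d0]; first by rewrite invr0 mul0r subr0 scale0r scale1r add0r.
  by rewrite /= mulVf// subrr scale0r addr0.
apply: mxmeasurableD; apply: mxmeasurableZ => //.
- exact: cmeasurableV.
- move=> i j; under eq_fun do rewrite mxE /cofactor.
  apply: cmeasurableM; first exact: cmeasurable_cst.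
  by apply: cmeasurable_det => k l; under eq_fun do rewrite !mxE; exact: mf.
- apply: cmeasurableD; first exact: cmeasurable_cst.
  by apply: cmeasurableN; apply: cmeasurableM => //; exact: cmeasurableV.
Qed.
Lemma cmeasurable_bform n (K : X -> 'M[R[i]]_n) (g h : X -> 'cV[R[i]]_n) :
  mxmeasurable D K -> mxmeasurable D g -> mxmeasurable D h ->
  cmeasurable D (fun x => bform (K x) (g x) (h x)).
Proof.
move=> mK mg mh; rewrite /bform /mx11.
apply: mxmeasurableM; last exact: mxmeasurable_conj.
by apply: mxmeasurableM => //; exact: mxmeasurable_tr.
Qed.
Lemma measurable_qform n (K : X -> 'M[R[i]]_n) (h : X -> 'cV[R[i]]_n) :
  mxmeasurable D K -> mxmeasurable D h ->
  measurable_fun D (fun x => qform (K x) (h x)).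
Proof. by move=> mK mh; have [] := cmeasurable_bform mK mh mh. Qed.

End matrix_measurability.

(** * L_2 spaces with a matrix weight *)

Section weighted_L2.
Context {R : realType} {d : measure_display} {X : measurableType d}.
Variable mu : {measure set X -> \bar R}.
Context {n : nat}.
Implicit Types (K : X -> 'M[R[i]]_n) (g h : X -> 'cV[R[i]]_n).

(** Integrability of the real function is required instead of a finite extended integral; the two
    agree for a weight that is positive semidefinite almost everywhere, by [wL2P]. *)
Definition wL2 K h := mxmeasurable setT h /\
  mu.-integrable setT (EFin \o (fun x => qform (K x) (h x))).
Definition wip K g h : R[i] := cint mu setT (fun x => bform (K x) (g x) (h x)).

Lemma sqn_wip K h : sqn (wip K) h = Rintegral mu setT (fun x => qform (K x) (h x)).
Proof. by []. Qed.

Lemma wL2_sqnE K h : wL2 K h ->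
  (\int[mu]_x (qform (K x) (h x))%:E = (sqn (wip K) h)%:E)%E.
Proof. by move=> [_ hi]; rewrite integrable_EFin_Rintegral. Qed.

Variable K : X -> 'M[R[i]]_n.
Hypotheses (mK : mxmeasurable setT K) (pK : {ae mu, forall x, psdmx (K x)}).

Lemma wL2P h : mxmeasurable setT h ->
  (\int[mu]_x (qform (K x) (h x))%:E < +oo)%E -> wL2 K h.
Proof.
move=> mh hi; split=> //; apply: ge0_fin_integrable => //.
  exact: measurable_qform.
by apply: filterS pK => x px _; exact: px.2.
Qed.

Lemma wL2_le h (f : X -> R) : mxmeasurable setT h ->
  mu.-integrable setT (EFin \o f) -> {ae mu, forall x, qform (K x) (h x) <= f x} ->
  wL2 K h.
Proof.
move=> mh fi hf; split=> //; apply: ae_le_integrable fi _ => //.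
  exact: measurable_qform.
apply: filterS2 pK hf => x px le _.
by rewrite ger0_norm//; exact: px.2.
Qed.

Lemma wL2_bform g h : wL2 K g -> wL2 K h ->
  cintegrable mu setT (fun x => bform (K x) (g x) (h x)).
Proof.
move=> [mg gi] [mh hi].
apply: (@cintegrable_dom _ _ _ _ _ measurableT _
  (fun x => qform (K x) (g x) + qform (K x) (h x))).
- exact: cmeasurable_bform.
- exact: integrableD_EFin.
- apply: filterS pK => x px _.
  exact: (ip_sqrt_le (psd_sip px)).
Qed.

(** Each law is integrated from the same law for the form of the weight at almost every point. *)
Lemma wL2_sip : semi_inner_product (wL2 K) (wip K).
Proof.
split.
- split; first exact: mxmeasurable_cst.
  apply: eq_integrable (integrable0 mu setT) => // x _ /=.
  by rewrite qform0.
- move=> g h [mg gi] [mh hi].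
  apply: (@wL2_le _ (fun x => 2 * qform (K x) (g x) + 2 * qform (K x) (h x))).
  + exact: mxmeasurableD.
  + by apply: integrableD_EFin => //; exact: integrableZ_EFin.
  + apply: filterS pK => x px; exact: (sqnDr_le (psd_sip px)).
- move=> z g [mg gi]; apply: (@wL2_le _ (fun x => cabs2 z * qform (K x) (g x))).
  + by apply: mxmeasurableZ => //; exact: cmeasurable_cst.
  + exact: integrableZ_EFin.
  + by apply: filterS pK => x px; rewrite -sqn_bform (sqnZ (psd_sip px)).
- move=> g h u hg hh hu; rewrite /wip -cintD//; try exact: wL2_bform.
  by apply: eq_cint => x _; rewrite -bformDl.
- move=> z g u hg hu; rewrite /wip -cintZ//; last exact: wL2_bform.
  by apply: eq_cint => x _; rewrite -bformZl.
- move=> g h hg hh; rewrite /wip -cint_conj//; last exact: wL2_bform.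
  apply: ae_eq_cint => //.
  + by apply: cmeasurable_bform => //; [case: hh|case: hg].
  + by apply: cmeasurable_conj; apply: cmeasurable_bform => //; [case: hg|case: hh].
  + by apply: filterS pK => x px _; rewrite (ip_conj (psd_sip px)).
- move=> g [mg gi]; apply: ae_ge0_Rintegral => //.
    exact: measurable_qform.
  by apply: filterS pK => x px _; exact: px.2.
Qed.

End weighted_L2.

(** * Limits of complex sequences *)

Section complex_limits.
Context {R : realType}.
Implicit Types (u v : nat -> R[i]) (l m : R[i]).

Definition ccvg u l : Prop :=
  (complex.Re (u n) @[n --> \oo] --> complex.Re l) /\
  (complex.Im (u n) @[n --> \oo] --> complex.Im l).

Lemma ccvg_cst l : ccvg (fun=> l) l.
Proof. by split; exact: cvg_cst. Qed.
Lemma ccvgD u v l m : ccvg u l -> ccvg v m -> ccvg (fun n => u n + v n) (l + m).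
Proof.
move=> [u1 u2] [v1 v2]; split; rewrite !partsE; under eq_fun do rewrite partsE;
  exact: cvgD.
Qed.
Lemma ccvgN u l : ccvg u l -> ccvg (fun n => - u n) (- l).
Proof.
by move=> [u1 u2]; split; rewrite !partsE; under eq_fun do rewrite partsE; exact: cvgN.
Qed.
Lemma ccvgB u v l m : ccvg u l -> ccvg v m -> ccvg (fun n => u n - v n) (l - m).
Proof. by move=> ul vm; apply: ccvgD => //; exact: ccvgN. Qed.
Lemma ccvgM u v l m : ccvg u l -> ccvg v m -> ccvg (fun n => u n * v n) (l * m).
Proof.
move=> [u1 u2] [v1 v2]; split; rewrite !partsE; under eq_fun do rewrite partsE.
  by apply: cvgB; exact: cvgM.
by apply: cvgD; exact: cvgM.
Qed.
Lemma ccvg_conj u l : ccvg u l -> ccvg (fun n => conjc (u n)) (conjc l).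
Proof.
move=> [u1 u2]; split; rewrite !partsE; under eq_fun do rewrite partsE; first by [].
exact: cvgN.
Qed.
Lemma ccvg_sum I (s : seq I) (F : I -> nat -> R[i]) (L : I -> R[i]) :
  (forall i, ccvg (F i) (L i)) ->
  ccvg (fun n => \sum_(i <- s) F i n) (\sum_(i <- s) L i).
Proof.
move=> h; elim: s => [|i s ih].
  by rewrite big_nil; under eq_fun do rewrite big_nil; exact: ccvg_cst.
by rewrite big_cons; under eq_fun do rewrite big_cons; exact: ccvgD.
Qed.
Lemma ccvg_unique u l m : ccvg u l -> ccvg u m -> l = m.
Proof.
by move=> [l1 l2] [m1 m2]; apply: eq_parts; [move: l1 m1|move: l2 m2]; apply: cvg_unique.
Qed.
Lemma ccvg_shift i u l : ccvg u l -> ccvg (fun j => u (i + j)%N) l.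
Proof.
by move=> [a1 a2]; split; [move: a1|move: a2]; rewrite -(cvg_shiftn i) /=;
  under eq_fun do rewrite addnC.
Qed.
Lemma ccvg_cabs2 u l : (cabs2 (u n - l) @[n --> \oo] --> (0 : R)) -> ccvg u l.
Proof.
have aux (a : nat -> R) (b : R) (c : nat -> R) : c n @[n --> \oo] --> (0 : R) ->
    (forall n, (a n - b) ^+ 2 <= c n) -> a n @[n --> \oo] --> b.
  move=> c0 h; apply/cvgrPdist_lt => /= e e0.
  move/cvgrPdist_lt : c0 => /(_ (e ^+ 2)); rewrite exprn_gt0// => /(_ isT).
  apply: filterS => n; rewrite sub0r normrN => hn.
  rewrite distrC -(@ltr_pXn2r _ 2)// ?nnegrE ?ltW//.
  rewrite real_normK ?num_real//; apply: (le_lt_trans (h n)).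
  exact: le_lt_trans (ler_norm _) hn.
by move=> h; split; apply: aux h _ => n; rewrite /cabs2 !partsE ?lerDl ?lerDr sqr_ge0.
Qed.
Lemma ccvg_le u l (e : nat -> R) : (forall n, cabs2 (u n - l) <= e n) ->
  e n @[n --> \oo] --> (0 : R) -> ccvg u l.
Proof.
move=> h e0; apply: ccvg_cabs2; apply: squeeze_cvgr e0; last exact: cvg_cst.
by apply: nearW => n; rewrite cabs2_ge0 h.
Qed.

Lemma ccvg_bform n (M : 'M[R[i]]_n) (x y : nat -> 'cV[R[i]]_n)
    (a b : 'cV[R[i]]_n) :
  (forall k, ccvg (fun j => x j k ord0) (a k ord0)) ->
  (forall k, ccvg (fun j => y j k ord0) (b k ord0)) ->
  ccvg (fun j => bform M (x j) (y j)) (bform M a b).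
Proof.
move=> xa yb; rewrite bform_sum; under eq_fun do rewrite bform_sum.
apply: ccvg_sum => i; apply: ccvg_sum => j; apply: ccvgM; last exact: ccvg_conj.
by apply: ccvgM => //; exact: ccvg_cst.
Qed.

Lemma cvg_geo_dist (a : nat -> R) (c : R) :
  (forall n j, (a (n + j)%N - a n) ^+ 2 <= c * 2^-1 ^+ n) -> cvgn a.
Proof.
move=> h; apply/cauchy_cvgP/cauchy_exP => e e0.
have : geometric c (2^-1 : R) n @[n --> \oo] --> (0 : R).
  by apply: cvg_geometric; rewrite gtr0_norm ?invr_gt0// invf_lt1// ltr1n.
move/cvgrPdist_lt => /(_ (e ^+ 2)); rewrite exprn_gt0// => /(_ isT) [N _ hN].
exists (a N); exists N => // m /= Nm; rewrite /ball /=.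
have := hN N (leqnn N); rewrite sub0r normrN /geometric /= => hc.
rewrite distrC -(@ltr_pXn2r _ 2)// ?nnegrE ?ltW//.
rewrite real_normK ?num_real// -(subnKC Nm); apply: (le_lt_trans (h _ _)).
exact: le_lt_trans (ler_norm _) hc.
Qed.

Lemma ccvg_geo_dist u (c : R) :
  (forall n j, cabs2 (u (n + j)%N - u n) <= c * 2^-1 ^+ n) -> exists l, ccvg u l.
Proof.
move=> h.
have h1 n j : (complex.Re (u (n + j)%N) - complex.Re (u n)) ^+ 2 <= c * 2^-1 ^+ n.
  by apply: le_trans (h n j); rewrite /cabs2 !partsE lerDl sqr_ge0.
have h2 n j : (complex.Im (u (n + j)%N) - complex.Im (u n)) ^+ 2 <= c * 2^-1 ^+ n.
  by apply: le_trans (h n j); rewrite /cabs2 !partsE lerDr sqr_ge0.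
have /cvg_ex[l1 c1] := @cvg_geo_dist (fun n => complex.Re (u n)) c h1.
have /cvg_ex[l2 c2] := @cvg_geo_dist (fun n => complex.Im (u n)) c h2.
by exists (l1 +i* l2); split.
Qed.

(* [limn_esup] is everywhere defined, hence measurable in a parameter. *)
Definition clim u : R[i] :=
  fine (limn_esup (fun n => (complex.Re (u n))%:E)) +i*
  fine (limn_esup (fun n => (complex.Im (u n))%:E)).

Lemma clim_ccvg u l : ccvg u l -> clim u = l.
Proof.
have aux (a : nat -> R) (b : R) : a n @[n --> \oo] --> b ->
    fine (limn_esup (fun n => (a n)%:E)) = b.
  move=> ab; have h : (a n)%:E @[n --> \oo] --> b%:E by exact: cvg_EFin (nearW _ _) ab.
  rewrite is_cvg_limn_esupE; first by rewrite (cvg_lim _ h).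
  by apply/cvg_ex; exists b%:E.
by move=> [u1 u2]; apply: eq_parts => /=; exact: aux.
Qed.

Lemma cmeasurable_clim d (X : measurableType d) (D : set X) (f : nat -> X -> R[i]) :
  (forall n, cmeasurable D (f n)) -> cmeasurable D (fun x => clim (f^~ x)).
Proof.
move=> mf; split=> /=; apply: (measurable_comp measurableT) => //;
  try exact: fine_measurable;
  by apply: measurable_fun_limn_esup => n; apply/measurable_EFinP; case: (mf n).
Qed.

End complex_limits.

(** * Completeness of the weighted L_2 space *)

Section completeness.
Context {R : realType} {d : measure_display} {X : measurableType d}.
Variable mu : {measure set X -> \bar R}.
Context {n : nat} (K : X -> 'M[R[i]]_n).
Hypotheses (mK : mxmeasurable setT K) (pK : {ae mu, forall x, psdmx (K x)})
  (uK : {ae mu, forall x, K x \in unitmx}).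

(** The k-th coordinate is the inner product with the conjugate of M^{-1} e_k, so Cauchy-Schwarz
    bounds it. Convergence for an invertible weight is thus convergence of coordinates. *)
Lemma coord_qform (M : 'M[R[i]]_n) k : psdmx M -> M \in unitmx ->
  exists c : R, forall y : 'cV[R[i]]_n, cabs2 (y k ord0) <= c * qform M y.
Proof.
move=> pM uM; pose z : 'cV_n := conjmx (invmx M *m delta_mx k ord0).
exists (qform M z) => y; have -> : y k ord0 = bform M y z.
  rewrite /bform /z conjmxK -mulmxA mulKVmx// /mx11 mxE (bigD1 k)//= big1 ?addr0.
    by rewrite !mxE !eqxx mulr1.
  by move=> i ik; rewrite !mxE (negbTE ik) /= mulr0.
rewrite mulrC; exact: (ip_cauchy_schwarz (psd_sip pM)).
Qed.

(** The Riesz-Fischer argument for a rapidly Cauchy sequence. A weighted sum of the squared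
    increments is integrable, hence finite almost everywhere; there it controls all differences
    geometrically, and an invertible weight makes the coordinates converge. The same pointwise
    bound, integrated, gives the rate. *)
Lemma wL2_complete (g : nat -> X -> 'cV[R[i]]_n) :
  (forall i, wL2 mu K (g i)) ->
  (forall i, sqn (wip mu K) (g i.+1 - g i) <= 4^-1 ^+ i) ->
  exists h, wL2 mu K h /\
    exists C : R, forall i, sqn (wip mu K) (g i - h) <= C * 2^-1 ^+ i.
Proof.
move=> hg hd; have sip := wL2_sip mK pK.
have hdW i j : wL2 mu K (g i - g j) by exact: (sipB sip).
pose f i := g i.+1 - g i.
have hfW i : wL2 mu K (f i) by exact: hdW.
(* The weight 2^i is the one of [sqn_sum_geo]; against increments of size 4^{-i} it leaves integrals
   of at most 2^{-i}. The absolute value makes u nonnegative also at the exceptional points of the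
   weight. *)
pose u i x := 2 ^+ i * `|qform (K x) (f i x)|.
have mq h : wL2 mu K h -> measurable_fun setT (fun x => qform (K x) (h x)).
  by move=> [mh _]; exact: measurable_qform.
have mu_ i : measurable_fun setT (u i).
  by apply: measurable_funM => //; apply: measurableT_comp => //; exact: mq.
have u0 i x : 0 <= u i x by rewrite mulr_ge0// exprn_ge0.
pose M x := (\sum_(0 <= i <oo) (u i x)%:E)%E.
have mM : measurable_fun setT M.
  apply: (ge0_emeasurable_sum (h := fun i x => (u i x)%:E) (P := xpredT)).
    by move=> k x _ _; rewrite lee_fin.
  by move=> k _; exact/measurable_EFinP.
have M0 x : (0 <= M x)%E by apply: nneseries_ge0 => i _ _; rewrite lee_fin.
have intu i : (\int[mu]_x (u i x)%:E = (2 ^+ i * sqn (wip mu K) (f i))%:E)%E.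
  have [_ iq] := hfW i.
  have iu : mu.-integrable setT (EFin \o u i).
    by apply: integrableZ_EFin => //; exact: (integrable_abse iq).
  rewrite (integrable_EFin_Rintegral measurableT iu) RintegralZl//; last first.
    exact: (integrable_abse iq).
  congr ((_ * _)%:E); apply: ae_eq_Rintegral => //.
  - by apply: measurableT_comp => //; exact: mq.
  - exact: mq.
  - by apply: filterS pK => x px _; rewrite ger0_norm//; exact: px.2.
have iM : (\int[mu]_x M x <= 2%:E)%E.
  rewrite integral_nneseries//; last 2 first.
  - by move=> i; exact/measurable_EFinP.
  - by move=> i x _; rewrite lee_fin.
  (* The terms 2/2^{i+1} = 2^{-i} sum to at most 2. *)
  apply: le_trans (epsilon_trick0 xpredT (ler0n R 2)).
  apply: lee_nneseries => [i _ _|i _]; first by apply: integral_ge0 => x _; rewrite lee_fin.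
  rewrite intu lee_fin natrX exprS invfM mulrA divff// mul1r -exprVn.
  apply: (le_trans (ler_wpM2l _ (hd i))); first exact: exprn_ge0.
  by rewrite -exprMn (_ : 2 * 4^-1 = 2^-1 :> R)//; field.
have intM : mu.-integrable setT M.
  apply/integrableP; split=> //.
  under eq_integral do rewrite gee0_abs//.
  by apply: (le_lt_trans iM); rewrite ltry.
have finM : {ae mu, forall x, M x \is a fin_num}.
  by apply: filterS (integrable_ae measurableT intM) => x; exact.
pose m x := fine (M x).
have intm : mu.-integrable setT (EFin \o m).
  apply/integrableP; split.
    by apply/measurable_EFinP; apply: (measurable_comp measurableT) => //;
      exact: fine_measurable.
  apply: le_lt_trans (_ : (\int[mu]_x M x < +oo)%E); last first.
    by apply: (le_lt_trans iM); rewrite ltry.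
  apply: ae_ge0_le_integral => //=.
  - by apply/measurable_EFinP; apply: measurableT_comp => //;
    apply: (measurable_comp measurableT) => //; exact: fine_measurable.
  - by apply: filterS finM => x fx _; rewrite ger0_norm ?fine_ge0// fineK.
(* The telescoped difference has square at most the sum of 2^{k+1} |f_{i+k}|^2, which is 2 * 2^{-i}
   times a partial sum of the series defining M. *)
have key x : psdmx (K x) -> M x \is a fin_num -> forall i j,
    qform (K x) (g (i + j)%N x - g i x) <= 2 * m x * 2^-1 ^+ i.
  move=> px fx i j.
  have -> : g (i + j)%N x - g i x = \sum_(0 <= k < j) f (i + k)%N x.
    elim: j => [|j ih]; first by rewrite addn0 subrr big_nil.
    rewrite big_nat_recr//= -ih addnS /f.
    change ((g (i + j).+1 - g (i + j)%N) x) with (g (i + j).+1 x - g (i + j)%N x).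
    by rewrite addrC addrA subrK.
  have := @sqn_sum_geo _ _ _ _ (psd_sip px) (fun k => f k x) i j (fun=> I).
  rewrite sqn_bform => /le_trans; apply.
  have -> : \sum_(0 <= k < j) 2 ^+ k.+1 * sqn (bform (K x)) (f (i + k)%N x) =
      2 * 2^-1 ^+ i * \sum_(0 <= k < j) u (i + k)%N x.
    rewrite mulr_sumr; apply: eq_bigr => k _.
    rewrite /u ger0_norm; last exact: px.2.
    rewrite exprD exprS -mulrA -[RHS]mulrA; congr (_ * _).
    by rewrite !mulrA -exprMn mulVf// expr1n mul1r.
  rewrite -mulrA [leRHS]mulrAC -[leRHS]mulrA ler_wpM2l// ler_wpM2l//.
  rewrite -lee_fin fineK// -sumEFin.
  apply: le_trans (nneseries_lim_ge (u_ := fun k => (u k x)%:E) (i + j) _); last first.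
    by move=> k _ _; rewrite lee_fin.
  rewrite [leRHS](big_cat_nat (n := i)) ?leq_addr//= -[X in (X <= _)%E]add0e.
  apply: leeD; first by apply: sume_ge0 => k _; rewrite lee_fin.
  by rewrite -{1}[i in leRHS]add0n big_addn addKn; under eq_bigr do rewrite addnC.
pose h x : 'cV[R[i]]_n := \col_k clim (fun i => g i x k ord0).
have mh : mxmeasurable setT h.
  move=> k l; rewrite ord1; under eq_fun do rewrite mxE.
  by apply: cmeasurable_clim => i; have [+ _] := hg i; exact.
have key2 : {ae mu, forall x, forall i,
    qform (K x) (g i x - h x) <= 2 * m x * 2^-1 ^+ i}.
  apply: filterS3 pK uK finM => x px ux fx i.
  have gh k : ccvg (fun j => g j x k ord0) (h x k ord0).
    have [c hc] := coord_qform k px ux.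
    have [|l hl] := @ccvg_geo_dist _ (fun j => g j x k ord0) (`|c| * (2 * m x)).
      move=> j j'; have := hc (g (j + j')%N x - g j x); rewrite !mxE => /le_trans; apply.
      apply: (@le_trans _ _ (`|c| * qform (K x) (g (j + j')%N x - g j x))).
        by rewrite ler_wpM2r ?ler_norm//; exact: px.2.
      by rewrite -mulrA ler_wpM2l// key.
    by rewrite mxE (clim_ccvg hl).
  (* The bound [key] does not depend on j, so it survives the limit in j. *)
  have [+ _] : ccvg (fun j => bform (K x) (g i x - g (i + j)%N x) (g i x - g (i + j)%N x))
      (bform (K x) (g i x - h x) (g i x - h x)).
    have h' k : ccvg (fun j => (g i x - g (i + j)%N x) k ord0) ((g i x - h x) k ord0).
      rewrite !mxE; under eq_fun do rewrite !mxE.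
      apply: ccvgB; first exact: ccvg_cst.
      by have := gh k; rewrite mxE; exact: ccvg_shift.
    exact: ccvg_bform.
  move=> c1; apply: (cvgr_to_le c1); apply: nearW => j.
  have := sqnC (psd_sip px) I I => /(_ (g i x) (g (i + j)%N x)).
  by rewrite !sqn_bform !qformE => ->; exact: key.
have intc (c : R) : mu.-integrable setT (EFin \o (fun x => 2 * m x * c)).
  apply: eq_integrable (integrableZ_EFin measurableT (2 * c) intm) => // x _ /=.
  by rewrite mulrAC.
have hW i : wL2 mu K (g i - h).
  apply: (@wL2_le _ _ _ _ _ _ mK pK _ (fun x => 2 * m x * 2^-1 ^+ i)).
  - by have [mg _] := hg i; exact: mxmeasurableB.
  - exact: intc.
  - by apply: filterS key2 => x; exact.
have hh : wL2 mu K h.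
  by have := sipB sip (hg 0%N) (hW 0%N); rewrite subKr.
exists h; split=> //; exists (2 * Rintegral mu setT m) => i.
rewrite sqn_wip -[X in _ <= X * _]RintegralZl// -RintegralZr//; last first.
  exact: integrableZ_EFin.
apply: ae_le_Rintegral => //; first by case: (hW i).
by apply: filterS key2 => x hx _; exact: hx.
Qed.

End completeness.

(** * Exchange of integrals against a bounded kernel *)

Section fubini_kernel.
Context {R : realType} {d1 d2 : measure_display}.
Context {X : measurableType d1} {Y : measurableType d2}.
Variable m1 : {sigma_finite_measure set X -> \bar R}.
Variable m2 : {sigma_finite_measure set Y -> \bar R}.

Lemma measurable_fun_fine d (Z : measurableType d) (f : Z -> \bar R) :
  measurable_fun setT f -> measurable_fun setT (fun x => fine (f x)).
Proof. by move=> mf; apply: (measurableT_comp _ mf); exact: fine_measurable. Qed.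

(** No integrability in the inner variable is assumed: Tonelli applies to the positive and negative
    parts, and [fine] is measurable on all extended reals. *)
Lemma measurable_Rintegral_param (h : X * Y -> R) : measurable_fun setT h ->
  measurable_fun setT (fun x => Rintegral m2 setT (fun y => h (x, y))).
Proof.
move=> mh; apply: measurable_fun_fine.
have mE : measurable_fun setT (EFin \o h) by exact/measurable_EFinP.
under eq_fun do rewrite integralE.
apply: emeasurable_funB.
  apply: eq_measurable_fun (measurable_fun_fubini_tonelli_F (m2 := m2) _
    (measurable_funepos mE) (fun z => funepos_ge0 _ z)) => x _.
  by apply: eq_integral => y _; rewrite !funeposE.
apply: eq_measurable_fun (measurable_fun_fubini_tonelli_F (m2 := m2) _
  (measurable_funeneg mE) (fun z => funeneg_ge0 _ z)) => x _.
by apply: eq_integral => y _; rewrite !funenegE.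
Qed.

Lemma cmeasurable_cint_param (h : X * Y -> R[i]) : cmeasurable setT h ->
  cmeasurable setT (fun x => cint m2 setT (fun y => h (x, y))).
Proof.
by move=> [h1 h2]; split; [exact: (measurable_Rintegral_param h1)|
  exact: (measurable_Rintegral_param h2)].
Qed.

Lemma cmeasurable_fst (f : X -> R[i]) : cmeasurable setT f ->
  cmeasurable setT (fun z : X * Y => f z.1).
Proof.
by move=> [f1 f2]; split; [apply: (measurableT_comp f1)|apply: (measurableT_comp f2)];
  exact: measurable_fst.
Qed.
Lemma cmeasurable_snd (f : Y -> R[i]) : cmeasurable setT f ->
  cmeasurable setT (fun z : X * Y => f z.2).
Proof.
by move=> [f1 f2]; split; [apply: (measurableT_comp f1)|apply: (measurableT_comp f2)];
  exact: measurable_snd.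
Qed.
Lemma cmeasurable_pair (h : X * Y -> R[i]) x : cmeasurable setT h ->
  cmeasurable setT (fun y => h (x, y)).
Proof. by move=> [h1 h2]; split; [move: h1|move: h2]; exact: measurable_fun_pair2. Qed.
Lemma cmeasurable_pairr (h : X * Y -> R[i]) y : cmeasurable setT h ->
  cmeasurable setT (fun x => h (x, y)).
Proof. by move=> [h1 h2]; split; [move: h1|move: h2]; exact: measurable_fun_pair1. Qed.

(** [Rintegral] turns infinite inner integrals into 0, but these occur only on a null set. *)
Lemma Rfubini (h : X * Y -> R) : (m1 \x m2)%E.-integrable setT (EFin \o h) ->
  Rintegral m1 setT (fun x => Rintegral m2 setT (fun y => h (x, y))) =
  Rintegral m2 setT (fun y => Rintegral m1 setT (fun x => h (x, y))).
Proof.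
move=> hi; rewrite /Rintegral; congr fine.
have -> : (\int[m1]_x (fine (\int[m2]_y (h (x, y))%:E))%:E =
    \int[m1]_x \int[m2]_y (EFin \o h) (x, y))%E.
  apply: ae_eq_integral => //.
  - by apply/measurable_EFinP; apply: measurable_fun_fine; exact: measurable_fubini_F hi.
  - exact: measurable_fubini_F hi.
  - have := integrable_ae measurableT (integrable_fubini_F hi).
    by apply: filterS => x h1 Dx; rewrite fineK//; exact: h1.
rewrite Fubini//; apply: ae_eq_integral => //.
- exact: measurable_fubini_G hi.
- by apply/measurable_EFinP; apply: measurable_fun_fine; exact: measurable_fubini_G hi.
- have := ae_integrable2 hi.
  by apply: filterS => y h1 _; rewrite fineK//; exact: (integrable_fin_num measurableT h1).
Qed.

Lemma cfubini (h : X * Y -> R[i]) : cintegrable (m1 \x m2)%E setT h ->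
  cint m1 setT (fun x => cint m2 setT (fun y => h (x, y))) =
  cint m2 setT (fun y => cint m1 setT (fun x => h (x, y))).
Proof.
by move=> [h1 h2]; rewrite /cint; congr Complex; rewrite /=;
  [exact: (Rfubini h1)|exact: (Rfubini h2)].
Qed.

Lemma integrable_prod_mul (f : X -> R) (g : Y -> R) :
  m1.-integrable setT (EFin \o f) -> m2.-integrable setT (EFin \o g) ->
  (m1 \x m2)%E.-integrable setT (EFin \o (fun z => f z.1 * g z.2)).
Proof.
move=> fi gi; have mf := integrable_mfun fi; have mg := integrable_mfun gi.
apply/integrable12ltyP.
  apply/measurable_EFinP; apply: measurable_funM.
    by apply: (measurableT_comp mf); exact: measurable_fst.
  by apply: (measurableT_comp mg); exact: measurable_snd.
have gi' : m2.-integrable setT (EFin \o (fun y => `|g y|)) by exact: (integrable_abse gi).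
have fi' : m1.-integrable setT (EFin \o (fun y => `|f y|)) by exact: (integrable_abse fi).
rewrite (eq_integral (EFin \o (fun x => `|f x| * Rintegral m2 setT (fun y => `|g y|)))).
  rewrite integrable_EFin_Rintegral ?ltry//.
  apply: eq_integrable (integrableZ_EFin measurableT
    (Rintegral m2 setT (fun y => `|g y|)) fi') => // x _ /=.
  by rewrite mulrC.
move=> x _ /=; rewrite -RintegralZl// -(integrable_EFin_Rintegral measurableT).
  by apply: eq_integral => y _ /=; rewrite normrM.
exact: integrableZ_EFin.
Qed.

Variables (k : X * Y -> R[i]) (M : R).
Hypotheses (mk : cmeasurable setT k) (bk : forall z, cabs2 (k z) <= M).

(** A product of integrable functions of separate variables is integrable for the product measure,
    and stays so after multiplication by a bounded kernel. The kernels to come are the complex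
    exponential and the Poisson kernel. *)
Lemma cfubini_kernel (f : X -> R[i]) (g : Y -> R[i]) :
  cintegrable m1 setT f -> cintegrable m2 setT g ->
  cint m1 setT (fun x => f x * cint m2 setT (fun y => k (x, y) * g y)) =
  cint m2 setT (fun y => g y * cint m1 setT (fun x => k (x, y) * f x)).
Proof.
move=> fi gi; have mf := cintegrable_meas fi; have mg := cintegrable_meas gi.
have hi : cintegrable (m1 \x m2)%E setT (fun z => k z * (f z.1 * g z.2)).
  apply: (@cintegrableM_bounded _ _ _ _ _ measurableT _ _ M) => //.
  apply: (@cintegrable_dom _ _ _ _ _ measurableT _
    (fun z => Num.sqrt (cabs2 (f z.1)) * Num.sqrt (cabs2 (g z.2)))).
  - by apply: cmeasurableM; [exact: cmeasurable_fst|exact: cmeasurable_snd].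
  - apply: (integrable_prod_mul (f := fun x => Num.sqrt (cabs2 (f x)))
      (g := fun x => Num.sqrt (cabs2 (g x)))); exact: cintegrable_abs.
  - by apply: aeW => z _; rewrite cabs2M sqrtrM ?cabs2_ge0.
transitivity (cint m1 setT (fun x => cint m2 setT (fun y =>
    k (x, y) * (f x * g y)))).
  apply: eq_cint => x _; rewrite -cintZ//.
    by apply: eq_cint => y _; ring.
  apply: (@cintegrableM_bounded _ _ _ _ _ measurableT _ _ M) => //.
  exact: cmeasurable_pair.
rewrite (cfubini hi); apply: eq_cint => y _; rewrite -cintZ//.
  by apply: eq_cint => x _; rewrite /=; ring.
apply: (@cintegrableM_bounded _ _ _ _ _ measurableT _ _ M) => //.
exact: cmeasurable_pairr.
Qed.

End fubini_kernel.

(** * Integrals over subsets by extension with zero *)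

Section restriction.
Context {R : realType} {d : measure_display} {X : measurableType d}.
Variable mu : {measure set X -> \bar R}.
Variables (D : set X) (mD : measurable D).
Implicit Types f : X -> R[i].

Definition cind f x : R[i] := (\1_D x : R)%:C * f x.

Lemma cind_in f x : D x -> cind f x = f x.
Proof. by move=> Dx; rewrite /cind indicE mem_set// mul1r. Qed.
Lemma cind_out f x : ~ D x -> cind f x = 0.
Proof. by move=> Dx; rewrite /cind indicE memNset// mul0r. Qed.

Lemma cind_parts f : (fun x => complex.Re (cind f x)) = (fun x => complex.Re (f x)) \_ D /\
  (fun x => complex.Im (cind f x)) = (fun x => complex.Im (f x)) \_ D.
Proof.
by split; apply/funext => x; rewrite /cind partsE /= patchE indicE;
  case: (x \in D); rewrite /= ?mul0r ?mul1r ?subr0 ?addr0 ?subrr.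
Qed.

Lemma cind_integrable f : cintegrable mu D f -> cintegrable mu setT (cind f).
Proof.
have [e1 e2] := cind_parts f.
by move=> [f1 f2]; rewrite /cintegrable e1 e2; split; rewrite -restrict_EFin;
  apply/(integrable_mkcond _ mD).
Qed.
Lemma cind_measurable f : cmeasurable D f -> cmeasurable setT (cind f).
Proof.
have [e1 e2] := cind_parts f.
by move=> [f1 f2]; rewrite /cmeasurable e1 e2; split;
  apply/(measurable_restrictT _ mD).
Qed.
Lemma cint_cind f : cint mu D f = cint mu setT (cind f).
Proof.
have [e1 e2] := cind_parts f.
by rewrite /cint e1 e2; congr Complex; rewrite Rintegral_mkcond.
Qed.
Lemma cmeasurableS f : cmeasurable setT f -> cmeasurable D f.
Proof. by move=> [f1 f2]; split; exact: measurable_funTS. Qed.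
Lemma cintegrableS f : cintegrable mu setT f -> cintegrable mu D f.
Proof. by move=> [f1 f2]; split; [move: f1|move: f2]; exact: integrableS. Qed.

End restriction.

Section fubini_kernel_sets.
Context {R : realType} {d1 d2 : measure_display}.
Context {X : measurableType d1} {Y : measurableType d2}.
Variable m1 : {sigma_finite_measure set X -> \bar R}.
Variable m2 : {sigma_finite_measure set Y -> \bar R}.
Variables (k : X * Y -> R[i]) (M : R).
Hypotheses (mk : cmeasurable setT k) (bk : forall z, cabs2 (k z) <= M).
Variables (D : set X) (E : set Y).
Hypotheses (mD : measurable D) (mE : measurable E).

Lemma cfubini_kernelS (f : X -> R[i]) (g : Y -> R[i]) :
  cintegrable m1 D f -> cintegrable m2 E g ->
  cint m1 D (fun x => f x * cint m2 E (fun y => k (x, y) * g y)) =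
  cint m2 E (fun y => g y * cint m1 D (fun x => k (x, y) * f x)).
Proof.
move=> fi gi; rewrite (cint_cind m1 D) (cint_cind m2 E (fun y => g y * _)).
transitivity (cint m1 setT (fun x => cind D f x *
    cint m2 setT (fun y => k (x, y) * cind E g y))).
  apply: eq_cint => x _; rewrite /cind mulrA (cint_cind m2 E); congr (_ * _).
  by apply: eq_cint => y _; rewrite /cind mulrCA.
rewrite (cfubini_kernel mk bk (cind_integrable mD fi) (cind_integrable mE gi)).
apply: eq_cint => y _; rewrite /cind mulrA (cint_cind m1 D); congr (_ * _).
by apply: eq_cint => x _; rewrite /cind mulrCA.
Qed.

Lemma cmeasurable_kernel (g : Y -> R[i]) : cmeasurable E g ->
  cmeasurable setT (fun x => cint m2 E (fun y => k (x, y) * g y)).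
Proof.
move=> mg.
have -> : (fun x => cint m2 E (fun y => k (x, y) * g y)) =
    (fun x => cint m2 setT (fun y => k (x, y) * cind E g y)).
  apply/funext => x; rewrite (cint_cind m2 E); apply: eq_cint => y _.
  by rewrite /cind mulrCA.
have h : cmeasurable setT (fun z : X * Y => k z * cind E g z.2).
  by apply: cmeasurableM => //; apply: cmeasurable_snd; exact: cind_measurable.
exact: (cmeasurable_cint_param m2 h).
Qed.

End fubini_kernel_sets.

(** * The Fourier transform of exp(- e |t|) *)

Section damped_exponential.
Context {R : realType}.
Implicit Types (e x t : R) (f : R -> R).

Lemma ge0_integralT_fold f : (forall x, 0 <= f x) -> continuous f ->
  (\int[leb R]_x (f x)%:E =
   \int[leb R]_(x in `[0%R, +oo[) (f x + f (- x))%:E)%E.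
Proof.
move=> f0 cf.
have mf : measurable_fun [set: R] f by exact: continuous_measurable_fun.
have mfN : measurable_fun [set: R] (fun x => f (- x)).
  by apply: (measurableT_comp mf); exact: oppr_measurable.
under [RHS]eq_integral do rewrite EFinD.
rewrite ge0_integralD//=; last 4 first.
- by move=> x _; rewrite lee_fin.
- exact/measurable_EFinP/measurable_funTS.
- by move=> x _; rewrite lee_fin.
- exact/measurable_EFinP/measurable_funTS.
have mposnums : measurable [set x : R | 0 <= x]%R by rewrite -set_itvcy.
rewrite -(setUv [set x : R | 0 <= x]%R) ge0_integral_setU//= ; last 4 first.
  exact: measurableC.
  by apply/measurable_EFinP; rewrite setUv.
  by move=> x _; rewrite lee_fin.
  exact/disj_setPCl.
rewrite -set_itvcy// setCitvr; congr (_ + _)%E.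
rewrite integral_itv_bndo_bndc; last exact/measurable_EFinP/measurable_funTS.
rewrite -{1}oppr0 ge0_integration_by_substitutionNy//.
exact: continuous_subspaceT.
Qed.

Definition damp e t := expR (- e * `|t|).

Lemma continuous_damp e : continuous (damp e).
Proof.
move=> t; apply: (continuous_comp (f := fun t => - e * `|t|) (g := @expR R)).
  by apply: cvgM; [exact: cvg_cst|exact: norm_continuous].
exact: continuous_expR.
Qed.

Lemma damp_ge0 e t : 0 <= damp e t.
Proof. exact: expR_ge0. Qed.

Lemma dampN e t : damp e (- t) = damp e t.
Proof. by rewrite /damp normrN. Qed.

Lemma is_derive_lin (c t : R) : is_derive t 1 (fun t : R => c * t) c.
Proof.
have h : is_derive t 1 (c \*: id : R -> R) c.
  by apply: (is_derive_eq (is_deriveZ c (is_derive_id t (1 : R)))); rewrite -[RHS]mulr1.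
exact: h.
Qed.

Lemma cvg_expRy e : 0 < e -> expR (- e * t) @[t --> +oo] --> (0 : R).
Proof.
move=> e0; under eq_fun do rewrite mulNr.
apply: (cvg_comp (fun t => e * t) (fun y => expR (- y))); last exact: cvgr_expR.
exact: gt0_cvgMry.
Qed.

(** Integrability is not known yet, so only the tools for nonnegative functions apply. Adding 1 to
    the cosine makes the integrand nonnegative, and folding the line onto a half-line doubles it.
    The primitive is e^{-et}(a sin xt + b cos xt - 2/e), with a and b solved from the derivative. *)
Lemma integral_half_cos e x : 0 < e ->
  (\int[leb R]_(t in `[0%R, +oo[) ((2 + 2 * cos (x * t)) * expR (- e * t))%:E =
   (2 / e + 2 * e / (e ^+ 2 + x ^+ 2))%:E)%E.
Proof.
move=> e0; have q0 : 0 < e ^+ 2 + x ^+ 2 by rewrite ltr_pwDl ?exprn_gt0 ?sqr_ge0.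
pose a := 2 * x / (e ^+ 2 + x ^+ 2); pose b := - (2 * e / (e ^+ 2 + x ^+ 2)).
pose F1 := (fun t : R => expR (- e * t)).
pose F2 := (a \*: (sin \o (fun t => x * t)) + b \*: (cos \o (fun t => x * t)) +
  cst (- (2 / e))) : R -> R.
pose F := F1 * F2 : R -> R.
pose f t := (2 + 2 * cos (x * t)) * expR (- e * t).
have dF1 t : is_derive t 1 F1 (expR (- e * t) * - e).
  exact: (is_derive1_comp (is_derive_expR _) (is_derive_lin _ _)).
have dF2 t : is_derive t 1 F2 (a * (cos (x * t) * x) + b * (- sin (x * t) * x) + 0).
  apply: is_deriveD; apply: is_deriveD; apply: is_deriveZ.
    exact: (is_derive1_comp (is_derive_sin _) (is_derive_lin _ _)).
  exact: (is_derive1_comp (is_derive_cos _) (is_derive_lin _ _)).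
have dF t : is_derive t 1 F (f t).
  apply: (is_derive_eq (is_deriveM (dF1 t) (dF2 t))).
  transitivity (expR (- e * t) *
    (a * (cos (x * t) * x) + b * (- sin (x * t) * x) + 0) +
    (a * sin (x * t) + b * cos (x * t) - 2 / e) * (expR (- e * t) * - e)) => //.
  have e1 : e != 0 by rewrite gt_eqF.
  have q1 : e ^+ 2 + x ^+ 2 != 0 by rewrite gt_eqF.
  by rewrite /f /a /b; field; rewrite e1 -?expr2 q1.
have cF1 : continuous F1.
  by move=> t; apply: differentiable_continuous; apply/derivable1_diffP; case: (dF1 t).
rewrite (@ge0_continuous_FTC2y _ f F 0 0).
- have -> : F 0 = expR (- e * 0) * (a * sin (x * 0) + b * cos (x * 0) - 2 / e) by [].
  rewrite !mulr0 expR0 sin0 cos0 /a /b -EFinB.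
  by congr EFin; ring.
- move=> t _; apply: mulr_ge0; last exact: expR_ge0.
  have := cos_geN1 (x * t); lra.
- apply: continuous_subspaceT => t; apply: cvgM; last exact: cF1.
  apply: cvgD; first exact: cvg_cst.
  apply: cvgM; first exact: cvg_cst.
  apply: (continuous_comp (f := fun t => x * t)); last exact: continuous_cos.
  by apply: cvgM; [exact: cvg_cst|exact: cvg_id].
- have h1 : (`|a| + `|b| + `|2 / e|) * F1 t @[t --> +oo] --> (0 : R).
    rewrite -[X in _ --> X](mulr0 (`|a| + `|b| + `|2 / e|)).
    by apply: cvgM; [exact: cvg_cst|exact: cvg_expRy].
  have h2 : - ((`|a| + `|b| + `|2 / e|) * F1 t) @[t --> +oo] --> (0 : R).
    by rewrite -[X in _ --> X]oppr0; exact: cvgN.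
  apply: squeeze_cvgr h2 h1.
  apply: nearW => t; rewrite -ler_norml.
  have -> : F t = F1 t * (a * sin (x * t) + b * cos (x * t) - 2 / e) by [].
  rewrite normrM mulrC (ger0_norm (expR_ge0 _)) ler_wpM2r ?expR_ge0//.
  apply: (le_trans (ler_normD _ _)); rewrite normrN lerD2r.
  apply: (le_trans (ler_normD _ _)); rewrite !normrM lerD//.
    by rewrite ler_piMr// ler_norml sin_geN1 sin_le1.
  by rewrite ler_piMr// ler_norml cos_geN1 cos_le1.
- by move=> t _; case: (dF t).
- apply: cvg_at_right_filter; apply: differentiable_continuous.
  by apply/derivable1_diffP; case: (dF 0).
- by move=> t _; rewrite derive1E; case: (dF t).
Qed.

Lemma continuous_cosM x : continuous (fun t => cos (t * x)).
Proof.
move=> t; apply: (continuous_comp (f := fun t => t * x)); last exact: continuous_cos.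
by apply: cvgM; [exact: cvg_id|exact: cvg_cst].
Qed.
Lemma continuous_sinM x : continuous (fun t => sin (t * x)).
Proof.
move=> t; apply: (continuous_comp (f := fun t => t * x)); last exact: continuous_sin.
by apply: cvgM; [exact: cvg_id|exact: cvg_cst].
Qed.

Lemma integral_damp_cos e x : 0 < e ->
  (\int[leb R]_t ((1 + cos (t * x)) * damp e t)%:E =
   (2 / e + 2 * e / (e ^+ 2 + x ^+ 2))%:E)%E.
Proof.
move=> e0; rewrite (ge0_integralT_fold (f := fun t => (1 + cos (t * x)) * damp e t)).
- rewrite -(integral_half_cos x e0); apply: eq_integral => t; rewrite inE/= in_itv/= andbT => t0.
  by rewrite dampN mulNr cosN /damp ger0_norm// (mulrC t x); congr EFin; ring.
- move=> t; apply: mulr_ge0; last exact: expR_ge0.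
  have := cos_geN1 (t * x); lra.
- move=> t; apply: cvgM; last exact: continuous_damp.
  by apply: cvgD; [exact: cvg_cst|exact: continuous_cosM].
Qed.

Lemma integrable_damp e : 0 < e -> (leb R).-integrable setT (EFin \o damp e).
Proof.
move=> e0.
(* At x = 0 the factor 1 + cos is the constant 2. *)
have h := @integral_damp_cos e 0 e0.
suff : (leb R).-integrable setT (EFin \o (fun t => (1 + cos (t * 0)) * damp e t)).
  move=> /(integrableZ_EFin measurableT (2^-1)); apply: eq_integrable => // t _ /=.
  by rewrite mulr0 cos0; congr EFin; field.
apply: ge0_fin_integrable => //.
- apply: measurable_funM; last first.
    by apply: continuous_measurable_fun; exact: continuous_damp.
  apply: measurable_funD => //.
  by apply: continuous_measurable_fun; exact: continuous_cosM.
- by apply: aeW => t _; rewrite mulr0 cos0 mulr_ge0// expR_ge0.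
- by rewrite h ltry.
Qed.

Lemma integrable_dampM e f : 0 < e -> measurable_fun setT f ->
  (forall t, `|f t| <= 1) ->
  (leb R).-integrable setT (EFin \o (fun t => f t * damp e t)).
Proof.
move=> e0 mf f1; apply: ae_le_integrable (integrable_damp e0) _ => //.
  apply: measurable_funM => //.
  by apply: continuous_measurable_fun; exact: continuous_damp.
apply: aeW => t _; rewrite normrM (ger0_norm (expR_ge0 _)).
by rewrite ler_piMl// expR_ge0.
Qed.

Lemma Rintegral_damp e : 0 < e -> Rintegral (leb R) setT (damp e) = 2 / e.
Proof.
move=> e0; have := @integral_damp_cos e 0 e0.
rewrite -[X in X = _ -> _]fineK; last first.
  by rewrite integral_damp_cos.
rewrite -/(Rintegral _ _ _) => -[].
rewrite (_ : Rintegral _ _ _ = 2 * Rintegral (leb R) setT (damp e)); last first.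
  rewrite -RintegralZl//; last exact: integrable_damp.
  by apply: eq_Rintegral => t _; rewrite mulr0 cos0.
rewrite expr0n addr0 => h.
have -> : Rintegral (leb R) setT (damp e) = (2 / e + 2 * e / e ^+ 2) / 2.
  by rewrite -h; field.
by field; rewrite gt_eqF.
Qed.

Lemma Rintegral_damp_cos e x : 0 < e ->
  Rintegral (leb R) setT (fun t => cos (t * x) * damp e t) =
  2 * e / (e ^+ 2 + x ^+ 2).
Proof.
move=> e0.
have ic : (leb R).-integrable setT (EFin \o (fun t => cos (t * x) * damp e t)).
  apply: integrable_dampM => //.
    by apply: continuous_measurable_fun; exact: continuous_cosM.
  by move=> t; rewrite ler_norml cos_geN1 cos_le1.
have := @integral_damp_cos e x e0.
rewrite -[X in X = _ -> _]fineK; last by rewrite integral_damp_cos.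
rewrite -/(Rintegral _ _ _) => -[].
rewrite (_ : Rintegral _ _ _ = Rintegral (leb R) setT (damp e) +
    Rintegral (leb R) setT (fun t => cos (t * x) * damp e t)); last first.
  rewrite -RintegralD//; last exact: integrable_damp.
  by apply: eq_Rintegral => t _; rewrite mulrDl mul1r.
by rewrite Rintegral_damp//; lra.
Qed.

(** Oddness, expressed with nonnegative integrands: folding 1 + sin cancels the sine, so its
    integral equals that of the damping factor alone. *)
Lemma Rintegral_damp_sin e x : 0 < e ->
  Rintegral (leb R) setT (fun t => sin (t * x) * damp e t) = 0.
Proof.
move=> e0.
have ic : (leb R).-integrable setT (EFin \o (fun t => sin (t * x) * damp e t)).
  apply: integrable_dampM => //.
    by apply: continuous_measurable_fun; exact: continuous_sinM.
  by move=> t; rewrite ler_norml sin_geN1 sin_le1.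
have : (\int[leb R]_t ((1 + sin (t * x)) * damp e t)%:E =
    \int[leb R]_t (damp e t)%:E)%E.
  rewrite (ge0_integralT_fold (f := fun t => (1 + sin (t * x)) * damp e t)); last 2 first.
  - move=> t; apply: mulr_ge0; last exact: expR_ge0.
    have := sin_geN1 (t * x); lra.
  - move=> t; apply: cvgM; last exact: continuous_damp.
    by apply: cvgD; [exact: cvg_cst|exact: continuous_sinM].
  rewrite (ge0_integralT_fold (f := damp e)); last 2 first.
  - by move=> t; exact: expR_ge0.
  - exact: continuous_damp.
  apply: eq_integral => t _; rewrite dampN mulNr sinN; congr EFin; ring.
move/(congr1 fine); rewrite -/(Rintegral _ _ _) -[RHS]/(Rintegral _ _ _).
rewrite (_ : Rintegral _ _ _ = Rintegral (leb R) setT (damp e) +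
    Rintegral (leb R) setT (fun t => sin (t * x) * damp e t)); last first.
  rewrite -RintegralD//; last exact: integrable_damp.
  by apply: eq_Rintegral => t _; rewrite mulrDl mul1r.
by rewrite -/(Rintegral _ _ _); lra.
Qed.

Lemma cint_poisson e x : 0 < e ->
  cint (leb R) setT (fun t => expi (t * x) * (damp e t)%:C) =
  (2 * e / (e ^+ 2 + x ^+ 2))%:C.
Proof.
move=> e0; apply: eq_parts => /=.
  rewrite -(Rintegral_damp_cos _ e0); apply: eq_Rintegral => t _.
  by rewrite /= mulr0 subr0.
rewrite -[RHS](Rintegral_damp_sin x e0); apply: eq_Rintegral => t _.
by rewrite /= mulr0 add0r.
Qed.

Lemma cmeasurable_expi d (X : measurableType d) (D : set X) (g : X -> R) :
  measurable_fun D g -> cmeasurable D (fun z => expi (g z)).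
Proof.
move=> mg; split.
  apply: (measurableT_comp _ mg).
  by apply: continuous_measurable_fun; exact: continuous_cos.
apply: (measurableT_comp _ mg).
by apply: continuous_measurable_fun; exact: continuous_sin.
Qed.

End damped_exponential.

(** * Dominated convergence and bounds for complex integrals *)

Section limits_of_integrals.
Context {R : realType} {d : measure_display} {X : measurableType d}.
Variable mu : {measure set X -> \bar R}.
Variables (D : set X) (mD : measurable D).

Lemma Rintegral_dominated (f : nat -> X -> R) (g h : X -> R) :
  (forall n, measurable_fun D (f n)) -> measurable_fun D g ->
  {ae mu, forall x, D x -> f n x @[n --> \oo] --> g x} ->
  mu.-integrable D (EFin \o h) ->
  {ae mu, forall x, forall n, D x -> `|f n x| <= h x} ->
  mu.-integrable D (EFin \o g) /\
  Rintegral mu D (f n) @[n --> \oo] --> Rintegral mu D g.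
Proof.
move=> mf mg fg ih fh.
have [ig _ c] := @dominated_convergence _ _ _ mu D mD (fun n => EFin \o f n)
  (EFin \o g) (EFin \o h) (fun n => (measurable_EFinP _ _).2 (mf n))
  ((measurable_EFinP _ _).2 mg)
  ltac:(by apply: filterS fg => x h1 Dx; apply: cvg_EFin; [exact: nearW|exact: h1])
  ih ltac:(by apply: filterS fh => x h1 n Dx /=; rewrite lee_fin; exact: h1).
split=> //; apply: fine_cvg.
by move: c; rewrite (integrable_EFin_Rintegral mD ig).
Qed.

Lemma cint_dominated (f : nat -> X -> R[i]) (g : X -> R[i]) (h : X -> R) :
  (forall n, cmeasurable D (f n)) -> cmeasurable D g ->
  {ae mu, forall x, D x -> ccvg (f^~ x) (g x)} ->
  mu.-integrable D (EFin \o h) ->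
  {ae mu, forall x, forall n, D x -> Num.sqrt (cabs2 (f n x)) <= h x} ->
  cintegrable mu D g /\ ccvg (fun n => cint mu D (f n)) (cint mu D g).
Proof.
move=> mf [mg1 mg2] fg ih fh.
have [i1 c1] := @Rintegral_dominated (fun n x => complex.Re (f n x)) _ h
  (fun n => (mf n).1) mg1
  ltac:(by apply: filterS fg => x h1 Dx; case: (h1 Dx)) ih
  ltac:(by apply: filterS fh => x h1 n Dx; exact: le_trans (normr_Re _) (h1 n Dx)).
have [i2 c2] := @Rintegral_dominated (fun n x => complex.Im (f n x)) _ h
  (fun n => (mf n).2) mg2
  ltac:(by apply: filterS fg => x h1 Dx; case: (h1 Dx)) ih
  ltac:(by apply: filterS fh => x h1 n Dx; exact: le_trans (normr_Im _) (h1 n Dx)).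
by [].
Qed.

(** The factor 2 comes from bounding the real and imaginary parts separately; the lemma serves to
    show that transforms are bounded, so the constant is immaterial. *)
Lemma sqrt_cabs2_cint (f : X -> R[i]) : cintegrable mu D f ->
  Num.sqrt (cabs2 (cint mu D f)) <=
  2 * Rintegral mu D (fun x => Num.sqrt (cabs2 (f x))).
Proof.
move=> fi; have ia := cintegrable_abs mD fi; case: fi => f1 f2.
have h0 : 0 <= Rintegral mu D (fun x => Num.sqrt (cabs2 (f x))).
  by apply: Rintegral_ge0 => x _; rewrite sqrtr_ge0.
have h1 : `|Rintegral mu D (fun x => complex.Re (f x))| <=
    Rintegral mu D (fun x => Num.sqrt (cabs2 (f x))).
  apply: (le_trans (le_normr_Rintegral mD f1)); apply: le_Rintegral => //.
  - exact: (integrable_abse f1).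
  - by move=> x _; exact: normr_Re.
have h2 : `|Rintegral mu D (fun x => complex.Im (f x))| <=
    Rintegral mu D (fun x => Num.sqrt (cabs2 (f x))).
  apply: (le_trans (le_normr_Rintegral mD f2)); apply: le_Rintegral => //.
  - exact: (integrable_abse f2).
  - by move=> x _; exact: normr_Im.
rewrite -(@ler_pXn2r _ 2)// ?nnegrE ?sqrtr_ge0 ?mulr_ge0//.
rewrite sqr_sqrtr ?cabs2_ge0// /cabs2 /= -(real_normK (num_real (Rintegral _ _ _))).
rewrite -(real_normK (num_real (Rintegral mu D (fun x => complex.Im (f x))))).
rewrite exprMn (_ : 2 ^+ 2 = 1 + 3 :> R); last by ring.
move: (sqr_ge0 (Rintegral mu D (fun x => Num.sqrt (cabs2 (f x))))) => h3.
have h4 : `|Rintegral mu D (fun x => complex.Re (f x))| ^+ 2 <=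
  Rintegral mu D (fun x => Num.sqrt (cabs2 (f x))) ^+ 2 by rewrite ler_pXn2r// nnegrE.
have h5 : `|Rintegral mu D (fun x => complex.Im (f x))| ^+ 2 <=
  Rintegral mu D (fun x => Num.sqrt (cabs2 (f x))) ^+ 2 by rewrite ler_pXn2r// nnegrE.
lra.
Qed.

Lemma cintegrable_bounded (f : X -> R[i]) (M : R) : (mu D < +oo)%E ->
  cmeasurable D f -> (forall x, D x -> cabs2 (f x) <= M) -> cintegrable mu D f.
Proof.
move=> muD mf fM; apply: (@cintegrable_dom _ _ _ _ _ mD _ (fun=> Num.sqrt M)) => //.
  apply/integrableP; split; first exact: measurable_cst.
  rewrite integral_cst//= ; exact: lte_mul_pinfty.
by apply: aeW => x Dx; rewrite ler_wsqrtr// fM.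
Qed.

End limits_of_integrals.

(** * The Poisson kernel and its primitive *)

Section poisson_kernel.
Context {R : realType}.
Implicit Types e y l t : R.

Definition eps_ (n : nat) : R := n.+1%:R^-1.
Lemma eps_gt0 n : 0 < eps_ n. Proof. by rewrite invr_gt0. Qed.
Lemma eps_le1 n : eps_ n <= 1. Proof. by rewrite invf_le1// ler1n. Qed.
Lemma cvg_eps : eps_ n @[n --> \oo] --> (0 : R).
Proof. exact: cvg_harmonic. Qed.

Definition poisson (e y : R) : R := 2 * e / (e ^+ 2 + y ^+ 2).

Lemma poisson_den e y : 0 < e -> 0 < e ^+ 2 + y ^+ 2.
Proof. by move=> e0; rewrite ltr_pwDl ?exprn_gt0 ?sqr_ge0. Qed.
Lemma poisson_ge0 e y : 0 < e -> 0 <= poisson e y.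
Proof. by move=> e0; rewrite divr_ge0 ?mulr_ge0 ?ltW// poisson_den. Qed.
(** Dropping e^2 in the denominator leaves a bound linear in e: away from 0 the kernel tends to 0
    uniformly. *)
Lemma poisson_le e y (dl : R) : 0 < e -> 0 < dl -> dl <= `|y| ->
  poisson e y <= 2 / dl ^+ 2 * e.
Proof.
move=> e0 d0 dy; rewrite /poisson [leRHS]mulrAC; apply: ler_wpM2l.
  by rewrite mulr_ge0// ltW.
rewrite lef_pV2 ?posrE ?exprn_gt0 ?poisson_den//.
by rewrite -[y ^+ 2]real_normK ?num_real// ler_wpDl ?sqr_ge0// ler_pXn2r// nnegrE ltW.
Qed.
Lemma poisson_le_inv e y : 0 < e -> poisson e y <= 2 / e.
Proof.
move=> e0; rewrite /poisson -mulrA ler_wpM2l// ler_pdivrMr ?poisson_den//.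
by rewrite mulrDr expr2 mulrA mulVf ?gt_eqF// mul1r lerDl mulr_ge0 ?sqr_ge0// invr_ge0 ltW.
Qed.
Lemma continuous_poisson e : 0 < e -> continuous (poisson e).
Proof.
move=> e0 y; apply: cvgM; first exact: cvg_cst.
apply: cvgV; first by rewrite gt_eqF// poisson_den.
by apply: cvgD; [exact: cvg_cst|exact: exprn_continuous].
Qed.

Lemma Rintegral_poisson e l (a b : R) : 0 < e -> a < b ->
  Rintegral (leb R) `[a, b] (fun x => poisson e (x - l)) =
  2 * (atan ((b - l) / e) - atan ((a - l) / e)).
Proof.
move=> e0 ab; pose F := (2 : R) \*: (atan \o (fun x => e^-1 * (x - l))) : R -> R.
have cs : continuous (fun x : R => x - l).
  by move=> x; apply: cvgB; [exact: cvg_id|exact: cvg_cst].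
have dF (x : R) : is_derive x 1 F (poisson e (x - l)).
  have dl : is_derive x 1 ((e^-1 : R) \*: ((id : R -> R) - cst l)) (e^-1).
    apply: (is_derive_eq (is_deriveZ _ (is_deriveB (is_derive_id _ _)
      (is_derive_cst _ _ _)))).
    by rewrite subr0 -[RHS]mulr1.
  apply: (is_derive_eq (is_deriveZ _ (is_derive1_comp (is_derive1_atan _) dl))).
  transitivity (2 * ((1 + (e^-1 * (x - l)) ^+ 2)^-1 * e^-1)) => //.
  have e1 : e != 0 by rewrite gt_eqF.
  have q1 : e ^+ 2 + (x - l) ^+ 2 != 0 by rewrite gt_eqF// poisson_den.
  have q2 : 1 + (e^-1 * (x - l)) ^+ 2 != 0 by rewrite gt_eqF// ltr_pwDl// sqr_ge0.
  rewrite /poisson; have -> : 1 + (e^-1 * (x - l)) ^+ 2 =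
    (e ^+ 2 + (x - l) ^+ 2) / e ^+ 2 by field.
  by field; rewrite e1 q1.
have cF : continuous F.
  by move=> x; apply: differentiable_continuous; apply/derivable1_diffP; case: (dF x).
rewrite /Rintegral (@continuous_FTC2 _ _ F)//.
- rewrite -EFinB /=.
  transitivity (2 * atan (e^-1 * (b - l)) - 2 * atan (e^-1 * (a - l))) => //.
  by rewrite -mulrBr !(mulrC e^-1).
- apply: continuous_subspaceT => x.
  apply: (continuous_comp (f := fun x => x - l) (g := poisson e)); first exact: cs.
  exact: continuous_poisson.
- split.
  + by move=> x _; case: (dF x).
  + exact: cvg_at_right_filter (cF a).
  + exact: cvg_at_left_filter (cF b).
- by move=> x _; rewrite derive1E; case: (dF x).
Qed.

(** Through this limit the integral of the Poisson kernel over an interval tends to 2 pi times its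
    indicator, except at the end points. *)
Lemma cvg_atan_eps (y : R) : y != 0 ->
  atan (y / eps_ n) @[n --> \oo] --> Num.sg y * (pi / 2).
Proof.
have pos (z : R) : 0 < z -> atan (z / eps_ n) @[n --> \oo] --> pi / 2.
  move=> z0; apply: (cvg_comp (fun n => z / eps_ n) atan); last exact: cvgy_atan.
  have h : (eps_ n)^-1 @[n --> \oo] --> +oo%R.
    under eq_fun do rewrite /eps_ invrK.
    by have := @cvgr_idn R; rewrite -(cvg_shiftS (fun n => n%:R : R)).
  apply: (cvg_comp (fun n => (eps_ n)^-1) (fun x => z * x) h).
  exact: gt0_cvgMry.
move=> y0; case: (ltgtP y 0) => [yn|yp|y00]; last by rewrite y00 eqxx in y0.
- rewrite ltr0_sg// mulN1r.
  have -> : (fun n => atan (y / eps_ n)) = (fun n => - atan (- y / eps_ n)).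
    by apply/funext => n; rewrite mulNr atanN opprK.
  by apply: cvgN; apply: pos; rewrite oppr_gt0.
- by rewrite gtr0_sg// mul1r; exact: pos.
Qed.

Lemma cvg_damp_eps (t : R) : damp (eps_ n) t @[n --> \oo] --> (1 : R).
Proof.
rewrite -expR0; apply: (cvg_comp (fun n => - eps_ n * `|t|) expR); last exact: continuous_expR.
rewrite -(mul0r `|t|); apply: cvgM; last exact: cvg_cst.
by rewrite -oppr0; apply: cvgN; exact: cvg_eps.
Qed.

Lemma damp_le1 e (t : R) : 0 < e -> damp e t <= 1.
Proof. by move=> e0; rewrite -expR0 ler_expR mulNr oppr_le0 mulr_ge0// ltW. Qed.

End poisson_kernel.

(** * The Fourier transform and its damped inverse *)

Section fourier.
Context {R : realType}.
Implicit Types (D E S : set (measurableTypeR R)) (u f g : R -> R[i]) (t l x : R).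

(** Unnormalised, with the sign of the transform in the theorem: the inverse transform is [inv2pi]
    times [ft] at the opposite point. *)
Definition ft D u l : R[i] := cint (leb R) D (fun t => expi (t * l) * u t).

Lemma measurable_fun_prodmul :
  measurable_fun setT (fun z : measurableTypeR R * measurableTypeR R => z.2 * z.1).
Proof. by apply: measurable_funM; [exact: measurable_snd|exact: measurable_fst]. Qed.

Lemma cmeasurable_expi_kernel : cmeasurable setT
  (fun z : measurableTypeR R * measurableTypeR R => expi (z.2 * z.1)).
Proof. by apply: cmeasurable_expi; exact: measurable_fun_prodmul. Qed.

Lemma cmeasurable_expiM D x : cmeasurable D (fun t : measurableTypeR R => expi (t * x)).
Proof.
apply: cmeasurable_expi; apply: measurable_funTS.
by apply: measurable_funM => //; exact: measurable_id.
Qed.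

Lemma cintegrable_expi D u l : measurable D -> cintegrable (leb R) D u ->
  cintegrable (leb R) D (fun t => expi (t * l) * u t).
Proof.
move=> mD ui; apply: (@cintegrableM_bounded _ _ _ _ _ mD _ _ 1) => //.
  exact: cmeasurable_expiM.
by move=> t _; rewrite cabs2_expi.
Qed.

Lemma cmeasurable_ft D u : measurable D -> cmeasurable D u ->
  cmeasurable (setT : set (measurableTypeR R)) (ft D u).
Proof.
move=> mD mu.
exact: (@cmeasurable_kernel _ _ _ _ _ (leb R) (fun z => expi (z.2 * z.1))
  cmeasurable_expi_kernel D mD u mu).
Qed.

Lemma ft_bounded D u : measurable D -> cintegrable (leb R) D u ->
  exists M : R, forall l, cabs2 (ft D u l) <= M.
Proof.
move=> mD ui; exists ((2 * Rintegral (leb R) D (fun t => Num.sqrt (cabs2 (u t)))) ^+ 2).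
move=> l; have := sqrt_cabs2_cint mD (cintegrable_expi l mD ui).
move=> h; have {h} : Num.sqrt (cabs2 (ft D u l)) <=
    2 * Rintegral (leb R) D (fun t => Num.sqrt (cabs2 (u t))).
  apply: (le_trans h); apply: ler_wpM2l => //; rewrite le_eqVlt; apply/orP; left.
  by apply/eqP; apply: eq_Rintegral => t _; rewrite cabs2M cabs2_expi mul1r.
move=> h; rewrite -[leLHS]sqr_sqrtr ?cabs2_ge0// ler_pXn2r// nnegrE ?sqrtr_ge0//.
exact: le_trans (sqrtr_ge0 _) h.
Qed.

(** The multiplication formula: the kernel e^{itl} is symmetric in t and l. *)
Lemma ft_swap D E f g : measurable D -> measurable E ->
  cintegrable (leb R) D f -> cintegrable (leb R) E g ->
  cint (leb R) D (fun x => f x * ft E g x) = cint (leb R) E (fun y => g y * ft D f y).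
Proof.
move=> mD mE fi gi; rewrite /ft.
have b1 (z : measurableTypeR R * measurableTypeR R) :
    cabs2 (expi (z.2 * z.1) : R[i]) <= 1 by rewrite cabs2_expi.
have := @cfubini_kernelS _ _ _ _ _ (leb R) (leb R) _ 1
  cmeasurable_expi_kernel b1 D E mD mE f g fi gi.
move=> /= ->; apply: eq_cint => y _; congr (_ * _); apply: eq_cint => x _.
by rewrite (mulrC y).
Qed.

Lemma ftN D u l : measurable D -> cintegrable (leb R) D u ->
  ft D u (- l) = conjc (ft D (fun t => conjc (u t)) l).
Proof.
move=> mD ui; rewrite /ft -cint_conj//.
  by apply: eq_cint => t _; rewrite rmorphM /= conjcK mulrN expiN.
by apply: cintegrable_expi => //; exact: cintegrable_conj.
Qed.

Lemma cmeasurable_damp e : cmeasurable (setT : set (measurableTypeR R))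
  (fun t => (damp e t)%:C).
Proof.
by apply: cmeasurable_real; apply: continuous_measurable_fun; exact: continuous_damp.
Qed.

Lemma cintegrable_damp_expi e x : 0 < e ->
  cintegrable (leb R) setT (fun t => expi (t * x) * (damp e t)%:C).
Proof.
move=> e0; apply: cintegrable_expi => //; split; first exact: integrable_damp.
exact: integrable0.
Qed.

(** Damping makes the inversion integral absolutely convergent, and the multiplication formula
    replaces it by a Poisson average of u around x. *)
Lemma ft_poisson D u e x : measurable D -> cintegrable (leb R) D u -> 0 < e ->
  cint (leb R) setT (fun l => expi (l * - x) * (damp e l)%:C * ft D u l) =
  cint (leb R) D (fun t => u t * (poisson e (t - x))%:C).
Proof.
move=> mD ui e0; rewrite ft_swap//; last exact: cintegrable_damp_expi.
apply: eq_cint => t _; congr (_ * _); rewrite /poisson -cint_poisson//.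
by apply: eq_cint => l _; rewrite mulrA -expiD -mulrDr.
Qed.

Lemma ftN_poisson D u e x : measurable D -> cintegrable (leb R) D u -> 0 < e ->
  cint (leb R) setT (fun l => expi (l * x) * (damp e l)%:C * ft D u (- l)) =
  cint (leb R) D (fun t => u t * (poisson e (t - x))%:C).
Proof.
move=> mD ui e0; have ci := cintegrable_conj mD ui.
have mp : cmeasurable D (fun t : measurableTypeR R => (poisson e (t - x))%:C : R[i]).
  apply: cmeasurable_real; apply: measurable_funTS; apply: continuous_measurable_fun => t.
  apply: (continuous_comp (f := fun t : R => t - x) (g := poisson e)).
    by apply: cvgB; [exact: cvg_id|exact: cvg_cst].
  exact: continuous_poisson.
(* The transform at - l is the conjugate of the transform of conj(u) at l, so this is [ft_poisson]
   for conj(u), conjugated. *)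
transitivity (conjc (cint (leb R) D (fun t => conjc (u t) * (poisson e (t - x))%:C))).
  rewrite -ft_poisson// -cint_conj//.
    apply: eq_cint => l _; rewrite ftN// !rmorphM /= oppr0.
    by rewrite -[expi (l * x)]conjcK -expiN mulrN.
  have [M hM] := ft_bounded mD ci.
  under eq_fun do rewrite mulrC.
  apply: (@cintegrableM_bounded _ _ _ _ _ measurableT _ _ M) => //.
  + exact: cintegrable_damp_expi.
  + by apply: cmeasurable_ft => //; exact: cintegrable_meas ci.
rewrite -cint_conj//.
  by apply: eq_cint => t _; rewrite rmorphM /= conjcK oppr0.
under eq_fun do rewrite mulrC.
apply: (@cintegrableM_bounded _ _ _ _ _ mD _ _ ((2 / e) ^+ 2)) => //.
move=> t _; rewrite cabs2_real ler_pXn2r ?poisson_le_inv ?nnegrE ?poisson_ge0//.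
by rewrite divr_ge0// ltW.
Qed.

Lemma ccvg_real (a : nat -> R) (b : R) : a n @[n --> \oo] --> b ->
  ccvg (fun n => (a n)%:C) b%:C.
Proof. by move=> h; split => //=; exact: cvg_cst. Qed.

Lemma damped_limit f : cintegrable (leb R) setT f ->
  ccvg (fun n => cint (leb R) setT (fun t => f t * (damp (eps_ n) t)%:C))
    (cint (leb R) setT f).
Proof.
move=> fi; have mf := cintegrable_meas fi.
have [] // := @cint_dominated _ _ _ (leb R) setT measurableT
  (fun n t => f t * (damp (eps_ n) t)%:C) f (fun t => Num.sqrt (cabs2 (f t))).
- by move=> n; apply: cmeasurableM => //; exact: cmeasurable_damp.
- apply: aeW => t _; rewrite -[X in ccvg _ X]mulr1; apply: ccvgM; first exact: ccvg_cst.
  by apply: ccvg_real; exact: cvg_damp_eps.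
- exact: cintegrable_abs.
- apply: aeW => t n _; rewrite cabs2M cabs2_real ler_wsqrtr// ler_piMr ?cabs2_ge0//.
  by rewrite expr_le1// ?damp_ge0// damp_le1// eps_gt0.
Qed.

(** The damped inversion integral is the Poisson average of u over D, where the kernel is at most
    2e/dl^2, so it tends to 0 with e. As the transform is integrable, dominated convergence removes
    the damping. No regularity of u is involved. *)
Lemma ft_vanish D u x (dl : R) : measurable D -> cintegrable (leb R) D u ->
  cintegrable (leb R) setT (ft D u) -> 0 < dl ->
  (forall t, D t -> dl <= `|t - x|) ->
  cint (leb R) setT (fun l => expi (l * - x) * ft D u l) = 0.
Proof.
move=> mD ui Ui d0 hD; have mu := cintegrable_meas ui.
apply: (ccvg_unique (damped_limit (cintegrable_expi (- x) measurableT Ui))).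
have e1 n := eps_gt0 (R := R) n.
have -> : (fun n => cint (leb R) setT
    (fun t => expi (t * - x) * ft D u t * (damp (eps_ n) t)%:C)) =
    (fun n => cint (leb R) D (fun t => u t * (poisson (eps_ n) (t - x))%:C)).
  apply/funext => n; rewrite -ft_poisson//.
  by apply: eq_cint => t _; rewrite mulrAC.
have c0 : 2 / dl ^+ 2 * eps_ n @[n --> \oo] --> (0 : R).
  by rewrite -[X in _ --> X](mulr0 (2 / dl ^+ 2)); apply: cvgM; [exact: cvg_cst|exact: cvg_eps].
have [] // := @cint_dominated _ _ _ (leb R) D mD
  (fun n t => u t * (poisson (eps_ n) (t - x))%:C) (fun=> 0)
  (fun t => (2 / dl ^+ 2) * Num.sqrt (cabs2 (u t))).
- move=> n; apply: cmeasurableM => //; apply: cmeasurable_real.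
  apply: measurable_funTS; apply: continuous_measurable_fun => t.
  apply: (continuous_comp (f := fun t : R => t - x) (g := poisson (eps_ n))).
    by apply: cvgB; [exact: cvg_id|exact: cvg_cst].
  exact: continuous_poisson.
- apply: aeW => t Dt; rewrite -[X in ccvg _ X](mulr0 (u t)); apply: ccvgM.
    exact: ccvg_cst.
  apply: ccvg_real; apply: squeeze_cvgr c0; last exact: cvg_cst.
  by apply: nearW => n; rewrite poisson_ge0// poisson_le// hD.
- by apply: integrableZ_EFin => //; exact: cintegrable_abs.
- apply: aeW => t n Dt; rewrite cabs2M cabs2_real mulrC sqrtrM ?sqr_ge0// sqrtr_sqr.
  rewrite ler_wpM2r ?sqrtr_ge0// ger0_norm ?poisson_ge0//.
  apply: (le_trans (poisson_le (e1 n) d0 (hD _ Dt))).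
  by rewrite ler_piMr ?eps_le1// divr_ge0// exprn_ge0// ltW.
- by move=> _; rewrite cint0.
Qed.

End fourier.

(** * Inversion for an integrable function whose inverse transform lives on S *)

Section fourier_inversion.
Context {R : realType}.
Variables (phi : R -> R[i]) (S : set (measurableTypeR R)).
Hypotheses (phii : cintegrable (leb R) setT phi) (mS : measurable S)
  (finS : (leb R S < +oo)%E).

Let w t := inv2pi * ft setT phi (- t).
Hypothesis w0 : forall t, ~ S t -> w t = 0.

Lemma cmeasurable_inverse_ft : cmeasurable (setT : set (measurableTypeR R)) w.
Proof.
apply: cmeasurableM; first exact: cmeasurable_cst.
have [h1 h2] := cmeasurable_ft measurableT (cintegrable_meas phii).
by split; [apply: (measurableT_comp h1)|apply: (measurableT_comp h2)];
  exact: oppr_measurable.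
Qed.

Lemma inverse_ft_bounded : exists M, forall t, cabs2 (w t) <= M.
Proof.
have [M hM] := ft_bounded measurableT phii; exists (cabs2 (inv2pi : R[i]) * M) => t.
by rewrite cabs2M ler_wpM2l ?cabs2_ge0.
Qed.

Let w_cind : w = cind S w.
Proof.
apply/funext => t; have [St|St] := pselect (S t); first by rewrite cind_in.
by rewrite cind_out// w0.
Qed.

Let wiS : cintegrable (leb R) S w.
Proof.
have [M hM] := inverse_ft_bounded.
apply: (@cintegrable_bounded _ _ _ _ _ mS _ M) => //.
exact: cmeasurableS cmeasurable_inverse_ft.
Qed.

Let wi : cintegrable (leb R) setT w.
Proof. by rewrite w_cind; exact: cind_integrable. Qed.

Let WE l : ft S w l = ft setT w l.
Proof.
rewrite /ft cint_cind; apply: eq_cint => t _.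
by rewrite [in RHS]w_cind /cind mulrCA.
Qed.

(** The damped transform of w has two readings: it tends to the transform of w as the damping
    disappears, and it is the Poisson smoothing of phi. The inversion formula compares the two. *)
Let J n x := cint (leb R) setT (fun t => expi (t * x) * (damp (eps_ n) t)%:C * w t).

Let cvgJ x : ccvg (J^~ x) (ft setT w x).
Proof.
have := damped_limit (cintegrable_expi x measurableT wi).
have -> // : (fun n => cint (leb R) setT
    (fun t => expi (t * x) * w t * (damp (eps_ n) t)%:C)) = J^~ x.
by apply/funext => n; apply: eq_cint => t _; rewrite mulrAC.
Qed.

Let JE n x : J n x =
  inv2pi * cint (leb R) setT (fun l => phi l * (poisson (eps_ n) (l - x))%:C).
Proof.
have e0 := eps_gt0 (R := R) n.
rewrite -ftN_poisson// -cintZ//.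
  by apply: eq_cint => t _; rewrite /w mulrCA.
have [M hM] := ft_bounded measurableT phii.
under eq_fun do rewrite mulrC.
apply: (@cintegrableM_bounded _ _ _ _ _ measurableT _ _ M) => //.
  exact: cintegrable_damp_expi.
have [h1 h2] := cmeasurable_ft measurableT (cintegrable_meas phii).
by split; [apply: (measurableT_comp h1)|apply: (measurableT_comp h2)];
  exact: oppr_measurable.
Qed.

Let mJ n : cmeasurable (setT : set (measurableTypeR R)) (J n).
Proof.
have e0 := eps_gt0 (R := R) n.
have mk : cmeasurable setT (fun z : measurableTypeR R * measurableTypeR R =>
    expi (z.2 * z.1) * (damp (eps_ n) z.2)%:C).
  apply: cmeasurableM; first exact: cmeasurable_expi_kernel.
  exact: (cmeasurable_snd (cmeasurable_damp (eps_ n))).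
exact: (@cmeasurable_kernel _ _ _ _ _ (leb R) _ mk setT measurableT w
  cmeasurable_inverse_ft).
Qed.

Let J_bounded : exists M : R, forall n x, Num.sqrt (cabs2 (J n x)) <= M.
Proof.
exists (2 * Rintegral (leb R) setT (fun t => Num.sqrt (cabs2 (w t)))) => n x.
have e0 := eps_gt0 (R := R) n.
have ji : cintegrable (leb R) setT (fun t => expi (t * x) * (damp (eps_ n) t)%:C * w t).
  apply: (@cintegrableM_bounded _ _ _ _ _ measurableT _ _ 1) => //.
    by apply: cintegrable_meas; first exact: cintegrable_damp_expi.
  move=> t _; rewrite cabs2M cabs2_expi mul1r cabs2_real.
  by rewrite expr_le1// ?damp_ge0// damp_le1.
apply: (le_trans (sqrt_cabs2_cint measurableT ji)); rewrite ler_wpM2l//.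
apply: le_Rintegral => //; try exact: cintegrable_abs.
move=> t _; rewrite 2!cabs2M cabs2_expi mul1r cabs2_real ler_wsqrtr//.
by rewrite ler_piMl ?cabs2_ge0// expr_le1// ?damp_ge0// damp_le1.
Qed.

Let cint_itv_J (a b : R) n : a < b ->
  cint (leb R) `[a, b] (J n) = inv2pi * cint (leb R) setT (fun l => phi l *
    (2 * (atan ((b - l) / eps_ n) - atan ((a - l) / eps_ n)))%:C).
Proof.
move=> ab; have e0 := eps_gt0 (R := R) n.
pose k (z : measurableTypeR R * measurableTypeR R) : R[i] :=
  (poisson (eps_ n) (z.2 - z.1))%:C.
have mk : cmeasurable setT k.
  apply: cmeasurable_real.
  apply: (@measurableT_comp _ _ _ _ _ _ (poisson (eps_ n) : measurableTypeR R -> measurableTypeR R)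
    _ (fun z : measurableTypeR R * measurableTypeR R => z.2 - z.1)).
    by apply: continuous_measurable_fun; exact: continuous_poisson.
  by apply: measurable_funB; [exact: measurable_snd|exact: measurable_fst].
have bk z : cabs2 (k z) <= (2 / eps_ n) ^+ 2.
  rewrite cabs2_real ler_pXn2r ?poisson_le_inv ?nnegrE ?poisson_ge0//.
  by rewrite divr_ge0// ltW.
have iab : (leb R `[a, b]%classic < +oo)%E.
  by rewrite lebesgue_measure_itv /=; case: ifP => _; rewrite ?ltry// -EFinD ltry.
have mab : measurable (`[a, b]%classic : set (measurableTypeR R)).
  exact: measurable_itv.
have i1 : cintegrable (leb R) `[a, b] (fun=> 1).
  apply: (@cintegrable_bounded _ _ _ _ _ mab _ 1) => //.
  by move=> x _; rewrite -[1 : R[i]]/(1%:C) cabs2_real expr1n.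
have := @cfubini_kernelS _ _ _ _ _ (leb R) (leb R) k _ mk bk `[a, b]%classic setT
  mab measurableT (fun=> 1) phi i1 phii.
rewrite (_ : cint (leb R) `[a, b] (J n) = inv2pi * cint (leb R) `[a, b] (fun x =>
    1 * cint (leb R) setT (fun y => k (x, y) * phi y))).
  move=> ->; congr (_ * _); apply: eq_cint => l _; congr (_ * _).
  rewrite -Rintegral_poisson// -cint_real; apply: eq_cint => x _.
  by rewrite mulr1 /k /poisson /= -[(l - x) ^+ 2]sqrrN opprB.
rewrite -cintZ//.
  apply: eq_cint => x _; rewrite JE mul1r; congr (_ * _); apply: eq_cint => l _.
  by rewrite mulrC.
have [M hM] := J_bounded.
(* The Poisson integral of phi is 2 pi J, which is bounded and therefore integrable on the
   interval. *)
have iJ : cintegrable (leb R) `[a, b] (fun x => (2 * pi)%:C * J n x).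
  apply: cintegrableZ => //.
  apply: (@cintegrable_bounded _ _ _ _ _ mab _ (M ^+ 2)) => //.
    exact: cmeasurableS.
  move=> x _; rewrite -[leLHS]sqr_sqrtr ?cabs2_ge0// ler_pXn2r// nnegrE ?sqrtr_ge0//.
  exact: le_trans (sqrtr_ge0 _) (hM 0%N 0).
apply: (eq_cintegrable mab _ iJ) => x _ /=; rewrite JE mulrA mul1r.
rewrite /inv2pi -rmorphM /= mulfV ?mul1r; last by rewrite mulf_neq0// gt_eqF// pi_gt0.
by apply: eq_cint => l _; rewrite mulrC.
Qed.

Let ae_neq (a : R) : {ae leb R, forall x, x != a}.
Proof.
exists [set a]; split=> //; first exact: lebesgue_measure_set1.
by move=> x /= /negP; rewrite negbK => /eqP.
Qed.

(** Integrating over an interval avoids the pointwise convergence of Poisson averages of a merely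
    integrable phi. After exchanging the integrals, phi is multiplied by a difference of
    arctangents, which is bounded and tends to the indicator of the interval up to the factor 2
    pi. *)
Lemma cint_itv_inversion (a b : R) : a < b ->
  cint (leb R) `[a, b] (ft S w) = cint (leb R) `[a, b] phi.
Proof.
move=> ab.
have mab : measurable (`[a, b]%classic : set (measurableTypeR R)).
  exact: measurable_itv.
have iab : (leb R `[a, b]%classic < +oo)%E.
  by rewrite lebesgue_measure_itv /=; case: ifP => _; rewrite ?ltry// -EFinD ltry.
have [M hM] := J_bounded.
have mW : cmeasurable (setT : set (measurableTypeR R)) (ft setT w) by exact: cmeasurable_ft cmeasurable_inverse_ft.
transitivity (cint (leb R) `[a, b] (ft setT w)).
  by apply: eq_cint => x _; exact: WE.
have [] := @cint_dominated _ _ _ (leb R) `[a, b]%classic mab J (ft setT w) (fun=> M).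
- by move=> n; exact: cmeasurableS.
- exact: cmeasurableS.
- by apply: aeW => x _; exact: cvgJ.
- apply/integrableP; split; first exact: measurable_cst.
  by rewrite integral_cst//=; exact: lte_mul_pinfty.
- by apply: aeW => x n _; exact: hM.
move=> _ c1; apply: (ccvg_unique c1).
have -> : (fun n => cint (leb R) `[a, b] (J n)) = (fun n => inv2pi *
    cint (leb R) setT (fun l => phi l *
    (2 * (atan ((b - l) / eps_ n) - atan ((a - l) / eps_ n)))%:C)).
  by apply/funext => n; exact: cint_itv_J.
(* The limit of the arctangents: 2 pi inside the interval and 0 outside. The end points, where a
   sign vanishes, form a null set. *)
pose g l := (2 * (Num.sg (b - l) * (pi / 2) - Num.sg (a - l) * (pi / 2))) : R.
have e2pi : cint (leb R) `[a, b] phi = inv2pi * cint (leb R) setT (fun l => phi l *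
    (2 * pi * \1_(`[a, b]%classic) l)%:C).
  rewrite cint_cind (_ : (fun l => phi l * _) =
      (fun l => (2 * pi)%:C * cind `[a, b] phi l)); last first.
    by apply/funext => l; rewrite /cind rmorphM /= mulrC mulrA.
  rewrite cintZ//; last first.
    by apply: cind_integrable => //; exact: cintegrableS phii.
  rewrite mulrA /inv2pi -rmorphM /= mulVf ?mul1r//.
  by rewrite mulf_neq0// gt_eqF// pi_gt0.
rewrite e2pi; apply: ccvgM; first exact: ccvg_cst.
have mphi := cintegrable_meas phii.
have [] // := @cint_dominated _ _ _ (leb R) setT measurableT
  (fun n l => phi l * (2 * (atan ((b - l) / eps_ n) - atan ((a - l) / eps_ n)))%:C)
  (fun l => phi l * (2 * pi * \1_(`[a, b]%classic) l)%:C)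
  (fun l => 2 * pi * Num.sqrt (cabs2 (phi l))).
- have ma (c : R) n : measurable_fun setT
      (fun l : measurableTypeR R => atan ((c - l) / eps_ n)).
    apply: continuous_measurable_fun => l.
    apply: (continuous_comp (f := fun l : R => (c - l) / eps_ n)).
      apply: cvgM; last exact: cvg_cst.
      by apply: cvgB; [exact: cvg_cst|exact: cvg_id].
    exact: continuous_atan.
  move=> n; apply: cmeasurableM => //; apply: cmeasurable_real.
  by apply: measurable_funM => //; apply: measurable_funB; exact: ma.
- apply: cmeasurableM => //; apply: cmeasurable_real; apply: measurable_funM => //.
- apply: (@filterS2 _ _ (ae_filter_ringOfSetsType (leb R)) _ _ _ _ (ae_neq a) (ae_neq b)) => l la lb _.
  apply: ccvgM; first exact: ccvg_cst.
  apply: ccvg_real.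
  have -> : 2 * pi * \1_(`[a, b]%classic) l = g l.
    rewrite /g indicE; have [/set_mem|/negP h] := boolP (l \in `[a, b]%classic).
      rewrite /= in_itv /= => /andP[al lb'].
      rewrite gtr0_sg; last by rewrite subr_gt0 lt_def eq_sym lb.
      by rewrite ltr0_sg; [field|rewrite subr_lt0 lt_def la].
    case: (ltP l a) => [la'|al].
      rewrite !gtr0_sg ?subr_gt0//; first by rewrite subrr !mulr0.
      exact: lt_trans ab.
    have lb' : b < l.
      rewrite ltNge; apply/negP => h'; apply: h; apply/mem_set => /=.
      by rewrite in_itv /= al h'.
    rewrite !ltr0_sg ?subr_lt0//; first by rewrite subrr !mulr0.
    exact: lt_trans lb'.
  apply: cvgM; first exact: cvg_cst.
  by apply: cvgB; apply: cvg_atan_eps; rewrite subr_eq0 eq_sym.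
- by apply: integrableZ_EFin => //; exact: cintegrable_abs.
- apply: aeW => l n _; rewrite cabs2M cabs2_real mulrC sqrtrM ?sqr_ge0// sqrtr_sqr.
  rewrite ler_wpM2r ?sqrtr_ge0// normrM ger0_norm// ler_wpM2l//.
  have a1 := atan_ltpi2 ((b - l) / eps_ n); have a2 := atan_gtNpi2 ((b - l) / eps_ n).
  have a3 := atan_ltpi2 ((a - l) / eps_ n); have a4 := atan_gtNpi2 ((a - l) / eps_ n).
  by rewrite ler_norml; apply/andP; split; lra.
Qed.

End fourier_inversion.

(** * From integrals over intervals to almost everywhere equality *)

Section ae_zero.
Context {R : realType}.

(** All primitives of f vanish identically, and by the Lebesgue form of the fundamental theorem f is
    almost everywhere the derivative of a primitive. *)
Lemma ae_eq0_itv (f : R -> R) :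
  measurable_fun (setT : set (measurableTypeR R)) f ->
  (forall a b, a < b -> (leb R).-integrable `[a, b] (EFin \o f)) ->
  (forall a b, a < b -> Rintegral (leb R) `[a, b] f = 0) ->
  {ae leb R, forall x, f x = 0}.
Proof.
move=> mf fi f0.
have Rint0 (a b : R) : Rintegral (leb R) `[a, b] f = 0.
  case: (ltgtP a b) => [|ba|->]; first exact: f0.
    by rewrite set_itv_ge ?Rintegral_set0// -leNgt bnd_simp.
  by rewrite set_itv1 Rintegral_set1.
have fi' (a b : R) : (leb R).-integrable `[a, b] (EFin \o f).
  apply: (integrableS _ _ _ (fi a (Num.max a b + 1) _)) => //.
    by apply: subset_itvl; rewrite bnd_simp ler_wpDr// le_max lexx orbT.
  by rewrite ltr_pwDr// le_max lexx.
have locf : locally_integrable setT f.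
  split=> //; first exact: openT.
  move=> K _ cK; have [M [Mr hM]] := compact_bounded cK.
  have KM : K `<=` `[- (`|M| + 1), `|M| + 1].
    move=> x Kx; rewrite /= in_itv /= -ler_norml.
    by apply: hM => //; rewrite (le_lt_trans (ler_norm _))// ltrDl.
  have /integrableP[_] := fi' (- (`|M| + 1)) (`|M| + 1).
  apply: le_lt_trans; apply: ge0_subset_integral => //=.
  - by apply: closed_measurable; apply: compact_closed => //; exact: Rhausdorff.
  - by apply/measurable_EFinP; apply: measurable_funTS; exact: measurableT_comp.
(* A primitive based at - m speaks only of the points to the right of - m; countably many m cover
   the line. *)
have h (m : nat) := @FTC1 R f (BLeft (- m%:R)) (fun y => fi' _ y) locf.
have := ae_foralln h; apply: filterS => x hx.
pose m := Num.bound `|x|.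
have xm : - m%:R < x.
  rewrite ltrNl; apply: (le_lt_trans (ler_norm _)); rewrite normrN.
  exact: archi_boundP.
have [_ <-] := hx m ltac:(by rewrite lte_fin); rewrite (_ : (fun x0 => _) = cst 0) ?derive1_cst//.
by apply/funext => y; exact: Rint0.
Qed.

Theorem fourier_inversion (phi : R -> R[i]) (S : set (measurableTypeR R)) :
  cintegrable (leb R) setT phi -> measurable S -> (leb R S < +oo)%E ->
  (forall t, ~ S t -> inv2pi * ft setT phi (- t) = 0) ->
  {ae leb R, forall l, ft S (fun t => inv2pi * ft setT phi (- t)) l = phi l}.
Proof.
move=> phii mS finS w0; pose w t := inv2pi * ft setT phi (- t).
rewrite -[X in ft S X]/w.
have mW := cmeasurable_ft mS (cmeasurableS S (cmeasurable_inverse_ft phii)).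
have wiS : cintegrable (leb R) S w.
  have [M hM] := inverse_ft_bounded phii.
  apply: (@cintegrable_bounded _ _ _ _ _ mS _ M) => //.
    exact: cmeasurableS (cmeasurable_inverse_ft phii).
  by move=> t _; exact: hM.
have [M hM] := ft_bounded mS wiS.
have mphi := cintegrable_meas phii.
have iab (a b : R) : cintegrable (leb R) `[a, b] (fun l => ft S w l - phi l).
  have mab : measurable (`[a, b]%classic : set (measurableTypeR R)).
    exact: measurable_itv.
  have fab : (leb R `[a, b]%classic < +oo)%E.
    by rewrite lebesgue_measure_itv /=; case: ifP => _; rewrite ?ltry// -EFinD ltry.
  apply: cintegrableB => //; last by apply: cintegrableS phii.
  by apply: (@cintegrable_bounded _ _ _ _ _ mab _ M) => //; exact: cmeasurableS mW.
have cab (a b : R) : a < b -> cint (leb R) `[a, b] (fun l => ft S w l - phi l) = 0.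
  move=> ab; have mab : measurable (`[a, b]%classic : set (measurableTypeR R)).
    exact: measurable_itv.
  have ip : cintegrable (leb R) `[a, b] phi by apply: cintegrableS phii.
  rewrite cintB//; last first.
    apply: (eq_cintegrable mab _ (cintegrableD mab (iab a b) ip)) => x _ /=.
    by rewrite subrK.
  by rewrite (cint_itv_inversion phii mS finS w0 ab) subrr.
have [m1 m2] := cmeasurableD mW (cmeasurableN mphi).
have h1 := @ae_eq0_itv (fun l => complex.Re (ft S w l - phi l)) m1
  (fun a b ab => (iab a b).1) (fun a b ab => congr1 (@complex.Re R) (cab a b ab)).
have h2 := @ae_eq0_itv (fun l => complex.Im (ft S w l - phi l)) m2
  (fun a b ab => (iab a b).2) (fun a b ab => congr1 (@complex.Im R) (cab a b ab)).
apply: (@filterS2 _ _ (ae_filter_ringOfSetsType (leb R)) _ _ _ _ h1 h2) => l e1 e2.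
by apply/eqP; rewrite -subr_eq0; apply/eqP; exact: eq_parts.
Qed.

End ae_zero.

(** * The forms of H and of its inverse *)

Section weighted_inverse.
Context {R : realType} {n : nat}.
Implicit Types (F G H V : 'M[R[i]]_n) (x y u v : 'cV[R[i]]_n).

Lemma bform1E x y : bform 1%:M x y = \sum_k x k ord0 * conjc (y k ord0).
Proof. by rewrite /bform mulmx1 /mx11 mxE; apply: eq_bigr => k _; rewrite !mxE. Qed.

Lemma herm_conj F : adjmx F = F -> conjmx F = F^T.
Proof. by move=> h; rewrite -{2}h /adjmx conjmx_tr trmxK. Qed.

Lemma bform_invl H u y : H \in unitmx ->
  bform H ((invmx H)^T *m u) y = bform 1%:M u y.
Proof. by move=> uH; rewrite -bform_mull mulVmx. Qed.

Lemma bform_invr H x u : psdmx H -> H \in unitmx ->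
  bform H x ((invmx H)^T *m u) = bform 1%:M x u.
Proof.
move=> pH uH; have [hV _] := psdmx_inv pH.
by rewrite -herm_conj// -bform_mulr mulmxV.
Qed.

(** The map u -> (H^{-1})^T u carries the form of H^{-1} to the form of H. Integrated, it turns
    finite energy into membership in L_2(H). *)
Lemma bform_inv H u v : psdmx H -> H \in unitmx ->
  bform H ((invmx H)^T *m u) ((invmx H)^T *m v) = bform (invmx H) u v.
Proof.
move=> pH uH; have [hV _] := psdmx_inv pH.
by rewrite -bform_mull mulVmx// -herm_conj// -bform_mulr mul1mx.
Qed.

Lemma qform_addmx F G x : qform (F + G) x = qform F x + qform G x.
Proof. by rewrite !qformE bform_addmx Re_add. Qed.

(* [V^T F^T x] is the projection of [x] for the forms [F <= H]: the
   inequality follows from Cauchy-Schwarz for [F]. *)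
Lemma qform_proj_le F G x : psdmx F -> psdmx G -> F + G \in unitmx ->
  qform (F + G) ((invmx (F + G))^T *m (F^T *m x)) <= qform F x.
Proof.
move=> pF pG uH; set H := F + G; have pH : psdmx H by exact: psdmxD.
set y := (invmx H)^T *m _.
have e1 : bform F y x = bform H y y.
  have [hF _] := pF.
  have -> : bform H y y = bform 1%:M y (F^T *m x) by exact: bform_invr.
  by rewrite -(herm_conj hF) -bform_mulr mul1mx.
have e2 : bform H y y = (qform H y)%:C by exact: (ip_sqn (psd_sip pH)).
have := ip_cauchy_schwarz (psd_sip pF) (x := y) (y := x) I I.
rewrite e1 e2 cabs2_real !sqn_bform => cs.
have le1 : qform F y <= qform H y.
  by rewrite qform_addmx lerDl; exact: pG.2.
have q0 : 0 <= qform H y by exact: pH.2.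
have x0 : 0 <= qform F x by exact: pF.2.
have [qz|qz] := eqVneq (qform H y) 0; first by rewrite qz.
have qp : 0 < qform H y by rewrite lt_def qz.
rewrite -(ler_pM2l qp) -expr2; apply: (le_trans cs).
by rewrite ler_wpM2r.
Qed.

Lemma bform_delta (K : 'M[R[i]]_n) x k :
  bform K x (delta_mx k ord0) = (K^T *m x) k ord0.
Proof.
rewrite /bform /mx11 mxE (bigD1 k)//= big1 ?addr0.
  rewrite !mxE !eqxx /= oppr0 mulr1.
  by apply: eq_bigr => i _; rewrite !mxE mulrC.
by move=> i ik; rewrite !mxE (negbTE ik) /= oppr0 mulr0.
Qed.

Lemma bform_delta2 (K : 'M[R[i]]_n) k j :
  bform K (delta_mx k ord0) (delta_mx j ord0) = K k j.
Proof.
rewrite bform_delta mxE (bigD1 k)//= big1 ?addr0 => [|i ik].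
  by rewrite !mxE !eqxx mulr1.
by rewrite !mxE (negbTE ik) mulr0.
Qed.

Lemma bformZr (K : 'M[R[i]]_n) z x y : bform K x (z *: y) = conjc z * bform K x y.
Proof.
rewrite !bform_sum mulr_sumr; apply: eq_bigr => i _.
rewrite mulr_sumr; apply: eq_bigr => j _.
by rewrite mxE conjcM; ring.
Qed.

Lemma bform1_deltal z k y : bform 1%:M (z *: delta_mx k ord0) y = z * conjc (y k ord0).
Proof.
rewrite bformZl bform1E (bigD1 k)//= big1 ?addr0 => [|j jk].
  by rewrite mxE !eqxx mul1r.
by rewrite mxE (negbTE jk) mul0r.
Qed.

End weighted_inverse.

(** * Transforms of vector functions and the truncated kernel operators *)

Section matrix_fourier.
Context {R : realType} {n : nat}.
Local Notation RR := (measurableTypeR R).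
Variable S : set (measurableTypeR R).
Hypotheses (mS : measurable S) (finS : (leb R S < +oo)%E).
Implicit Types (x y w : R -> 'cV[R[i]]_n) (K : R -> 'M[R[i]]_n).

Lemma fourierS_ft x l k : fourierS S x l k ord0 = ft S (fun t => x t k ord0) l.
Proof. by rewrite /fourierS mxE; apply: eq_cint => t _; rewrite mxE. Qed.

(** S has finite measure and |z| <= 1 + |z|^2. *)
Lemma L2S_coord x k : L2S S x -> cintegrable (leb R) S (fun t => x t k ord0).
Proof.
move=> [mx ix]; have mk : cmeasurable S (fun t => x t k ord0) by exact: mx.
have mc (j : 'I_n) : measurable_fun S (fun t : RR => cabs2 (x t j ord0)).
  by apply: measurable_cabs2; exact: mx.
have iv : (leb R).-integrable S (EFin \o (fun t => vnorm2 (x t))).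
  apply: (ge0_fin_integrable mS _ _ ix).
    by rewrite /vnorm2; apply: measurable_sum => j; exact: mc.
  by apply: aeW => t _; apply: sumr_ge0 => j _; exact: cabs2_ge0.
apply: (@cintegrable_dom _ _ _ _ _ mS _ (fun t => 1 + vnorm2 (x t))) => //.
  apply: integrableD_EFin => //; apply/integrableP; split.
    exact: measurable_cst.
  by rewrite integral_cst//=; exact: lte_mul_pinfty.
apply: aeW => t _; have v1 : cabs2 (x t k ord0) <= vnorm2 (x t).
  by rewrite /vnorm2 (bigD1 k)//= lerDl; apply: sumr_ge0 => j _; exact: cabs2_ge0.
rewrite -(@ler_pXn2r _ 2)// ?nnegrE ?sqrtr_ge0 ?addr_ge0//.
  by rewrite sqr_sqrtr ?cabs2_ge0//; have := cabs2_ge0 (x t k ord0); nra.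
exact: le_trans (cabs2_ge0 _) v1.
Qed.

Lemma L2S_bounded x (M : R) : mxmeasurable S x ->
  (forall t k, cabs2 (x t k ord0) <= M) -> L2S S x.
Proof.
move=> mx xM; split=> //.
have vM t : vnorm2 (x t) <= n%:R * M.
  rewrite /vnorm2 -[n in n%:R]card_ord -sum1_card natr_sum mulr_suml ler_sum// => k _.
  by rewrite mul1r.
apply: (@le_lt_trans _ _ (\int[leb R]_(t in S) (n%:R * M)%:E)%E).
  apply: ge0_le_integral => //.
  - by move=> t _; rewrite lee_fin; apply: sumr_ge0 => j _; exact: cabs2_ge0.
  - apply/measurable_EFinP; apply: measurable_sum => j.
    by apply: measurable_cabs2; exact: mx.
  - by move=> t _; rewrite lee_fin.
rewrite integral_cst//= ; have [M0|M0] := leP 0 (n%:R * M).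
  exact: lte_mul_pinfty.
by apply: le_lt_trans (ltry 0); rewrite mule_le0_ge0// lee_fin ltW.
Qed.

Lemma mxmeasurable_fourierS x : L2S S x -> mxmeasurable (setT : set RR) (fourierS S x).
Proof.
move=> hx k j; rewrite ord1; under eq_fun do rewrite fourierS_ft.
by apply: cmeasurable_ft => //; have [mx _] := hx; exact: mx.
Qed.

Lemma fourierS_bounded x : L2S S x ->
  exists M : R, forall l k, cabs2 (fourierS S x l k ord0) <= M.
Proof.
move=> hx; have h k := ft_bounded mS (L2S_coord k hx).
have [f hf] := choice h; exists (\sum_k `|f k|) => l k.
rewrite fourierS_ft (le_trans (hf k l))// (le_trans (ler_norm _))//.
by rewrite (bigD1 k)//= lerDl sumr_ge0.
Qed.

Lemma L2SD x y : L2S S x -> L2S S y -> L2S S (fun t => x t + y t).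
Proof.
move=> [mx ix] [my iy]; split; first exact: mxmeasurableD.
have mv (z : R -> 'cV[R[i]]_n) : mxmeasurable S z -> measurable_fun S (fun t : RR => vnorm2 (z t)).
  move=> mz; apply: measurable_sum => j.
  by apply: measurable_cabs2; exact: mz.
have v0 (z : R -> 'cV[R[i]]_n) t : 0 <= vnorm2 (z t : 'cV[R[i]]_n).
  by apply: sumr_ge0 => j _; exact: cabs2_ge0.
have ii (z : R -> 'cV[R[i]]_n) : mxmeasurable S z -> (\int[leb R]_(t in S) (vnorm2 (z t))%:E < +oo)%E ->
    (leb R).-integrable S (EFin \o (fun t => vnorm2 (z t))).
  by move=> mz; apply: ge0_fin_integrable => //; [exact: mv|apply: aeW => t _; exact: v0].
have h := integrableD_EFin mS (integrableZ_EFin mS 2 (ii _ mx ix))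
  (integrableZ_EFin mS 2 (ii _ my iy)).
have h1 : (leb R).-integrable S (EFin \o (fun t => vnorm2 (x t + y t))).
  apply: (ae_le_integrable mS _ h).
    by apply: mv; exact: mxmeasurableD.
  apply: aeW => t _; rewrite (ger0_norm (v0 (fun t => x t + y t) t)) /vnorm2 !mulr_sumr.
  by rewrite -big_split ler_sum// => k _; rewrite mxE; exact: cabs2D.
by rewrite (integrable_EFin_Rintegral mS h1) ltry.
Qed.

Lemma L2SN x : L2S S x -> L2S S (fun t => - x t).
Proof.
move=> [mx ix]; split; first exact: mxmeasurableN.
move: ix; apply: le_lt_trans; rewrite le_eqVlt; apply/orP; left; apply/eqP.
apply: eq_integral => t _.
by congr EFin; apply: eq_bigr => k _; rewrite mxE cabs2N.
Qed.

Lemma fourierSB x y l : L2S S x -> L2S S y ->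
  fourierS S (fun t => x t - y t) l = fourierS S x l - fourierS S y l.
Proof.
move=> hx hy; apply/matrixP => k j; rewrite ord1 !mxE -cintB//.
- by apply: eq_cint => t _; rewrite !mxE mulrBr.
- apply: (eq_cintegrable mS _ (cintegrable_expi l mS (L2S_coord k hx))) => t _.
  by rewrite mxE.
- apply: (eq_cintegrable mS _ (cintegrable_expi l mS (L2S_coord k hy))) => t _.
  by rewrite mxE.
Qed.

Lemma cintegrable_bform_bounded (D : set RR) K x y : measurable D ->
  mxintegrable (leb R) D K -> mxmeasurable D x -> mxmeasurable D y ->
  (exists M, forall l k, cabs2 (x l k ord0) <= M) ->
  (exists M, forall l k, cabs2 (y l k ord0) <= M) ->
  cintegrable (leb R) D (fun l => bform (K l) (x l) (y l)).
Proof.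
move=> mD iK mx my [M hM] [M' hM'].
under eq_fun do rewrite bform_sum.
apply: cintegrable_sum => // i _; apply: cintegrable_sum => // j _.
under eq_fun do rewrite mulrAC.
have M0 (l : RR) : 0 <= M by exact: le_trans (cabs2_ge0 _) (hM l i).
apply: (@cintegrableM_bounded _ _ _ _ _ mD _ _ (M * M')) => //.
  by apply: cmeasurableM; [exact: mx|apply: cmeasurable_conj; exact: my].
by move=> l _; rewrite cabs2M cabs2_conj ler_pM ?cabs2_ge0.
Qed.

(** Integrating in u before l exhibits the operator as a Fourier multiplier: transform x, apply K^T,
    and invert over D. *)
Lemma kernel_int_ft (D : set RR) K x t k : measurable D ->
  mxintegrable (leb R) D K -> L2S S x ->
  kernel_int S D K x t k ord0 =
  inv2pi * ft D (fun l => ((K l)^T *m fourierS S x l) k ord0) (- t).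
Proof.
move=> mD iK hx; rewrite /kernel_int 2!mxE mxE; congr (_ * _).
have iKt j : cintegrable (leb R) D (fun l => expi (l * - t) * K l j k).
  exact: cintegrable_expi.
have [Mx hMx] := fourierS_bounded hx.
have iKx j : cintegrable (leb R) D (fun l => expi (l * - t) * K l j k *
    ft S (fun u => x u j ord0) l).
  under eq_fun do rewrite mulrC.
  apply: (@cintegrableM_bounded _ _ _ _ _ mD _ _ Mx) => //.
    apply: cmeasurableS; apply: cmeasurable_ft => //.
    by have [mx _] := hx; exact: mx.
  by move=> l _; rewrite -fourierS_ft.
have [/= M hM] := choice (fun j => ft_bounded mD (iKt j)).
transitivity (\sum_j cint (leb R) S (fun u => x u j ord0 *
    ft D (fun l => expi (l * - t) * K l j k) u)).
  rewrite -cint_sum//.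
    apply: eq_cint => u _; rewrite mxE.
    transitivity (\sum_j cint (leb R) D (fun l => x u j ord0 *
        (expi (l * u) * (expi (l * - t) * K l j k)))).
      rewrite -cint_sum//.
      apply: eq_cint => l _; rewrite !mxE mulr_sumr; apply: eq_bigr => j _.
      by rewrite !mxE mulrDr expiD mulrN; ring.
      by move=> j _; apply: cintegrableZ => //; exact: cintegrable_expi.
    by apply: eq_bigr => j _; rewrite /ft -cintZ//; exact: cintegrable_expi.
  move=> j _; under eq_fun do rewrite mulrC.
  apply: (@cintegrableM_bounded _ _ _ _ _ mS _ _ (M j)) => //.
  + exact: L2S_coord.
  + by apply: cmeasurableS; apply: cmeasurable_ft => //; exact: cintegrable_meas (iKt j).
under eq_bigr => j _ do rewrite (ft_swap mS mD (L2S_coord j hx) (iKt j)).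
rewrite -cint_sum//.
apply: eq_cint => l _; rewrite !mxE mulr_sumr; apply: eq_bigr => j _.
by rewrite fourierS_ft !mxE mulrA.
Qed.

(** Parseval in the form needed here: only the transforms of x and w remain. D will be a bounded
    interval for [B_s] and [R_s] and the whole line for [Q_s]. *)
Lemma inner_kernel_int (D : set RR) K x w : measurable D ->
  mxintegrable (leb R) D K -> L2S S x -> L2S S w ->
  innerS S (kernel_int S D K x) w =
  inv2pi * cint (leb R) D (fun l => bform (K l) (fourierS S x l) (fourierS S w l)).
Proof.
move=> mD iK hx hw.
pose g k l := ((K l)^T *m fourierS S x l) k ord0.
have ig k : cintegrable (leb R) D (g k).
  have [M hM] := fourierS_bounded hx.
  rewrite /g; under eq_fun do rewrite mxE.
  apply: cintegrable_sum => // j _; under eq_fun do rewrite mxE mulrC.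
  apply: (@cintegrableM_bounded _ _ _ _ _ mD _ _ M) => //.
  by apply: cmeasurableS; exact: mxmeasurable_fourierS.
have igc k := cintegrable_conj mD (ig k).
have [/= M hM] := choice (fun k => ft_bounded mD (igc k)).
have iwk k := L2S_coord k hw.
have iwg k : cintegrable (leb R) S (fun t =>
    w t k ord0 * ft D (fun l => conjc (g k l)) t).
  under eq_fun do rewrite mulrC.
  apply: (@cintegrableM_bounded _ _ _ _ _ mS _ _ (M k)) => //.
  by apply: cmeasurableS; apply: cmeasurable_ft => //; exact: cintegrable_meas (igc k).
have [Mw hMw] := fourierS_bounded hw.
have igw k : cintegrable (leb R) D (fun l =>
    conjc (g k l) * ft S (fun t => w t k ord0) l).
  under eq_fun do rewrite mulrC.
  apply: (@cintegrableM_bounded _ _ _ _ _ mD _ _ Mw) => //.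
    apply: cmeasurableS; apply: cmeasurable_ft => //.
    by have [mw _] := hw; exact: mw.
  by move=> l _; rewrite -fourierS_ft.
transitivity (\sum_k inv2pi * conjc (cint (leb R) S (fun t =>
    w t k ord0 * ft D (fun l => conjc (g k l)) t))).
  transitivity (\sum_k cint (leb R) S (fun t => inv2pi * conjc (
      w t k ord0 * ft D (fun l => conjc (g k l)) t))); last first.
    by apply: eq_bigr => k _; rewrite -cint_conj// -cintZ//; exact: cintegrable_conj.
  rewrite -cint_sum//; last by move=> k _; apply: cintegrableZ => //; exact: cintegrable_conj.
  apply: eq_cint => t _; rewrite /mx11 mxE; apply: eq_bigr => k _.
  rewrite [_^T ord0 k]mxE [conjmx (w t) k ord0]mxE kernel_int_ft// ftN//.
    by rewrite conjcM -mulrA; congr (_ * _); rewrite mulrC.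
  exact: ig.
rewrite -mulr_sumr; congr (_ * _).
under eq_bigr => k _ do rewrite (ft_swap mS mD (iwk k) (igc k)) -cint_conj//.
rewrite -cint_sum//; last by move=> k _; exact: cintegrable_conj.
apply: eq_cint => l _; rewrite /bform /mx11 mxE; apply: eq_bigr => k _.
rewrite conjcM conjcK [conjmx _ k ord0]mxE fourierS_ft; congr (_ * _).
by rewrite /g [LHS]mxE [RHS]mxE; apply: eq_bigr => j _; rewrite [_^T k j]mxE mulrC [_^T ord0 j]mxE.
Qed.

End matrix_fourier.

(** * Almost everywhere reasoning for Lebesgue measure *)

Section ae_lebesgue.
Context {R : realType}.
Implicit Types P Q : measurableTypeR R -> Prop.

(** This and the next two lemmas fix the filter instance once, which direct appeals to [filterS] for
    [leb R] would have to name each time. *)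
Lemma ae_leb_imp P Q : {ae leb R, forall x, P x} -> (forall x, P x -> Q x) ->
  {ae leb R, forall x, Q x}.
Proof.
by move=> hP PQ; apply: (@filterS _ _ (ae_filter_ringOfSetsType (leb R)) _ _ _ hP).
Qed.
Lemma ae_leb_imp2 P P' Q : {ae leb R, forall x, P x} -> {ae leb R, forall x, P' x} ->
  (forall x, P x -> P' x -> Q x) -> {ae leb R, forall x, Q x}.
Proof.
move=> hP hP' PQ.
by apply: (@filterS2 _ _ (ae_filter_ringOfSetsType (leb R)) _ _ _ _ hP hP').
Qed.
Lemma ae_leb_imp3 P P' P'' Q : {ae leb R, forall x, P x} ->
  {ae leb R, forall x, P' x} -> {ae leb R, forall x, P'' x} ->
  (forall x, P x -> P' x -> P'' x -> Q x) -> {ae leb R, forall x, Q x}.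
Proof.
move=> hP hP' hP'' PQ.
by apply: (@filterS3 _ _ (ae_filter_ringOfSetsType (leb R)) _ _ _ _ _ hP hP' hP'').
Qed.

End ae_lebesgue.

(** * The extremal problem in L_2(H) *)

Section spectral_side.
Context {R : realType} {n : nat}.
Local Notation RR := (measurableTypeR R).
Variable S : set (measurableTypeR R).
Hypotheses (mS : measurable S) (finS : (leb R S < +oo)%E).
Variables F G : R -> 'M[R[i]]_n.
Hypotheses (iF : mxintegrable (leb R) setT F) (iG : mxintegrable (leb R) setT G).
Hypotheses (pF : {ae leb R, forall l, psdmx (F l)})
  (pG : {ae leb R, forall l, psdmx (G l)})
  (uH : {ae leb R, forall l, F l + G l \in unitmx}).
Implicit Types (x y w : R -> 'cV[R[i]]_n) (K : R -> 'M[R[i]]_n).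

Let H l := F l + G l.

Lemma mxintegrable_meas K : mxintegrable (leb R) setT K ->
  mxmeasurable (setT : set RR) K.
Proof. by move=> iK i j; exact: cintegrable_meas (iK i j). Qed.

Lemma mxintegrable_add : mxintegrable (leb R) setT H.
Proof. by move=> i j; under eq_fun do rewrite mxE; exact: cintegrableD. Qed.

Lemma ae_psd_add : {ae leb R, forall l, psdmx (H l)}.
Proof. by apply: (ae_leb_imp2 pF pG) => l; exact: psdmxD. Qed.

Let mF := mxintegrable_meas iF.
Let iH := mxintegrable_add.
Let mH : mxmeasurable (setT : set RR) H := mxintegrable_meas iH.
Let pH := ae_psd_add.
Let sipH := wL2_sip mH pH.
Let sipF := wL2_sip mF pF.
Let V l := invmx (H l).
Let mV : mxmeasurable (setT : set RR) V := mxmeasurable_inv mH.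
Let pV : {ae leb R, forall l, psdmx (V l)}.
Proof. by apply: (ae_leb_imp pH) => l; exact: psdmx_inv. Qed.

Lemma wL2_bounded K x : mxintegrable (leb R) setT K -> mxmeasurable (setT : set RR) x ->
  (exists M, forall l k, cabs2 (x l k ord0) <= M) -> wL2 (leb R) K x.
Proof.
move=> iK mx bx; split=> //.
by have [] := cintegrable_bform_bounded measurableT iK mx mx bx bx.
Qed.

Lemma wL2_addl x : wL2 (leb R) H x -> wL2 (leb R) F x /\ wL2 (leb R) G x.
Proof.
move=> [mx ix]; split.
  apply: (wL2_le mF pF mx ix).
  by apply: (ae_leb_imp pG) => l [_ pg]; rewrite qform_addmx lerDl.
apply: (wL2_le (mxintegrable_meas iG) pG mx ix).
by apply: (ae_leb_imp pF) => l [_ pf]; rewrite qform_addmx lerDr.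
Qed.

Lemma wip_add x y : wL2 (leb R) H x -> wL2 (leb R) H y ->
  wip (leb R) H x y = wip (leb R) F x y + wip (leb R) G x y.
Proof.
move=> hx hy; have [Fx Gx] := wL2_addl hx; have [Fy Gy] := wL2_addl hy.
rewrite /wip -cintD//.
- by apply: eq_cint => l _; rewrite bform_addmx.
- exact: (wL2_bform mF pF Fx Fy).
- exact: (wL2_bform (mxintegrable_meas iG) pG Gx Gy).
Qed.

Definition expvec t k (l : R) : 'cV[R[i]]_n := expi (t * l) *: delta_mx k ord0.

Lemma mxmeasurable_expvec t k : mxmeasurable (setT : set RR) (expvec t k).
Proof.
apply: mxmeasurableZ; last exact: mxmeasurable_cst.
by under eq_fun do rewrite mulrC; exact: cmeasurable_expiM.
Qed.

Lemma expvec_bounded t k : exists M, forall l j, cabs2 (expvec t k l j ord0) <= M.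
Proof.
exists 1 => l j; rewrite !mxE cabs2M cabs2_expi mul1r.
by case: (_ && _); rewrite /= -?[1 : R[i]]/(1%:C) -?[0 : R[i]]/(0%:C) cabs2_real
  ?expr1n ?expr0n//= ler01.
Qed.

Lemma wL2_expvec K t k : mxintegrable (leb R) setT K -> wL2 (leb R) K (expvec t k).
Proof.
by move=> iK; apply: wL2_bounded => //; [exact: mxmeasurable_expvec|exact: expvec_bounded].
Qed.

Lemma wL2_fourierS K x : mxintegrable (leb R) setT K -> L2S S x ->
  wL2 (leb R) K (fourierS S x).
Proof.
move=> iK hx; apply: wL2_bounded => //; first exact: mxmeasurable_fourierS.
exact: fourierS_bounded.
Qed.

(** When x has finite energy for H^{-1}, this is the Riesz representative in L_2(H) of the
    functional taking y to the integral of y^T conj(x); see [wip_dualr]. *)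
Definition dual_vec x l : 'cV[R[i]]_n := (V l)^T *m x l.

Lemma mxmeasurable_dual x : mxmeasurable (setT : set RR) x ->
  mxmeasurable (setT : set RR) (dual_vec x).
Proof. by move=> mx; apply: mxmeasurableM => //; exact: mxmeasurable_tr. Qed.

Lemma wL2_dual x : wL2 (leb R) V x -> wL2 (leb R) H (dual_vec x).
Proof.
move=> [mx ix]; apply: (wL2_le mH pH (mxmeasurable_dual mx) ix).
by apply: (ae_leb_imp2 pH uH) => l ph uh; rewrite !qformE bform_inv.
Qed.

(** The pointwise inequality [qform_proj_le], integrated. It places the first term of the spectral
    characteristic in L_2(H). *)
Lemma wL2_dual_mul x : wL2 (leb R) F x ->
  wL2 (leb R) H (dual_vec (fun l => (F l)^T *m x l)).
Proof.
move=> hx; have mFx : mxmeasurable (setT : set RR) (fun l => (F l)^T *m x l).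
  by apply: mxmeasurableM; [exact: mxmeasurable_tr|case: hx].
apply: (wL2_le mH pH (mxmeasurable_dual mFx) hx.2).
by apply: (ae_leb_imp3 pF pG uH) => l pf pg uh; exact: qform_proj_le.
Qed.

Lemma wL2_dualV x : mxmeasurable (setT : set RR) x -> wL2 (leb R) H (dual_vec x) ->
  wL2 (leb R) V x.
Proof.
move=> mx [mdx ix]; apply: (wL2_le mV pV mx ix).
by apply: (ae_leb_imp2 pH uH) => l ph uh; rewrite !qformE bform_inv.
Qed.

Lemma finite_energyP x : finite_energy S F G x <->
  L2S S x /\ wL2 (leb R) V (fourierS S x).
Proof.
split=> [[hx ix]|[hx ix]]; split=> //.
  exact: (wL2P mV pV (mxmeasurable_fourierS mS hx) ix).
by rewrite (wL2_sqnE ix) ltry.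
Qed.

Lemma finite_energy_dual x : finite_energy S F G x ->
  wL2 (leb R) H (dual_vec (fourierS S x)).
Proof. by move=> /finite_energyP[_]; exact: wL2_dual. Qed.

Lemma wip_dualr x y : wL2 (leb R) H x -> mxmeasurable (setT : set RR) y ->
  wip (leb R) H x (dual_vec y) = cint (leb R) setT (fun l => bform 1%:M (x l) (y l)).
Proof.
move=> [mx _] my; apply: ae_eq_cint => //.
- by apply: cmeasurable_bform => //; exact: mxmeasurable_dual.
- by apply: cmeasurable_bform => //; exact: mxmeasurable_cst.
- by apply: (ae_leb_imp2 pH uH) => l ph uh _; rewrite bform_invr.
Qed.

(** The coordinate y_k is the pointwise H-product of [dual_vec y] with the constant vector e_k,
    which lies in L_2(H) because H is integrable. Finite energy thus yields integrability of y
    itself. *)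
Lemma cintegrable_dual_coord y k : mxmeasurable (setT : set RR) y ->
  wL2 (leb R) H (dual_vec y) -> cintegrable (leb R) setT (fun l => y l k ord0).
Proof.
move=> my hy; have hd : wL2 (leb R) H (fun _ : RR => delta_mx k ord0).
  have := wL2_expvec 0 k iH; congr wL2; apply/funext => l.
  by rewrite /expvec mul0r expi0 scale1r.
apply: (ae_eq_cintegrable measurableT (wL2_bform mH pH hy hd)); first exact: my.
apply: (ae_leb_imp uH) => l uh _; rewrite bform_invl//.
by rewrite bform_delta trmx1 mul1mx.
Qed.

Lemma finite_energyB x y : finite_energy S F G x -> finite_energy S F G y ->
  finite_energy S F G (fun t => x t - y t).
Proof.
move=> /finite_energyP[hx fx] /finite_energyP[hy fy]; apply/finite_energyP.
split; first by apply: L2SD => //; exact: L2SN.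
have := sipB (wL2_sip mV pV) fx fy; congr wL2; apply/funext => l.
by rewrite fourierSB.
Qed.

(** Tested against w, the truncated operators are integrals of one function over growing intervals.
    Once that function is integrable, dominated convergence gives the integral over the line,
    although K alone may not be integrable there. *)
Lemma kernel_op_inner K x y w : kernel_op S F G K x y -> finite_energy S F G w ->
  cintegrable (leb R) setT (fun l => bform (K l) (fourierS S x l) (fourierS S w l)) ->
  innerS S y w = inv2pi *
    cint (leb R) setT (fun l => bform (K l) (fourierS S x l) (fourierS S w l)).
Proof.
move=> [iK hx hy lim] fw ib; have [hw _] := fw.
set b := fun l => bform _ _ _ in ib *.
have c1 : ccvg (fun m : nat => innerS S (kernel_int S `[- m%:R, m%:R] K x) w)
    (innerS S y w).
  apply: ccvg_cabs2; apply: (cvg_comp (fun m : nat => m%:R : R)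
    (fun L => cabs2 (innerS S (kernel_int S `[- L, L] K x) w - innerS S y w))).
    exact: cvgr_idn.
  exact: lim.
apply: (ccvg_unique c1).
have mL (m : nat) : measurable (`[- m%:R, m%:R]%classic : set RR) by exact: measurable_itv.
under eq_fun do rewrite (inner_kernel_int mS finS (mL _) (iK _) hx hw) -/b.
apply: ccvgM; first exact: ccvg_cst.
have mb := cintegrable_meas ib.
have -> : (fun m : nat => cint (leb R) `[- (m%:R : R), (m%:R : R)] b) =
    (fun m : nat => cint (leb R) setT (cind `[- (m%:R : R), (m%:R : R)] b)).
  by apply/funext => m; rewrite cint_cind.
have [] // := @cint_dominated _ _ _ (leb R) setT measurableT
  (fun m : nat => cind `[- (m%:R : R), (m%:R : R)] b) b (fun l => Num.sqrt (cabs2 (b l))).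
- by move=> m; apply: cind_measurable; [exact: mL|exact: cmeasurableS].
- apply: aeW => l _; pose N := Num.bound `|l|.
  have lN (m : nat) : (N <= m)%N -> cind `[- (m%:R : R), (m%:R : R)] b l = b l.
    move=> Nm; apply: cind_in; rewrite /= in_itv /= -ler_norml.
    by apply: (le_trans (ltW (archi_boundP _))) => //; rewrite ler_nat.
  split; apply: cvg_near_cst; exists N => // m /= Nm; by rewrite lN.
- exact: cintegrable_abs.
- apply: aeW => l m _; have [lm|lm] := pselect (`[- (m%:R : R), (m%:R : R)]%classic l).
    by rewrite cind_in.
  by rewrite cind_out// -[0 : R[i]]/(0%:C) cabs2_real expr0n sqrtr0 sqrtr_ge0.
Qed.

Variables (a c Ra : R -> 'cV[R[i]]_n).
Hypotheses (ha : L2S S a) (hRa : graph_R S F G a Ra) (hc : graph_B S F G c Ra).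

Let A := fourierS S a.
Let C := fourierS S c.
Let mA : mxmeasurable (setT : set RR) A := mxmeasurable_fourierS mS ha.
Let fc : finite_energy S F G c := hc.1.
Let mC : mxmeasurable (setT : set RR) C := mxmeasurable_fourierS mS fc.1.
Let g0 : R -> 'cV[R[i]]_n := dual_vec (fun l => (F l)^T *m A l).
Let hA : wL2 (leb R) F A := wL2_fourierS iF ha.

Lemma wL2_proj : wL2 (leb R) H g0.
Proof. exact: wL2_dual_mul hA. Qed.

(** The form of F H^{-1} at the transforms of a and w is the pointwise H-product of [g0] and the
    dual vector of w; both lie in L_2(H), which provides the integrability asked by
    [kernel_op_inner]. *)
Lemma inner_R w : finite_energy S F G w ->
  innerS S Ra w = inv2pi * wip (leb R) H g0 (dual_vec (fourierS S w)).
Proof.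
move=> fw; have mw := mxmeasurable_fourierS mS fw.1.
have hw := finite_energy_dual fw.
have e1 : {ae leb R, forall l, setT l -> bform (H l) (g0 l) (dual_vec (fourierS S w) l) =
    bform (F l *m V l) (A l) (fourierS S w l)}.
  apply: (ae_leb_imp2 pH uH) => l ph uh _.
  rewrite /g0 /dual_vec bform_inv// -bform_mull.
  by rewrite /V.
have m2 : cmeasurable (setT : set RR) (fun l =>
    bform (F l *m V l) (A l) (fourierS S w l)).
  by apply: cmeasurable_bform => //; exact: mxmeasurableM.
have i1 := wL2_bform mH pH wL2_proj hw.
have e2 := ae_eq_cint measurableT (cintegrable_meas i1) m2 e1.
have := kernel_op_inner hRa fw (ae_eq_cintegrable measurableT i1 m2 e1).
by rewrite -e2.
Qed.

Lemma inner_B w : finite_energy S F G w ->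
  innerS S Ra w = inv2pi * wip (leb R) H (dual_vec C) (dual_vec (fourierS S w)).
Proof.
move=> fw; have mw := mxmeasurable_fourierS mS fw.1.
have [_ hfw] := (finite_energyP w).1 fw; have [_ hfc] := (finite_energyP c).1 fc.
have hw := finite_energy_dual fw; have hcd := finite_energy_dual fc.
have i1 := wL2_bform mV pV hfc hfw.
have e1 : {ae leb R, forall l, setT l -> bform (V l) (C l) (fourierS S w l) =
    bform (H l) (dual_vec C l) (dual_vec (fourierS S w) l)}.
  by apply: (ae_leb_imp2 pH uH) => l ph uh _; rewrite bform_inv.
have e2 := ae_eq_cint measurableT (cintegrable_meas i1)
  (cintegrable_meas (wL2_bform mH pH hcd hw)) e1.
have := kernel_op_inner hc.2 fw i1.
by rewrite e2.
Qed.

Definition spectral_char l := g0 l - dual_vec C l.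

Lemma wL2_spectral_char : wL2 (leb R) H spectral_char.
Proof. exact: (sipB sipH wL2_proj (finite_energy_dual fc)). Qed.

Lemma inv2pi_neq0 : inv2pi != 0 :> R[i].
Proof.
rewrite /inv2pi; apply/eqP => /(congr1 (@complex.Re R)) /= /eqP.
by rewrite invr_eq0 mulf_eq0 pnatr_eq0 /= gt_eqF// pi_gt0.
Qed.

(** Both terms of h contribute 2 pi times the pairing of [Ra] with w: one through [R_s] applied to
    a, the other through [B_s] applied to c. *)
Lemma spectral_char_orth w : finite_energy S F G w ->
  wip (leb R) H spectral_char (dual_vec (fourierS S w)) = 0.
Proof.
move=> fw; have hw := finite_energy_dual fw.
rewrite (ipBl sipH wL2_proj (finite_energy_dual fc) hw).
apply/eqP; rewrite subr_eq0; apply/eqP.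
apply: (mulfI inv2pi_neq0).
exact (etrans (esym (inner_R fw)) (inner_B fw)).
Qed.

Hypothesis cS : closed S.

(** The inner product is conjugate to the inversion integral at t of the k-th coordinate of the
    transform of w, which is integrable since w has finite energy. As S is closed, t is at a
    positive distance from it and [ft_vanish] applies. *)
Lemma wip_expvec_vanish w t k : finite_energy S F G w -> ~ S t ->
  wip (leb R) H (expvec t k) (dual_vec (fourierS S w)) = 0.
Proof.
move=> fw St; have mw := mxmeasurable_fourierS mS fw.1.
have hw := finite_energy_dual fw.
rewrite (wip_dualr (wL2_expvec t k iH) mw).
have [dl d0 hdl] : exists2 dl : R, 0 < dl & forall s, S s -> dl <= `|s - t|.
  have /nbhs_ballP[e /= e0 he] : nbhs t (~` S).
    by apply: open_nbhs_nbhs; split => //; exact: closed_openC.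
  exists e => // s Ss; rewrite leNgt; apply/negP => st.
  by apply: (he s) => //; rewrite /ball /= distrC.
have iW := cintegrable_dual_coord k mw hw.
have iW' : cintegrable (leb R) setT (ft S (fun s => w s k ord0)).
  by apply: (eq_cintegrable measurableT _ iW) => l _; rewrite fourierS_ft.
have v0 := ft_vanish mS (L2S_coord mS finS k fw.1) iW' d0 hdl.
transitivity (conjc (cint (leb R) setT (fun l => expi (l * - t) *
    ft S (fun s => w s k ord0) l))); last by rewrite v0 conjc0.
rewrite -cint_conj//; last exact: cintegrable_expi.
apply: eq_cint => l _; rewrite bform1_deltal.
by rewrite conjcM -expiN mulrN opprK (mulrC l) fourierS_ft.
Qed.

Definition obs_comb (q : R -> 'cV[R[i]]_n) : Prop :=
  exists (m : nat) (t : 'I_m -> R) (k : 'I_m -> 'I_n) (z : 'I_m -> R[i]),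
    (forall j, ~ S (t j)) /\ q = \sum_j z j *: expvec (t j) (k j).

Lemma wL2_obs_comb K q : mxintegrable (leb R) setT K ->
  {ae leb R, forall l, psdmx (K l)} -> obs_comb q -> wL2 (leb R) K q.
Proof.
move=> iK pK [m [t [k [z [_ ->]]]]].
have sip := wL2_sip (mxintegrable_meas iK) pK.
apply: (sip_sum sip) => j; apply: (sipZ sip); exact: wL2_expvec.
Qed.

Variable p : R -> 'cV[R[i]]_n.
Hypotheses (hp : wL2 (leb R) H p)
  (lim_p : forall e : R, 0 < e -> exists q, obs_comb q /\ sqn (wip (leb R) H) (q - p) < e)
  (orth_p : forall t k, ~ S t ->
    wip (leb R) F A (expvec t k) = wip (leb R) H p (expvec t k)).

Lemma limit_orth w : finite_energy S F G w ->
  wip (leb R) H p (dual_vec (fourierS S w)) = 0.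
Proof.
move=> fw; have hw := finite_energy_dual fw.
set W := dual_vec _ in hw *; set b := wip _ _ _ _.
apply: cabs2_eq0; apply/le_anti; rewrite cabs2_ge0 andbT.
apply/ler_addgt0Pl => e e0; rewrite addr0.
have s0 := sqn_ge0 sipH hw.
have s1 : 0 < sqn (wip (leb R) H) W + 1 by rewrite ltr_wpDl.
(* The tolerance e/(|W|^2 + 1) absorbs the factor |W|^2 of Cauchy-Schwarz; the 1 covers the case |W|
   = 0. *)
have [q [oq hq]] := lim_p (divr_gt0 e0 s1).
have wq := wL2_obs_comb iH pH oq.
have q0 : wip (leb R) H q W = 0.
  have [m [t [k [z [St ->]]]]] := oq.
  rewrite (ip_suml sipH) => [|j|]; [|exact: (sipZ sipH (z j) (wL2_expvec (t j) (k j) iH))|exact: hw].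
  rewrite big1// => j _; rewrite (ipZl sipH _ (wL2_expvec (t j) (k j) iH) hw).
  by rewrite /W (wip_expvec_vanish _ fw (St j)) mulr0.
have -> : b = - wip (leb R) H (q - p) W.
  by rewrite (ipBl sipH wq hp hw) q0 sub0r opprK.
rewrite cabs2N; apply: (le_trans (ip_cauchy_schwarz sipH (sipB sipH wq hp) hw)).
have h1 : sqn (wip (leb R) H) (q - p) * (sqn (wip (leb R) H) W + 1) <= e.
  by rewrite -ler_pdivlMr// ltW.
apply: le_trans h1; apply: ler_wpM2l; last by rewrite lerDl ler01.
exact: (sqn_ge0 sipH (sipB sipH wq hp)).
Qed.

Let g1 l := g0 l - p l.
Let hg1 : wL2 (leb R) H g1 := sipB sipH wL2_proj hp.
(** Almost everywhere this is F^T A - H^T p, and its dual vector is [g1]. *)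
Let phi l : 'cV[R[i]]_n := (H l)^T *m g1 l.

Let mphi : mxmeasurable (setT : set RR) phi.
Proof. by apply: mxmeasurableM; [exact: mxmeasurable_tr|case: hg1]. Qed.

Let dual_phi : {ae leb R, forall l, dual_vec phi l = g1 l}.
Proof.
apply: (ae_leb_imp uH) => l uh.
by rewrite /dual_vec /phi mulmxA -trmx_mul mulmxV// trmx1 mul1mx.
Qed.

Let hphi : wL2 (leb R) H (dual_vec phi).
Proof.
apply: (wL2_le mH pH (mxmeasurable_dual mphi) hg1.2).
by apply: (ae_leb_imp dual_phi) => l ->.
Qed.

Let iphi k : cintegrable (leb R) setT (fun l => phi l k ord0).
Proof. exact: cintegrable_dual_coord. Qed.

(** The left side is the H-product of [g1] with the exponential at t, and [orth_p] says that [g0]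
    and p have the same product with it. *)
Let phi_vanish k t : ~ S t -> ft setT (fun l => phi l k ord0) (- t) = 0.
Proof.
move=> St.
have hE := wL2_expvec t k iH; have hEF := wL2_expvec t k iF.
have e0 : wip (leb R) H g1 (expvec t k) = 0.
  rewrite (ipBl sipH wL2_proj hp hE) -(orth_p k St).
  apply/eqP; rewrite subr_eq0; apply/eqP.
  apply: (ae_eq_cint measurableT (cintegrable_meas (wL2_bform mH pH wL2_proj hE))
    (cintegrable_meas (wL2_bform mF pF hA hEF))).
  apply: (ae_leb_imp2 pF uH) => l [hF _] uh _.
  by rewrite /g0 /dual_vec bform_invl// -bform_mull mulmx1.
rewrite /ft -[RHS]e0; apply: eq_cint => l _.
by rewrite /expvec bformZr bform_delta mulrN expiN (mulrC l).
Qed.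

Let w t : 'cV[R[i]]_n := \col_k (inv2pi * ft setT (fun l => phi l k ord0) (- t)).

Let hw : L2S S w.
Proof.
have [/= M hM] := choice (fun k => inverse_ft_bounded (iphi k)).
apply: (L2S_bounded mS finS (M := \sum_k `|M k|)).
  move=> k j; under eq_fun do rewrite mxE.
  exact: cmeasurableS (cmeasurable_inverse_ft (iphi k)).
move=> t k; rewrite mxE; apply: (le_trans (hM k t)).
apply: (le_trans (ler_norm _)).
by rewrite (bigD1 k) // lerDl; apply: sumr_ge0.
Qed.

Let fourier_w : {ae leb R, forall l, fourierS S w l = phi l}.
Proof.
have h k : {ae leb R, forall l, fourierS S w l k ord0 = phi l k ord0}.
  have h0 := fourier_inversion (iphi k) mS finS (fun t St =>
    etrans (congr1 (fun z => inv2pi * z) (phi_vanish k St)) (mulr0 _)).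
  apply: (ae_leb_imp h0) => l <-; rewrite fourierS_ft; apply: eq_cint => t _.
  by rewrite mxE.
(* The coordinates are re-indexed by the natural numbers, so that countable intersection gives one
   exceptional set for all of them. *)
have h' (m : nat) : {ae leb R, forall l, forall k : 'I_n, k = m :> nat ->
    fourierS S w l k ord0 = phi l k ord0}.
  case: (ltnP m n) => [mn|nm].
    apply: (ae_leb_imp (h (Ordinal mn))) => l e k km.
    by have -> : k = Ordinal mn by exact: val_inj.
  by apply: aeW => l k km; have := ltn_ord k; rewrite km ltnNge nm.
apply: (ae_leb_imp (ae_foralln h')) => l e.
by apply/matrixP => k j; rewrite ord1; exact: e.
Qed.

Let fw : finite_energy S F G w.
Proof.
apply/finite_energyP; split; first exact: hw.
have mw := mxmeasurable_fourierS mS hw.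
apply: (wL2_le mV pV mw (wL2_dualV mphi hphi).2).
by apply: (ae_leb_imp fourier_w) => l ->.
Qed.

Lemma spectral_char_unique : sqn (wip (leb R) H) (p - spectral_char) = 0.
Proof.
have fu := finite_energyB fw fc; set u := fun t => _ in fu.
have hu := finite_energy_dual fu.
have hs := wL2_spectral_char.
have o1 := spectral_char_orth fu; have o2 := limit_orth fu.
have hd : wL2 (leb R) H (p - spectral_char) := sipB sipH hp hs.
have e1 : {ae leb R, forall l, dual_vec (fourierS S u) l = (spectral_char - p) l}.
  apply: (ae_leb_imp2 fourier_w dual_phi) => l e2 e3.
  rewrite /u /dual_vec fourierSB//; last by case: fc.
  rewrite mulmxBr e2; change ((V l)^T *m phi l) with (dual_vec phi l); rewrite e3.
  change ((spectral_char - p) l) with (g0 l - dual_vec C l - p l).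
  by rewrite /g1 addrAC.
rewrite (sqnC sipH hp hs).
have hd' : wL2 (leb R) H (spectral_char - p) := sipB sipH hs hp.
have e2 : wip (leb R) H (spectral_char - p) (spectral_char - p) =
    wip (leb R) H (spectral_char - p) (dual_vec (fourierS S u)).
  apply: (ae_eq_cint measurableT (cintegrable_meas (wL2_bform mH pH hd' hd'))
    (cintegrable_meas (wL2_bform mH pH hd' hu))).
  by apply: (ae_leb_imp e1) => l e _; rewrite e.
by rewrite /sqn e2 (ipBl sipH hs hp hu) o1 o2 subr0.
Qed.

End spectral_side.

(** * Limits and isometries between semi-inner product spaces *)

Section limits_in_inner_product_spaces.
Context {R : realType}.

Lemma ip_sumr (V : lmodType R[i]) (W : V -> Prop) ip (hip : semi_inner_product W ip)
    I (s : seq I) (F : I -> V) u : (forall i, W (F i)) -> W u ->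
  ip u (\sum_(i <- s) F i) = \sum_(i <- s) ip u (F i).
Proof.
move=> h hu; rewrite (ip_conj hip (sip_sum hip s h) hu) (ip_suml hip s h hu) rmorph_sum.
by apply: eq_bigr => i _; rewrite /= -(ip_conj hip).
Qed.

Lemma ip_limit (V : lmodType R[i]) (W : V -> Prop) ip (hip : semi_inner_product W ip)
    (x : nat -> V) y z (e : nat -> R) : (forall i, W (x i)) -> W y -> W z ->
  (forall i, sqn ip (x i - y) <= e i) -> e i @[i --> \oo] --> (0 : R) ->
  ccvg (fun i => ip (x i) z) (ip y z).
Proof.
move=> hx hy hz he e0.
apply: (@ccvg_le _ _ _ (fun i => e i * sqn ip z)).
  move=> i; rewrite -(ipBl hip (hx i) hy hz).
  apply: (le_trans (ip_cauchy_schwarz hip (sipB hip (hx i) hy) hz)).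
  by apply: ler_wpM2r; [exact: (sqn_ge0 hip hz)|exact: he].
by rewrite -[X in _ --> X](mul0r (sqn ip z)); apply: cvgM => //; exact: cvg_cst.
Qed.

Lemma ip_limitr (V : lmodType R[i]) (W : V -> Prop) ip (hip : semi_inner_product W ip)
    (x : nat -> V) y z (e : nat -> R) : (forall i, W (x i)) -> W y -> W z ->
  (forall i, sqn ip (x i - y) <= e i) -> e i @[i --> \oo] --> (0 : R) ->
  ccvg (fun i => ip z (x i)) (ip z y).
Proof.
move=> hx hy hz he e0; rewrite (ip_conj hip hy hz).
have -> : (fun i => ip z (x i)) = (fun i => conjc (ip (x i) z)).
  by apply/funext => i; rewrite -(ip_conj hip).
by apply: ccvg_conj; exact: (ip_limit hip hx hy hz he e0).
Qed.

Variables (V1 V2 : lmodType R[i]) (W1 : V1 -> Prop) (W2 : V2 -> Prop).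
Variables (ip1 : V1 -> V1 -> R[i]) (ip2 : V2 -> V2 -> R[i]).
Hypotheses (hip1 : semi_inner_product W1 ip1) (hip2 : semi_inner_product W2 ip2).
Variable K : R.

(** Used with K = 1/(2 pi), for the observations against exponentials and for the orthogonal
    measures against indicators. *)
Lemma ip_comb_eq m m' (f : 'I_m -> V1) (f' : 'I_m' -> V1) (g : 'I_m -> V2)
    (g' : 'I_m' -> V2) (z : 'I_m -> R[i]) (z' : 'I_m' -> R[i]) :
  (forall j, W1 (f j)) -> (forall j, W1 (f' j)) ->
  (forall j, W2 (g j)) -> (forall j, W2 (g' j)) ->
  (forall i j, ip1 (f i) (f' j) = K%:C * ip2 (g i) (g' j)) ->
  ip1 (\sum_j z j *: f j) (\sum_j z' j *: f' j) =
  K%:C * ip2 (\sum_j z j *: g j) (\sum_j z' j *: g' j).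
Proof.
move=> hf hf' hg hg' h.
have hzf j := sipZ hip1 (z j) (hf j); have hzf' j := sipZ hip1 (z' j) (hf' j).
have hzg j := sipZ hip2 (z j) (hg j); have hzg' j := sipZ hip2 (z' j) (hg' j).
rewrite (ip_suml hip1 _ hzf (sip_sum hip1 _ hzf')).
rewrite (ip_suml hip2 _ hzg (sip_sum hip2 _ hzg')).
rewrite mulr_sumr; apply: eq_bigr => i _.
rewrite (ip_sumr hip1 _ hzf' (hzf i)) (ip_sumr hip2 _ hzg' (hzg i)).
rewrite mulr_sumr; apply: eq_bigr => j _.
rewrite (ipZl hip1 _ (hf i) (hzf' j)) (ipZr hip1 _ (hf i) (hf' j)) h.
rewrite (ipZl hip2 _ (hg i) (hzg' j)) (ipZr hip2 _ (hg i) (hg' j)).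
by rewrite !mulrA; congr (_ * _); rewrite mulrC mulrA.
Qed.

Lemma sqnB_isometry x x' y y' : W1 x -> W1 x' -> W2 y -> W2 y' ->
  ip1 x x = K%:C * ip2 y y -> ip1 x x' = K%:C * ip2 y y' ->
  ip1 x' x' = K%:C * ip2 y' y' -> sqn ip1 (x - x') = K * sqn ip2 (y - y').
Proof.
move=> hx hx' hy hy' e1 e2 e3.
have e4 : ip1 x' x = K%:C * ip2 y' y.
  by rewrite (ip_conj hip1 hx hx') e2 conjcM conjc_real -(ip_conj hip2).
rewrite /sqn.
rewrite (ipBl hip1 hx hx' (sipB hip1 hx hx')) (ipBr hip1 hx hx hx') (ipBr hip1 hx' hx hx').
rewrite (ipBl hip2 hy hy' (sipB hip2 hy hy')) (ipBr hip2 hy hy hy') (ipBr hip2 hy' hy hy').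
by rewrite e1 e2 e3 e4 !partsE /=; ring.
Qed.

End limits_in_inner_product_spaces.

(** * Random variables as a weighted L_2 space *)

Section random_variables_space.
Context {R : realType} {d : measure_display} {Omega : measurableType d}.
Variable P : probability Omega R.
Implicit Types X Y Z : Omega -> R[i].

(** With the constant weight 1 on vectors of size 1, the laws for random variables are inherited
    from the weighted L_2 space. *)
Definition cst1 : Omega -> 'M[R[i]]_1 := fun=> 1%:M.
Definition emb X (w : Omega) : 'cV[R[i]]_1 := const_mx (X w).

Lemma mxmeasurable_cst1 : mxmeasurable setT cst1.
Proof. exact: mxmeasurable_cst. Qed.

Lemma psd_1 : psdmx (1%:M : 'M[R[i]]_1).
Proof.
split=> [|v].
  by apply/matrixP => i j; rewrite !mxE eq_sym; case: (i == j); rewrite /= oppr0.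
rewrite qformE bform1E big_ord1 mulconj /=; exact: cabs2_ge0.
Qed.

Let pcst1 : {ae P, forall w, psdmx (cst1 w)}.
Proof. by apply: aeW => w; exact: psd_1. Qed.

Lemma bform_emb X Y w : bform (cst1 w) (emb X w) (emb Y w) = X w * conjc (Y w).
Proof. by rewrite bform1E big_ord1 !mxE. Qed.

Lemma corrE X Y : corr P X Y = wip P cst1 (emb X) (emb Y).
Proof. by apply: eq_cint => w _; rewrite bform_emb. Qed.

Lemma rv2_wL2 X : rv2 P X -> wL2 P cst1 (emb X).
Proof.
move=> [mX iX _].
have mE : mxmeasurable setT (emb X) by move=> i j; under eq_fun do rewrite mxE.
apply: (wL2P mxmeasurable_cst1 pcst1 mE).
rewrite (eq_integral (fun w => (cabs2 (X w))%:E))// => w _.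
by rewrite qformE bform_emb mulconj.
Qed.

Lemma wL2_cintegrable X : wL2 P cst1 (emb X) -> cintegrable P setT X.
Proof.
move=> [mE iE].
have mX : cmeasurable setT X.
  by have := mE ord0 ord0; under eq_fun do rewrite mxE.
apply: (@cintegrable_dom _ _ _ _ _ measurableT _ (fun w => 1 + qform (cst1 w) (emb X w))) => //.
  apply: integrableD_EFin => //; apply/integrableP; split; first exact: measurable_cst.
  by rewrite integral_cst//= probability_setT mule1 ltry.
apply: aeW => w _; rewrite qformE bform_emb mulconj /=.
have c0 := cabs2_ge0 (X w).
have c1 : 0 <= 1 + cabs2 (X w) by rewrite addr_ge0.
rewrite -(@ler_pXn2r _ 2)// ?nnegrE ?sqrtr_ge0//.
by rewrite sqr_sqrtr//; nra.
Qed.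

Lemma rv2_cintegrable X : rv2 P X -> cintegrable P setT X.
Proof. by move=> hX; apply: wL2_cintegrable; exact: rv2_wL2. Qed.

Lemma wL2_rv2 X : wL2 P cst1 (emb X) -> cint P setT X = 0 -> rv2 P X.
Proof.
move=> hX X0; split=> //; first exact: (cintegrable_meas (wL2_cintegrable hX)).
have := wL2_sqnE hX; rewrite (eq_integral (fun w => (cabs2 (X w))%:E)).
  by move=> ->; rewrite ltry.
by move=> w _; rewrite qformE bform_emb mulconj.
Qed.

Lemma emb0 : emb (0 : Omega -> R[i]) = 0.
Proof. by apply/funext => w; apply/matrixP => i j; rewrite !mxE. Qed.
Lemma embD X Y : emb (X + Y) = emb X + emb Y.
Proof. by apply/funext => w; apply/matrixP => i j; rewrite !mxE. Qed.
Lemma embZ (z : R[i]) X : emb (z *: X) = z *: emb X.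
Proof. by apply/funext => w; apply/matrixP => i j; rewrite !mxE. Qed.

Lemma rv2_sip : semi_inner_product (rv2 P) (corr P).
Proof.
have sip := wL2_sip mxmeasurable_cst1 pcst1.
split.
- apply: wL2_rv2; first by rewrite emb0; exact: (sip0 sip).
  exact: cint0.
- move=> X Y hX hY; apply: wL2_rv2.
    by rewrite embD; apply: (sipD sip); exact: rv2_wL2.
  have := cintD measurableT (rv2_cintegrable hX) (rv2_cintegrable hY).
  by have [_ _ ->] := hX; have [_ _ ->] := hY; rewrite addr0.
- move=> z X hX; apply: wL2_rv2.
    by rewrite embZ; apply: (sipZ sip); exact: rv2_wL2.
  have := cintZ measurableT z (rv2_cintegrable hX).
  by have [_ _ ->] := hX; rewrite mulr0.
- move=> X Y Z hX hY hZ; rewrite !corrE embD.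
  by apply: (ipDl sip); exact: rv2_wL2.
- move=> z X Z hX hZ; rewrite !corrE embZ.
  by apply: (ipZl sip); exact: rv2_wL2.
- move=> X Y hX hY; rewrite !corrE.
  by apply: (ip_conj sip); exact: rv2_wL2.
- move=> X hX; rewrite corrE.
  by apply: (ip_ge0 sip); exact: rv2_wL2.
Qed.

Lemma msdistE X Y : rv2 P X -> rv2 P Y -> msdist P X Y = (sqn (corr P) (X - Y))%:E.
Proof.
move=> hX hY; have hd := rv2_wL2 (sipB rv2_sip hX hY).
rewrite /sqn corrE -[complex.Re _]/(sqn (wip P cst1) (emb (X - Y))) -(wL2_sqnE hd).
by apply: eq_integral => w _; rewrite qformE bform_emb mulconj.
Qed.

Lemma corrmxE n (X Y : Omega -> 'cV[R[i]]_n) i j : corrmx P X Y i j =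
  corr P (fun w => X w i ord0) (fun w => Y w j ord0).
Proof.
rewrite /corrmx mxE; apply: eq_cint => w _.
by rewrite mxE big_ord1 !mxE.
Qed.

End random_variables_space.

(** * Correlations in spectral terms *)

Section process_spectrum.
Context {R : realType} {d : measure_display} {Omega : measurableType d}.
Variable P : probability Omega R.
Context {n : nat}.
Local Notation RR := (measurableTypeR R).
Implicit Types (x : R -> Omega -> 'cV[R[i]]_n) (K : R -> 'M[R[i]]_n).

Definition coord x t k (w : Omega) : R[i] := x t w k ord0.

Lemma corr_spectral x Rx K t s k j : stationary P x Rx -> spectral_density K Rx ->
  corr P (coord x t k) (coord x s j) =
  inv2pi * wip (leb R) K (expvec t k) (expvec s j).
Proof.
move=> [_ hR] [_ _ hK].
rewrite /coord -corrmxE -{1}(subrK s t) addrC hR hK 2!mxE; congr (_ * _).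
apply: eq_cint => l _.
rewrite mxE /expvec bformZl bformZr mulrA -expiN -expiD -mulrBl; congr (_ * _).
by rewrite bform_delta2.
Qed.

Lemma bform_coord (M : 'M[R[i]]_n) u v :
  bform M u v = \sum_k u k ord0 * bform M (delta_mx k ord0) v.
Proof.
rewrite bform_sum; apply: eq_bigr => k _; rewrite bform_sum [in RHS](bigD1 k)//=.
rewrite [X in _ * (_ + X)]big1 ?addr0 => [|i ik].
  rewrite mulr_sumr; apply: eq_bigr => j _.
  by rewrite !mxE !eqxx mul1r mulrA.
by rewrite big1// => j _; rewrite !mxE (negbTE ik) !mul0r.
Qed.

Variable S : set (measurableTypeR R).
Hypotheses (mS : measurable S) (finS : (leb R S < +oo)%E).

Lemma functional_spectral (a : R -> 'cV[R[i]]_n) x X K Y y : L2S S a ->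
  (forall t k, rv2 P (coord x t k)) -> is_functional P S a x X ->
  mxintegrable (leb R) setT K -> {ae leb R, forall l, psdmx (K l)} ->
  rv2 P Y -> wL2 (leb R) K y ->
  (forall t k, corr P (coord x t k) Y = inv2pi * wip (leb R) K (expvec t k) y) ->
  corr P X Y = inv2pi * wip (leb R) K (fourierS S a) y.
Proof.
move=> ha hx [_ hX] iK pK hY hy hc; rewrite (hX _ hY).
have hE k := wL2_expvec 0 k iK.
have ek k (l : RR) : expvec 0 k l = delta_mx k ord0 by rewrite /expvec mul0r expi0 scale1r.
pose g k l := bform (K l) (delta_mx k ord0) (y l).
have ig k : cintegrable (leb R) setT (g k).
  apply: (eq_cintegrable measurableT _ (wL2_bform (mxintegrable_meas iK) pK (hE k) hy)).
  by move=> l _; rewrite /g ek.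
have ce t k : wip (leb R) K (expvec t k) y = ft setT (g k) t.
  by apply: eq_cint => l _; rewrite /expvec bformZl mulrC -(mulrC t) mulrC.
have [/= M hM] := choice (fun k => ft_bounded measurableT (ig k)).
have iag k : cintegrable (leb R) S (fun t => a t k ord0 * ft setT (g k) t).
  under eq_fun do rewrite mulrC.
  apply: (@cintegrableM_bounded _ _ _ _ _ mS _ _ (M k)) => //.
  - exact: L2S_coord.
  - by apply: cmeasurableS; apply: cmeasurable_ft => //; exact: cintegrable_meas (ig k).
have [Ma hMa] := fourierS_bounded mS finS ha.
have iga k : cintegrable (leb R) setT (fun l => g k l * ft S (fun t => a t k ord0) l).
  under eq_fun do rewrite mulrC.
  apply: (@cintegrableM_bounded _ _ _ _ _ measurableT _ _ Ma) => //.
    by apply: cmeasurable_ft => //; case: ha => ma _; exact: ma.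
  by move=> l _; rewrite -fourierS_ft.
have e1 t : corr P (fun w => mx11 ((a t)^T *m x t w)) Y =
    inv2pi * \sum_k a t k ord0 * ft setT (g k) t.
  have -> : (fun w => mx11 ((a t)^T *m x t w)) = \sum_k a t k ord0 *: coord x t k.
    apply/funext => w; rewrite /mx11 mxE fct_sumE; apply: eq_bigr => k _.
    by rewrite mxE.
  rewrite (ip_suml (rv2_sip P) _ (fun k => sipZ (rv2_sip P) _ (hx t k)) hY).
  rewrite mulr_sumr; apply: eq_bigr => k _.
  by rewrite (ipZl (rv2_sip P) _ (hx t k) hY) hc ce mulrCA.
under eq_cint do rewrite e1.
rewrite cintZ//; last exact: cintegrable_sum.
congr (_ * _); rewrite cint_sum//.
under eq_bigr => k _ do rewrite (ft_swap mS measurableT (L2S_coord mS finS k ha) (ig k)).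
rewrite -cint_sum//; apply: eq_cint => l _.
rewrite bform_coord; apply: eq_bigr => k _.
by rewrite fourierS_ft mulrC.
Qed.

End process_spectrum.

(** * The projection and its spectral image *)

Section filtering.
Context {R : realType} {d : measure_display} {Omega : measurableType d}.
Variable P : probability Omega R.
Context {n : nat}.
Local Notation RR := (measurableTypeR R).
Variable S : set (measurableTypeR R).
Hypotheses (mS : measurable S) (finS : (leb R S < +oo)%E).
Variables (xi eta : R -> Omega -> 'cV[R[i]]_n) (Rxi Reta F G : R -> 'M[R[i]]_n).
Hypotheses (hxi : stationary P xi Rxi) (heta : stationary P eta Reta)
  (hunc : uncorrelated P xi eta)
  (hF : spectral_density F Rxi) (hG : spectral_density G Reta).
Variables (a : R -> 'cV[R[i]]_n) (Axi : Omega -> R[i]).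
Hypotheses (ha : L2S S a) (hAxi : is_functional P S a xi Axi).

Let H l := F l + G l.
Let A := fourierS S a.
Let pF : {ae leb R, forall l, psdmx (F l)}. Proof. by case: hF. Qed.
Let pG : {ae leb R, forall l, psdmx (G l)}. Proof. by case: hG. Qed.
Let iF : mxintegrable (leb R) setT F. Proof. by case: hF. Qed.
Let iG : mxintegrable (leb R) setT G. Proof. by case: hG. Qed.
Let iH : mxintegrable (leb R) setT H := mxintegrable_add iF iG.
Let pH : {ae leb R, forall l, psdmx (H l)} := ae_psd_add pF pG.
Let sipP := rv2_sip P.
Let sipF := wL2_sip (mxintegrable_meas iF) pF.
Let sipG := wL2_sip (mxintegrable_meas iG) pG.
Let sipH := wL2_sip (mxintegrable_meas iH) pH.
Let rx t k : rv2 P (coord xi t k). Proof. by case: hxi => h _; exact: h. Qed.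
Let re t k : rv2 P (coord eta t k). Proof. by case: heta => h _; exact: h. Qed.

Let wL2_addl x := @wL2_addl _ _ _ _ iF iG pF pG x.
Let wip_addr x y := @wip_add _ _ _ _ iF iG pF pG x y.
Definition obs t k := coord xi t k + coord eta t k.

Lemma rv2_obs t k : rv2 P (obs t k).
Proof. exact: (sipD sipP (rx t k) (re t k)). Qed.

Lemma corr_xi_eta t k s j : corr P (coord xi t k) (coord eta s j) = 0.
Proof. by rewrite /coord -corrmxE hunc mxE. Qed.

Lemma corr_obs t k s j :
  corr P (obs t k) (obs s j) = inv2pi * wip (leb R) H (expvec t k) (expvec s j).
Proof.
rewrite /obs (ipDl sipP (rx t k) (re t k) (rv2_obs s j)).
rewrite (ipDr sipP (rx t k) (rx s j) (re s j)) (ipDr sipP (re t k) (rx s j) (re s j)).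
rewrite (ip_conj sipP (rx s j) (re t k)) !corr_xi_eta conjc0 addr0 add0r.
rewrite (corr_spectral _ _ _ _ hxi hF) (corr_spectral _ _ _ _ heta hG) -mulrDr.
by congr (_ * _); apply: esym; apply: wip_addr; exact: wL2_expvec.
Qed.

Lemma corr_functional_xi t k :
  corr P Axi (coord xi t k) = inv2pi * wip (leb R) F A (expvec t k).
Proof.
apply: (functional_spectral mS finS ha rx hAxi iF pF (rx t k) (wL2_expvec t k iF)).
by move=> s j; exact: corr_spectral hxi hF.
Qed.

Lemma corr_functional_obs t k :
  corr P Axi (obs t k) = inv2pi * wip (leb R) F A (expvec t k).
Proof.
have [rA _] := hAxi.
rewrite /obs (ipDr sipP rA (rx t k) (re t k)) corr_functional_xi.
have -> : corr P Axi (coord eta t k) = 0; last by rewrite addr0.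
have w0 := sip0 sipF.
have z0 y : wL2 (leb R) F y -> wip (leb R) F y 0 = 0.
  by move=> hy; rewrite (ip_conj sipF w0 hy) (ip0l sipF hy) conjc0.
(* The noise is uncorrelated with the signal, so its counterpart in L_2(F) is 0. *)
have -> := functional_spectral mS finS ha rx hAxi iF pF (re t k) w0 _.
  by rewrite z0 ?mulr0//; exact: wL2_fourierS.
by move=> s j; rewrite corr_xi_eta z0 ?mulr0//; exact: wL2_expvec.
Qed.

Lemma corr_functional : corr P Axi Axi = inv2pi * wip (leb R) F A A.
Proof.
have [rA _] := hAxi; have hA := wL2_fourierS mS finS iF ha.
(* Now Y is the functional itself, with counterpart A; the required correlations with the process
   come from the previous use of the same lemma. *)
apply: (functional_spectral mS finS ha rx hAxi iF pF rA hA) => t k.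
rewrite (ip_conj sipP rA (rx t k)) corr_functional_xi conjcM conjc_real.
by rewrite -(ip_conj sipF hA (wL2_expvec t k iF)).
Qed.

(** The spectral isometry on finite combinations, kept as a relation between sums with the same
    coefficients, so that it need not be shown to be a well-defined map. *)
Definition obs_pair (Y : Omega -> R[i]) (q : R -> 'cV[R[i]]_n) : Prop :=
  exists (m : nat) (t : 'I_m -> R) (k : 'I_m -> 'I_n) (z : 'I_m -> R[i]),
    [/\ forall j, ~ S (t j), Y = \sum_j z j *: obs (t j) (k j) &
        q = \sum_j z j *: expvec (t j) (k j)].

Lemma obs_pair_comb Y q : obs_pair Y q -> obs_comb S q.
Proof. by move=> [m [t [k [z [St _ ->]]]]]; exists m, t, k, z. Qed.

Lemma obs_pair_rv2 Y q : obs_pair Y q -> rv2 P Y.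
Proof.
move=> [m [t [k [z [_ -> _]]]]].
exact: (sip_sum sipP _ (fun j => sipZ sipP (z j) (rv2_obs (t j) (k j)))).
Qed.

Lemma obs_pair_wL2 Y q : obs_pair Y q -> wL2 (leb R) H q.
Proof. by move=> /obs_pair_comb; exact: wL2_obs_comb. Qed.

Lemma corr_obs_pair Y q Y' q' : obs_pair Y q -> obs_pair Y' q' ->
  corr P Y Y' = inv2pi * wip (leb R) H q q'.
Proof.
move=> [m [t [k [z [_ -> ->]]]]] [m' [t' [k' [z' [_ -> ->]]]]].
apply: (ip_comb_eq sipP sipH) => *; [exact: rv2_obs|exact: rv2_obs|
  exact: wL2_expvec|exact: wL2_expvec|exact: corr_obs].
Qed.

Lemma corr_functional_obs_pair Y q : obs_pair Y q ->
  corr P Axi Y = inv2pi * wip (leb R) F A q.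
Proof.
have [rA _] := hAxi; have hA := wL2_fourierS mS finS iF ha.
move=> [m [t [k [z [_ -> ->]]]]].
have rz j := sipZ sipP (z j) (rv2_obs (t j) (k j)).
have ez j := sipZ sipF (z j) (wL2_expvec (t j) (k j) iF).
rewrite (ip_sumr sipP _ rz rA) (ip_sumr sipF _ ez hA) mulr_sumr.
apply: eq_bigr => j _.
rewrite (ipZr sipP _ rA (rv2_obs (t j) (k j))) corr_functional_obs.
by rewrite (ipZr sipF _ hA (wL2_expvec (t j) (k j) iF)) mulrCA.
Qed.

Lemma obs_pair_expvec t k : ~ S t -> obs_pair (obs t k) (expvec t k).
Proof.
move=> St; exists 1%N, (fun=> t), (fun=> k), (fun=> 1).
by split; rewrite ?big_ord1 ?scale1r.
Qed.

Lemma sqn_obs_pairB Y q Y' q' : obs_pair Y q -> obs_pair Y' q' ->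
  sqn (corr P) (Y - Y') = (2 * pi)^-1 * sqn (wip (leb R) H) (q - q').
Proof.
move=> h h'.
apply: (sqnB_isometry sipP sipH (obs_pair_rv2 h) (obs_pair_rv2 h')
  (obs_pair_wL2 h) (obs_pair_wL2 h')); exact: corr_obs_pair.
Qed.

Hypotheses (uH : {ae leb R, forall l, F l + G l \in unitmx}) (cS : closed S).
Variables (c Ra : R -> 'cV[R[i]]_n).
Hypotheses (hRa : graph_R S F G a Ra) (hc : graph_B S F G c Ra).
Variable Ahat : Omega -> R[i].
Hypothesis (hAhat : is_projection P (obs_space P S (fun t w => xi t w + eta t w)) Axi Ahat).

Let h := spectral_char S F G a c.
Let rAh : rv2 P Ahat. Proof. by case: hAhat => [[]]. Qed.
Let wh : wL2 (leb R) H h := wL2_spectral_char mS finS iF iG pF pG uH ha hc.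

Let sum_obs m (t : 'I_m -> R) (k : 'I_m -> 'I_n) (z : 'I_m -> R[i]) :
  (fun w => \sum_(j < m) z j * (xi (t j) w + eta (t j) w) (k j) ord0) =
  \sum_(j < m) z j *: obs (t j) (k j).
Proof. by apply/funext => w; rewrite fct_sumE; apply: eq_bigr => j _; rewrite mxE. Qed.

Lemma obs_approx (e : R) : 0 < e ->
  exists Yq, obs_pair Yq.1 Yq.2 /\ sqn (corr P) (Ahat - Yq.1) < e.
Proof.
move=> e0; have [[_ happ] _] := hAhat; have [m [t [k [z [St]]]]] := happ e e0.
rewrite sum_obs => hm; exists (\sum_j z j *: obs (t j) (k j), \sum_j z j *: expvec (t j) (k j)).
have hp : obs_pair (\sum_j z j *: obs (t j) (k j)) (\sum_j z j *: expvec (t j) (k j)).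
  by exists m, t, k, z.
by split=> //; move: hm; rewrite (msdistE rAh (obs_pair_rv2 hp)) lte_fin.
Qed.

Lemma projection_orth t k : ~ S t -> corr P Ahat (obs t k) = corr P Axi (obs t k).
Proof.
move=> St; have [rA _] := hAxi; have [_ orth] := hAhat.
have ho : obs_space P S (fun t w => xi t w + eta t w) (obs t k).
  split=> [|e e0]; first exact: rv2_obs.
  exists 1%N, (fun=> t), (fun=> k), (fun=> 1); split=> //.
  rewrite sum_obs big_ord1 scale1r (msdistE (rv2_obs t k) (rv2_obs t k)) subrr.
  by rewrite /sqn (ip0l sipP (sip0 sipP)) lte_fin.
have := orth _ ho => /eqP.
by rewrite (ipBl sipP rA rAh (rv2_obs t k)) subr_eq0 => /eqP.
Qed.

(** The partners of combinations approaching the estimate are Cauchy in L_2(H), hence converge to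
    some p. The orthogonality of the error to the observations passes to p in the limit, and
    [spectral_char_unique] identifies p with h. *)
Lemma spectral_limit : exists (Y : nat -> Omega -> R[i]) (q : nat -> R -> 'cV[R[i]]_n)
    (C : R), [/\ forall i, obs_pair (Y i) (q i),
    forall i, sqn (corr P) (Y i - Ahat) <= (2 * pi)^-1 * 4^-1 ^+ i &
    forall i, sqn (wip (leb R) H) (q i - h) <= C * 2^-1 ^+ i].
Proof.
have k0 : 0 < (2 * pi)^-1 :> R by rewrite invr_gt0 mulr_gt0// pi_gt0.
(* The exponent [i.+1] leaves room for the factors 2 in comparing neighbours: 2/16 + 2/4 <= 1. The
   factor 1/(2 pi) is that of the isometry. *)
have e0 (i : nat) : 0 < (2 * pi)^-1 * 4^-1 ^+ i.+1 :> R.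
  by rewrite mulr_gt0// exprn_gt0// invr_gt0.
have [/= Yq hYq] := choice (fun i => obs_approx (e0 i)).
pose Y i := (Yq i).1; pose q i := (Yq i).2.
have op i : obs_pair (Y i) (q i) := (hYq i).1.
have rY i := obs_pair_rv2 (op i); have wq i := obs_pair_wL2 (op i).
have hY i : sqn (corr P) (Y i - Ahat) <= (2 * pi)^-1 * 4^-1 ^+ i.+1.
  by rewrite (sqnC sipP (rY i) rAh) ltW// (hYq i).2.
have g0 (i : nat) : 0 < 4^-1 ^+ i :> R by rewrite exprn_gt0// invr_gt0.
have cq i : sqn (wip (leb R) H) (q i.+1 - q i) <= 4^-1 ^+ i.
  rewrite -(ler_pM2l k0) -(sqn_obs_pairB (op i.+1) (op i)).
  apply: (le_trans (sqn_trans sipP (rY i.+1) rAh (rY i))).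
  rewrite (sqnC sipP rAh (rY i)); have := hY i.+1; have := hY i.
  rewrite !exprS => h1 h2; have := mulr_gt0 k0 (g0 i); nra.
have [p [wp [C hC]]] := wL2_complete (mxintegrable_meas iH) pH uH wq cq.
have C0 : 0 <= C.
  by have := le_trans (sqn_ge0 sipH (sipB sipH (wq 0%N) wp)) (hC 0%N); rewrite expr0 mulr1.
have C2 : C * 2^-1 ^+ i @[i --> \oo] --> (0 : R).
  by apply: cvg_geometric; rewrite ger0_norm ?invr_ge0// invf_lt1// ltr1n.
have hY' i : sqn (corr P) (Y i - Ahat) <= (2 * pi)^-1 * 4^-1 ^+ i.
  by apply: (le_trans (hY i)); rewrite (ler_pM2l k0) exprS ler_piMl ?ltW ?invf_lt1 ?ltr1n//.
have K4 : (2 * pi)^-1 * 4^-1 ^+ i @[i --> \oo] --> (0 : R).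
  by apply: cvg_geometric; rewrite ger0_norm ?invr_ge0// invf_lt1// ltr1n.
have lim_p e : 0 < e -> exists q', obs_comb S q' /\ sqn (wip (leb R) H) (q' - p) < e.
  move=> e1; have /cvgrPdist_lt/(_ e e1)[N _ hN] := C2.
  exists (q N); split; first exact: obs_pair_comb (op N).
  apply: (le_lt_trans (hC N)); have := hN N (leqnn N).
  by rewrite sub0r normrN; apply: le_lt_trans; exact: ler_norm.
have orth_p t k : ~ S t -> wip (leb R) F A (expvec t k) = wip (leb R) H p (expvec t k).
  move=> St; apply: (mulfI (inv2pi_neq0)).
  apply: (etrans (esym (corr_functional_obs t k))).
  apply: (etrans (esym (projection_orth k St))).
  apply: (ccvg_unique (ip_limit sipP rY rAh (rv2_obs t k) hY' K4)).
  under eq_fun do rewrite (corr_obs_pair (op _) (obs_pair_expvec k St)).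
  apply: ccvgM; first exact: ccvg_cst.
  exact: (ip_limit sipH wq wp (wL2_expvec t k iH) hC C2).
have s0 := spectral_char_unique mS finS iF iG pF pG uH ha hRa hc cS wp lim_p orth_p.
(* Since p and h are at distance 0, passing from p to h costs only the factor 2 of [sqn_trans]. *)
exists Y, q, (2 * C); split=> // i.
apply: (le_trans (sqn_trans sipH (wq i) wp wh)).
by rewrite -mulrA s0 mulr0 addr0 ler_pM2l// hC.
Qed.

(** Limits of the identities for pairs of combinations. Convergence to h in L_2(H) implies
    convergence in L_2(F), because G is positive semidefinite. *)
Lemma corr_projection : corr P Ahat Axi = inv2pi * wip (leb R) F h A /\
  corr P Ahat Ahat = inv2pi * wip (leb R) H h h.
Proof.
have [Y [q [C [op hY hq]]]] := spectral_limit.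
have [rA _] := hAxi; have hA := wL2_fourierS mS finS iF ha.
have rY i := obs_pair_rv2 (op i); have wq i := obs_pair_wL2 (op i).
have C2 : C * 2^-1 ^+ i @[i --> \oo] --> (0 : R).
  by apply: cvg_geometric; rewrite ger0_norm ?invr_ge0// invf_lt1// ltr1n.
have K4 : (2 * pi)^-1 * 4^-1 ^+ i @[i --> \oo] --> (0 : R).
  by apply: cvg_geometric; rewrite ger0_norm ?invr_ge0// invf_lt1// ltr1n.
have [wFh wGh] := wL2_addl wh.
have hqF i : sqn (wip (leb R) F) (q i - h) <= C * 2^-1 ^+ i.
  have wd := sipB sipH (wq i) wh; have [wFd wGd] := wL2_addl wd.
  apply: le_trans (hq i).
  rewrite [leRHS]/sqn (wip_addr wd wd) Re_add lerDl; exact: (sqn_ge0 sipG wGd).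
split.
  apply: (ccvg_unique (ip_limit sipP rY rAh rA hY K4)).
  have e i : corr P (Y i) Axi = inv2pi * wip (leb R) F (q i) A.
    have [wFq _] := wL2_addl (wq i).
    rewrite (ip_conj sipP rA (rY i)) (corr_functional_obs_pair (op i)) conjcM conjc_real.
    by rewrite -(ip_conj sipF hA wFq).
  under eq_fun do rewrite e.
  apply: ccvgM; first exact: ccvg_cst.
  exact: (ip_limit sipF (fun i => (wL2_addl (wq i)).1) wFh hA hqF C2).
have e j : corr P Ahat (Y j) = inv2pi * wip (leb R) H h (q j).
  apply: (ccvg_unique (ip_limit sipP rY rAh (rY j) hY K4)).
  under eq_fun do rewrite (corr_obs_pair (op _) (op j)).
  apply: ccvgM; first exact: ccvg_cst.
  exact: (ip_limit sipH wq wh (wq j) hq C2).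
apply: (ccvg_unique (ip_limitr sipP rY rAh rAh hY K4)).
under eq_fun do rewrite e.
apply: ccvgM; first exact: ccvg_cst.
exact: (ip_limitr sipH wq wh wh hq C2).
Qed.

Let orth_hat : corr P Axi Ahat = corr P Ahat Ahat.
Proof.
have [rA _] := hAxi; have [hO orth] := hAhat.
by apply/eqP; rewrite -subr_eq0 -(ipBl sipP rA rAh rAh); apply/eqP; exact: orth.
Qed.

(** The spectral form of the orthogonality of the error to the estimate. The common value is a
    squared norm, hence real, so the cross term may be conjugated. *)
Let wip_real : wip (leb R) F A h = wip (leb R) H h h /\
  wip (leb R) F h A = wip (leb R) H h h.
Proof.
have [rA _] := hAxi; have [e1 e2] := corr_projection.
have hA := wL2_fourierS mS finS iF ha; have [wFh _] := wL2_addl wh.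
have e3 : wip (leb R) F h A = wip (leb R) H h h.
  apply: (mulfI (inv2pi_neq0)); apply: (etrans (esym e1)); apply: etrans e2.
  rewrite [LHS](ip_conj sipP rA rAh) [RHS](ip_conj sipP rAh rAh).
  exact: (congr1 (@conjc R) orth_hat).
split; last exact: e3.
apply: (etrans (ip_conj sipF wFh hA)); apply: (etrans (congr1 (@conjc R) e3)).
exact: (esym (ip_conj sipH wh wh)).
Qed.

Lemma mean_square_error : (sqn (corr P) (Axi - Ahat))%:C =
  inv2pi * (wip (leb R) F A A - wip (leb R) F h A).
Proof.
have [rA _] := hAxi; have rE := sipB sipP rA rAh.
rewrite -(ip_sqn sipP rE) (ipBr sipP rE rA rAh).
rewrite (ipBl sipP rA rAh rA) (ipBl sipP rA rAh rAh) orth_hat subrr subr0.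
by rewrite corr_functional mulrBr (corr_projection).1.
Qed.

(** Expanding the first square and using H = F + G, the right side is |A|_F^2 - <A,h>_F - <h,A>_F +
    |h|_H^2 up to 1/(2 pi); by [wip_real] each cross term equals |h|_H^2. *)
Lemma mean_square_error_split : (sqn (corr P) (Axi - Ahat))%:C =
  inv2pi * wip (leb R) F (A - h) (A - h) + inv2pi * wip (leb R) G h h.
Proof.
have hA : wL2 (leb R) F A := wL2_fourierS mS finS iF ha.
have [wFh wGh] := wL2_addl wh.
have e0 : wip (leb R) F (A - h) (A - h) = (wip (leb R) F A A - wip (leb R) F A h) -
    (wip (leb R) F h A - wip (leb R) F h h).
  apply: (etrans (ipBl sipF hA wFh (sipB sipF hA wFh))).
  by congr (_ - _); [exact: (ipBr sipF hA hA wFh)|exact: (ipBr sipF wFh hA wFh)].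
have [e1 e2] := wip_real; have e3 := wip_addr wh wh.
have key (x1 x2 x3 x4 x5 x6 y : R[i]) : y = x6 - x1 - (x2 - x4) -> x1 = x3 -> x2 = x3 ->
    x3 = x4 + x5 -> x6 - x2 = y + x5.
  move=> -> -> -> e; have -> : x3 - x4 = x5 by rewrite e addrAC subrr add0r.
  by rewrite subrK.
rewrite mean_square_error -mulrDr; congr (_ * _); exact: (key _ _ _ _ _ _ _ e0 e1 e2 e3).
Qed.

End filtering.

(** * The two expressions for the error *)

Section error_formulas.
Context {R : realType} {n : nat}.
Local Notation RR := (measurableTypeR R).
Variable S : set (measurableTypeR R).
Hypotheses (mS : measurable S) (finS : (leb R S < +oo)%E).
Variables F G : R -> 'M[R[i]]_n.
Hypotheses (iF : mxintegrable (leb R) setT F) (iG : mxintegrable (leb R) setT G).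
Hypotheses (pF : {ae leb R, forall l, psdmx (F l)})
  (pG : {ae leb R, forall l, psdmx (G l)})
  (uH : {ae leb R, forall l, F l + G l \in unitmx}).
Variables (a c Ra : R -> 'cV[R[i]]_n).
Hypotheses (ha : L2S S a) (hRa : graph_R S F G a Ra) (hc : graph_B S F G c Ra).

Let H l := F l + G l.
Let V l := invmx (F l + G l).
Let A := fourierS S a.
Let C := fourierS S c.
Let h := spectral_char S F G a c.
Let mF := mxintegrable_meas iF.
Let mG := mxintegrable_meas iG.
Let iH : mxintegrable (leb R) setT H := mxintegrable_add iF iG.
Let mH := mxintegrable_meas iH.
Let mV : mxmeasurable (setT : set RR) V := mxmeasurable_inv mH.
Let pH : {ae leb R, forall l, psdmx (H l)} := ae_psd_add pF pG.
Let hA : wL2 (leb R) F A := wL2_fourierS mS finS iF ha.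
Let fc : finite_energy S F G c := hc.1.
Let mA : mxmeasurable (setT : set RR) A := hA.1.
Let mC : mxmeasurable (setT : set RR) C := mxmeasurable_fourierS mS fc.1.
Let wC : wL2 (leb R) H (dual_vec F G C) := finite_energy_dual mS iF iG pF pG uH fc.
Let g0 := dual_vec F G (fun l => (F l)^T *m A l).
Let wg0 : wL2 (leb R) H g0 := wL2_dual_mul iF iG pF pG uH hA.
Let wh : wL2 (leb R) H h := wL2_spectral_char mS finS iF iG pF pG uH ha hc.
Let sipF := wL2_sip mF pF.

Lemma spectral_charE l : h l = ((A l)^T *m F l *m V l - (C l)^T *m V l)^T.
Proof.
rewrite (linearB (@trmx _ _ _)) /= !trmx_mul !trmxK.
by rewrite /h /spectral_char /dual_vec.
Qed.

Lemma mx11_conjugate (X : 'rV[R[i]]_n) (U M : 'M[R[i]]_n) : adjmx U = U ->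
  mx11 (X *m U *m M *m U *m adjmx X) = bform M (X *m U)^T (X *m U)^T.
Proof.
move=> hU; rewrite /bform trmxK -[LHS]/(mx11 _) -!mulmxA; congr (mx11 (_ *m (_ *m (_ *m _)))).
have -> : conjmx (X *m U)^T = adjmx (X *m U) by [].
rewrite /adjmx trmx_mul conjmxM -/(adjmx X); congr (_ *m _).
by rewrite -[RHS]/(adjmx U) hU.
Qed.

Lemma error_noise : wip (leb R) G h h = cint (leb R) setT (fun l =>
  mx11 (((A l)^T *m F l - (C l)^T) *m V l *m G l *m V l *m
    adjmx ((A l)^T *m F l - (C l)^T))).
Proof.
have mX : mxmeasurable (setT : set RR) (fun l => (A l)^T *m F l - (C l)^T).
  by apply: mxmeasurableB; [apply: mxmeasurableM => //|]; exact: mxmeasurable_tr.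
apply: ae_eq_cint => //.
- by apply: cmeasurable_bform => //; case: wh.
- apply: mxmeasurableM; last by apply: mxmeasurable_conj; exact: mxmeasurable_tr.
  by do 3 (apply: mxmeasurableM => //).
apply: (ae_leb_imp pH) => l ph _; have [hV _] := psdmx_inv ph.
by rewrite mx11_conjugate// mulmxBl -spectral_charE.
Qed.

Lemma error_signal : wip (leb R) F (A - h) (A - h) = cint (leb R) setT (fun l =>
  mx11 (((A l)^T *m G l + (C l)^T) *m V l *m F l *m V l *m
    adjmx ((A l)^T *m G l + (C l)^T))).
Proof.
have mX : mxmeasurable (setT : set RR) (fun l => (A l)^T *m G l + (C l)^T).
  by apply: mxmeasurableD; [apply: mxmeasurableM => //|]; exact: mxmeasurable_tr.
have mAh : mxmeasurable (setT : set RR) (A - h) by apply: mxmeasurableB => //; case: wh.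
apply: ae_eq_cint => //.
- exact: cmeasurable_bform.
- apply: mxmeasurableM; last by apply: mxmeasurable_conj; exact: mxmeasurable_tr.
  by do 3 (apply: mxmeasurableM => //).
apply: (ae_leb_imp2 pH uH) => l ph uh _; have [hV _] := psdmx_inv ph.
rewrite mx11_conjugate//.
(* Writing A^T as A^T (F + G) V, the term A^T F V cancels against the one in h. *)
have -> : (((A l)^T *m G l + (C l)^T) *m V l)^T = (A - h) l; last by [].
rewrite -[(A - h) l]/(A l - h l) spectral_charE -[A l in RHS]trmxK -linearB /= ?trmxK.
congr (_^T); rewrite mulmxDl opprB addrCA [RHS]addrC; congr (_ + _).
by apply/eqP; rewrite eq_sym subr_eq -mulmxDl -mulmxDr [G l + F l]addrC mulmxK.
Qed.

Lemma bform_projr (M N : 'M[R[i]]_n) x y : adjmx M = M -> psdmx N -> N \in unitmx ->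
  bform N y ((invmx N)^T *m (M^T *m x)) = bform M y x.
Proof.
by move=> hM pN uN; rewrite bform_invr// -(herm_conj hM) -bform_mulr mul1mx.
Qed.

Let FVG l := F l *m V l *m G l.

(** From F V (F + G) = F. The right side involves only F-products, to which the estimates for the
    projection apply. *)
Let FVG_E l : H l \in unitmx -> FVG l = F l - F l *m V l *m F l.
Proof.
move=> uh; apply/eqP.
by rewrite eq_sym subr_eq -mulmxDr [G l + F l]addrC mulmxKV.
Qed.

(** The (k, j) entry of F V F is the F-product of V^T F^T e_k with e_j. The first lies in L_2(H),
    hence in L_2(F), and the second in L_2(F) because F is integrable. *)
Lemma mxintegrable_FVG : mxintegrable (leb R) setT FVG.
Proof.
move=> k j; have hE i := wL2_expvec 0 i iF.
have hE0 i (l : RR) : expvec 0 i l = delta_mx i ord0 by rewrite /expvec mul0r expi0 scale1r.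
have wk : wL2 (leb R) F (dual_vec F G (fun l => (F l)^T *m expvec 0 k l)).
  exact: (wL2_addl iF iG pF pG (wL2_dual_mul iF iG pF pG uH (hE k))).1.
have i1 := cintegrableB measurableT (iF k j) (wL2_bform mF pF wk (hE j)).
apply: (ae_eq_cintegrable measurableT i1).
  by do 2 (apply: mxmeasurableM => //).
apply: (ae_leb_imp uH) => l uh _.
rewrite FVG_E// !mxE; congr (_ - _).
rewrite hE0 bform_delta /dual_vec hE0 mulmxA -trmx_mul mulmxA -trmx_mul mulmxA.
rewrite !mxE (bigD1 k)//= big1 ?addr0 => [|i ik]; last by rewrite !mxE (negbTE ik) mulr0.
by rewrite !mxE !eqxx mulr1.
Qed.

(** Testing with w = c gives the pairing twice. Through [B_s] it is a squared norm, hence real; this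
    allows the arguments in the expression through [R_s] to be interchanged, after which the
    H-product with [g0] becomes an F-product with A. *)
Let inner_Ra_c : innerS S Ra c = inv2pi * wip (leb R) F (dual_vec F G C) A.
Proof.
have [wCF _] := wL2_addl iF iG pF pG wC.
have e1 : innerS S Ra c = inv2pi * wip (leb R) H g0 (dual_vec F G C) :=
  inner_R mS finS iF iG pF pG uH ha hRa fc.
have e2 : innerS S Ra c = inv2pi * wip (leb R) H (dual_vec F G C) (dual_vec F G C) :=
  inner_B mS finS iF iG pF pG uH hc fc.
have sipH := wL2_sip mH pH.
have e3 : wip (leb R) H g0 (dual_vec F G C) = wip (leb R) H (dual_vec F G C) g0.
  have e4 := mulfI inv2pi_neq0 (etrans (esym e1) e2).
  apply: (etrans e4); apply: esym; apply: (etrans (ip_conj sipH wg0 wC)).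
  apply: (etrans (congr1 (@conjc R) e4)); exact: (esym (ip_conj sipH wC wC)).
suff e5 : wip (leb R) H (dual_vec F G C) g0 = wip (leb R) F (dual_vec F G C) A.
  exact (etrans e1 (congr1 (fun z => inv2pi * z) (etrans e3 e5))).
apply: (ae_eq_cint measurableT (cintegrable_meas (wL2_bform mH pH wC wg0))
  (cintegrable_meas (wL2_bform mF pF wCF hA))).
apply: (ae_leb_imp3 pF pH uH) => l [hF _] ph uh _.
exact: (bform_projr _ _ hF ph uh).
Qed.

Let inner_Q : innerS S (op_Q S F G a) a =
  inv2pi * (wip (leb R) F A A - wip (leb R) F g0 A).
Proof.
rewrite (inner_kernel_int mS finS measurableT mxintegrable_FVG ha ha); congr (_ * _).
have [wg0F _] := wL2_addl iF iG pF pG wg0.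
have i1 := wL2_bform mF pF hA hA; have i2 := wL2_bform mF pF wg0F hA.
rewrite -(cintB measurableT i1 i2).
apply: (ae_eq_cint measurableT _ (cintegrable_meas (cintegrableB measurableT i1 i2))).
  by apply: cmeasurable_bform => //; exact: mxintegrable_meas mxintegrable_FVG.
apply: (ae_leb_imp uH) => l uh _.
rewrite FVG_E// /g0 /dual_vec mulmxA -trmx_mul -bform_mull.
by rewrite /bform mulmxBr mulmxBl /mx11 !mxE.
Qed.

Lemma error_operators :
  inv2pi * (wip (leb R) F A A - wip (leb R) F h A) =
  innerS S Ra c + innerS S (op_Q S F G a) a.
Proof.
have [wg0F _] := wL2_addl iF iG pF pG wg0; have [wCF _] := wL2_addl iF iG pF pG wC.
rewrite inner_Ra_c inner_Q -mulrDr; congr (_ * _).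
have -> : wip (leb R) F h A = wip (leb R) F g0 A - wip (leb R) F (dual_vec F G C) A.
  exact: (ipBl sipF wg0F wCF hA).
have key (x y z : R[i]) : x - (y - z) = z + (x - y) by rewrite opprB addrCA.
exact: key.
Qed.

End error_formulas.

(** * Step functions and their stochastic integrals *)

Section step_functions.
Context {R : realType} {n : nat}.
Local Notation RR := (measurableTypeR R).

(** As lists, step functions are added by concatenation, and the same list defines a function and a
    stochastic integral. *)
Definition step := seq ({D : set RR | measurable D} * 'cV[R[i]]_n).
Implicit Types (s : step) (p : {D : set RR | measurable D} * 'cV[R[i]]_n).

Definition step1 (D : set RR) (v : 'cV[R[i]]_n) : R -> 'cV[R[i]]_n :=
  fun l => (\1_D l : R)%:C *: v.
Definition step_fun s : R -> 'cV[R[i]]_n := \sum_(p <- s) step1 (sval p.1) p.2.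

Lemma cabs2_indic (D : set RR) l : cabs2 ((\1_D l : R)%:C) <= 1.
Proof.
rewrite cabs2_real indicE.
by case: (_ \in _); rewrite /= ?expr1n ?expr0n//= ler01.
Qed.

Lemma wL2_step1 K (D : set RR) v : mxintegrable (leb R) setT K -> measurable D ->
  wL2 (leb R) K (step1 D v).
Proof.
move=> iK mD; apply: wL2_bounded => //.
  apply: mxmeasurableZ; last exact: mxmeasurable_cst.
  by apply: cmeasurable_real; exact: measurable_indic.
exists (\sum_k cabs2 (v k ord0)) => l k.
rewrite mxE cabs2M (le_trans (ler_piMl (cabs2_ge0 _) (cabs2_indic D l)))//.
by rewrite (bigD1 k)//= lerDl sumr_ge0// => j _; exact: cabs2_ge0.
Qed.

Context {d : measure_display} {Omega : measurableType d}.
Variable P : probability Omega R.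
Variables (Z : set R -> Omega -> 'cV[R[i]]_n) (F : R -> 'M[R[i]]_n).

Definition step_int1 (D : set RR) (v : 'cV[R[i]]_n) : Omega -> R[i] :=
  fun w => mx11 (v^T *m Z D w).
Definition step_int s : Omega -> R[i] := \sum_(p <- s) step_int1 (sval p.1) p.2.

Hypotheses (hZ : orthogonal_measure P Z F) (iF : mxintegrable (leb R) setT F)
  (pF : {ae leb R, forall l, psdmx (F l)}).
Let sipP := rv2_sip P.
Let sipF := wL2_sip (mxintegrable_meas iF) pF.

Lemma step_int1E D v : step_int1 D v = \sum_k v k ord0 *: (fun w => Z D w k ord0).
Proof.
apply/funext => w; rewrite /step_int1 /mx11 mxE fct_sumE; apply: eq_bigr => k _.
by rewrite mxE.
Qed.

Lemma step1E D v : step1 D v = \sum_k v k ord0 *: step1 D (delta_mx k ord0).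
Proof.
apply/funext => l; rewrite fct_sumE [in LHS]/step1 [in LHS](matrix_sum_delta v) scaler_sumr.
by apply: eq_bigr => k _; rewrite big_ord1 !scalerA mulrC -scalerA.
Qed.

Lemma corr_step1 (D D' : set RR) v v' : measurable D -> measurable D' ->
  corr P (step_int1 D v) (step_int1 D' v') =
  inv2pi * wip (leb R) F (step1 D v) (step1 D' v').
Proof.
move=> mD mD'; have [rZ oZ] := hZ.
have wd E k : measurable E -> wL2 (leb R) F (step1 E (delta_mx k ord0)).
  by move=> mE; exact: wL2_step1.
rewrite !step_int1E (step1E D) (step1E D').
apply: (ip_comb_eq sipP sipF) => [k|k|k|k|k j];
  [exact: rZ|exact: rZ|exact: wd|exact: wd|].
rewrite -corrmxE oZ// 2!mxE; congr (_ * _).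
apply: (etrans (cint_cind (leb R) (D `&` D') (fun l => F l k j))).
apply: eq_cint => l _; rewrite /step1 bformZl bformZr bform_delta2 conjc_real.
by rewrite mulrA -rmorphM /cind indicI.
Qed.

Lemma rv2_step_int s : rv2 P (step_int s).
Proof.
have [rZ _] := hZ; apply: (sip_sum sipP) => -[[D mD] v]; rewrite step_int1E.
by apply: (sip_sum sipP) => k; apply: (sipZ sipP); exact: rZ.
Qed.

Lemma wL2_step_fun K s : mxintegrable (leb R) setT K ->
  {ae leb R, forall l, psdmx (K l)} -> wL2 (leb R) K (step_fun s).
Proof.
move=> iK pK; have sip := wL2_sip (mxintegrable_meas iK) pK.
by apply: (sip_sum sip) => -[[D mD] v]; exact: wL2_step1.
Qed.

Lemma corr_step s s' : corr P (step_int s) (step_int s') =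
  inv2pi * wip (leb R) F (step_fun s) (step_fun s').
Proof.
have r1 p : rv2 P (step_int1 (sval p.1) p.2).
  by have := rv2_step_int [:: p]; rewrite /step_int big_seq1.
have w1 p : wL2 (leb R) F (step1 (sval p.1) p.2).
  by have := wL2_step_fun [:: p] iF pF; rewrite /step_fun big_seq1.
rewrite (ip_suml sipP _ r1 (rv2_step_int s')) (ip_suml sipF _ w1 (wL2_step_fun s' iF pF)).
rewrite mulr_sumr; apply: eq_bigr => -[[D mD] v] _.
rewrite (ip_sumr sipP _ r1 (r1 _)) (ip_sumr sipF _ w1 (w1 _)).
by rewrite mulr_sumr; apply: eq_bigr => -[[D' mD'] v'] _; exact: corr_step1.
Qed.

Lemma stoch_int_step h X : is_stoch_int P Z F h X -> forall e : R, 0 < e ->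
  exists s, sqn (wip (leb R) F) (h - step_fun s) < e /\
    sqn (corr P) (X - step_int s) < e.
Proof.
move=> [[mh ih] rX happ] e e0; have [m [D [c [mD hF hX]]]] := happ e e0.
have wh := wL2P (mxintegrable_meas iF) pF mh ih.
pose s : step := [seq (exist _ (D j) (mD j), c j) | j <- enum 'I_m].
have es : step_fun s = (fun l => \sum_j (\1_(D j) l : R)%:C *: c j).
  by apply/funext => l; rewrite /step_fun big_map big_enum fct_sumE.
have ei : step_int s = (fun w => \sum_j mx11 ((c j)^T *m Z (D j) w)).
  by apply/funext => w; rewrite /step_int big_map big_enum fct_sumE.
exists s; rewrite -!lte_fin; split.
  apply: le_lt_trans hF; rewrite es -(wL2_sqnE _)//.
  by rewrite -es; exact: (sipB sipF wh (wL2_step_fun s iF pF)).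
by move: hX; rewrite -ei (msdistE rX (rv2_step_int s)).
Qed.

(** The definition of the integral provides only some good step functions s'. Comparing s with s' by
    the isometry on step functions shows that every s approximates X as well as it approximates h.
    This allows one s to serve two different measures. The 4 comes from two uses of [sqn_trans]. *)
Lemma stoch_int_le h X s : is_stoch_int P Z F h X ->
  sqn (corr P) (X - step_int s) <=
  4 * (2 * pi)^-1 * sqn (wip (leb R) F) (h - step_fun s).
Proof.
move=> hX; have [[mh ih] rX _] := hX.
have wh := wL2P (mxintegrable_meas iF) pF mh ih.
have k0 : 0 < (2 * pi)^-1 :> R by rewrite invr_gt0 mulr_gt0// pi_gt0.
set k := (2 * pi)^-1 in k0 *.
apply/ler_addgt0Pl => e e0.
(* The two errors of s' enter with the factors 2 and 4k. *)
have k1 : 0 < 2 + 4 * k by nra.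
have [s' [h1 h2]] := stoch_int_step hX (divr_gt0 e0 k1).
have ws := wL2_step_fun s iF pF; have ws' := wL2_step_fun s' iF pF.
apply: (le_trans (sqn_trans sipP rX (rv2_step_int s') (rv2_step_int s))).
rewrite (sqnB_isometry sipP sipF (rv2_step_int s') (rv2_step_int s) ws' ws
  (corr_step _ _) (corr_step _ _) (corr_step _ _)) -/k.
have h3 := sqn_trans sipF ws' wh ws.
rewrite (sqnC sipF ws' wh) in h3.
move: h1 h2 h3; move: (sqn _ (X - _)) (sqn _ (step_fun s' - _))
  (sqn _ (h - step_fun s')) (sqn _ (h - step_fun s)) => x y z u h1 h2 h3.
have -> : e = (2 + 4 * k) * (e / (2 + 4 * k)) by rewrite mulrC divfK// gt_eqF.
move: (e / _) h1 h2 => f h1 h2; nra.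
Qed.

End step_functions.

(** * Approximation of exponentials by step functions *)

Section step_approximation.
Context {R : realType} {n : nat}.
Local Notation RR := (measurableTypeR R).

(** The sum counts the positive integers up to y, so it is the integer part of y. *)
Lemma floor_sum m (y : R) : 0 <= y <= m%:R ->
  `|y - \sum_(j < m) (j.+1%:R <= y)%R%:R| <= 1.
Proof.
move=> /andP[y0 ym].
have key : (m%:R <= y -> \sum_(j < m) (j.+1%:R <= y)%R%:R = m%:R :> R) /\
    (y < m%:R -> \sum_(j < m) (j.+1%:R <= y)%R%:R <= y < \sum_(j < m) (j.+1%:R <= y)%R%:R + 1).
  elim: m {ym} => [|m [ih1 ih2]]; first by rewrite big_ord0; split=> //; rewrite ltNge y0.
  rewrite big_ord_recr /=; split=> [my|ym].
    by rewrite my ih1 ?(le_trans _ my) ?ler_nat// -natr1.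
  have -> : (m.+1%:R <= y) = false by apply/negbTE; rewrite -ltNge.
  rewrite addr0.
  have [my|my] := leP m%:R y; last exact: ih2.
  by rewrite ih1// my natr1.
rewrite ler_norml; have [my|my] := leP m%:R y; last by have := key.2 my; lra.
by rewrite key.1//; lra.
Qed.

Lemma step_level (f : RR -> R) (v : 'cV[R[i]]_n) (N : nat) :
  measurable_fun setT f -> (forall l, -1 <= f l <= 1) ->
  exists (s : step) (g : R -> R), (forall l, step_fun s l = (g l)%:C *: v) /\
    forall l, `|f l - g l| <= N.+1%:R^-1.
Proof.
move=> mf f1; pose r : R := N.+1%:R^-1.
have r0 : 0 < r by rewrite invr_gt0 ltr0n.
pose D (j : nat) : set RR := [set l | j.+1%:R * r - 1 <= f l].
have mD j : measurable (D j).
  have -> : D j = setT `&` f @^-1` `[j.+1%:R * r - 1, +oo[%classic.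
    by rewrite setTI; apply/seteqP; split=> l; rewrite /D /= in_itv /= andbT.
  by apply: mf => //; exact: measurable_itv.
(* Rounding f + 1 down to a multiple of r = 1/(N+1); as f + 1 ranges over [0, 2], there are 2(N+1)
   levels. The final - 1 is a step on the whole line. *)
pose g l := r * \sum_(j < N.+1.*2) (\1_(D j) l : R) - 1.
pose s : step := (exist _ setT measurableT, - v) ::
  [seq (exist _ (D j) (mD j), r%:C *: v) | j : 'I_(N.+1.*2) <- enum 'I_(N.+1.*2)].
exists s, g; split=> l.
  rewrite /step_fun /s big_cons big_map big_enum /= addrC.
  change ((\sum_(j < N.+1.*2) step1 (D j) (r%:C *: v)) l + step1 setT (- v) l =
    (g l)%:C *: v).
  rewrite fct_sumE /step1 indicT scale1r /g rmorphB rmorph1 scalerBl scale1r.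
  congr (_ - _); rewrite rmorphM rmorph_sum /= mulr_sumr scaler_suml.
  by apply: eq_bigr => j _; rewrite scalerA mulrC.
have -> : f l - g l = r * ((f l + 1) / r - \sum_(j < N.+1.*2) (\1_(D j) l : R)).
  by rewrite mulrBr mulrC divfK ?gt_eqF// /g; ring.
rewrite normrM (ger0_norm (ltW r0)) -[leRHS]mulr1 ler_pM2l//.
have -> : \sum_(j < N.+1.*2) (\1_(D j) l : R) =
    \sum_(j < N.+1.*2) (j.+1%:R <= (f l + 1) / r)%R%:R.
  apply: eq_bigr => j _; rewrite indicE ler_pdivlMr// -lerBlDr.
  by congr (_%:R); congr nat_of_bool; apply/idP/idP => [/set_mem|h]; [|apply/mem_set].
apply: floor_sum; have /andP[h1 h2] := f1 l.
rewrite divr_ge0 ?(ltW r0)//=; last by rewrite -lerBlDr sub0r.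
rewrite ler_pdivrMr// /r -muln2 natrM mulrAC mulfV ?mul1r ?pnatr_eq0//.
by rewrite -lerBrDr (le_trans h2)// -[2]/(1 + 1) addrK.
Qed.

Lemma expvec_approx (K : R -> 'M[R[i]]_n) t k : mxintegrable (leb R) setT K ->
  {ae leb R, forall l, psdmx (K l)} -> forall e : R, 0 < e ->
  exists s, sqn (wip (leb R) K) (expvec t k - step_fun s) < e.
Proof.
move=> iK pK e e0.
have hE := wL2_expvec 0 k iK.
set M := sqn (wip (leb R) K) (expvec 0 k).
have sip := wL2_sip (mxintegrable_meas iK) pK.
have M0 : 0 <= M by exact: (sqn_ge0 sip hE).
(* Errors of 1/(N+1) in cosine and sine give a squared distance of at most 2M/(N+1)^2, where M is
   the squared norm of the constant vector e_k. *)
pose N := Num.bound (2 * M / e).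
have bN : 2 * M / e < N.+1%:R.
  apply: (lt_trans (archi_boundP _)); last by rewrite ltr_nat.
  exact: divr_ge0 (mulr_ge0 (ler0n _ 2) M0) (ltW e0).
have mc : measurable_fun setT (fun l : RR => cos (t * l)).
  have [h _] := @cmeasurable_expiM R setT t.
  by under eq_fun do rewrite mulrC; exact: h.
have ms : measurable_fun setT (fun l : RR => sin (t * l)).
  have [_ h] := @cmeasurable_expiM R setT t.
  by under eq_fun do rewrite mulrC; exact: h.
have c1 l : -1 <= cos (t * l) <= 1 by rewrite cos_geN1 cos_le1.
have s1 l : -1 <= sin (t * l) <= 1 by rewrite sin_geN1 sin_le1.
have [sc [gc [ec hgc]]] := step_level (delta_mx k ord0) N mc c1.
have [ss [gs [es hgs]]] := step_level ('i%C *: delta_mx k ord0) N ms s1.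
exists (sc ++ ss).
have wd : wL2 (leb R) K (expvec t k - step_fun (sc ++ ss)).
  exact: (sipB sip (wL2_expvec t k iK) (wL2_step_fun (sc ++ ss) iK pK)).
have r0 : 0 < N.+1%:R^-1 :> R by rewrite invr_gt0 ltr0n.
apply: (@le_lt_trans _ _ (2 * N.+1%:R^-1 ^+ 2 * M)); last first.
  have r1 : N.+1%:R^-1 <= 1 :> R by rewrite invf_le1 ?ltr0n// ler1n.
  have h : N.+1%:R^-1 * (2 * M) < e.
    by rewrite mulrC -ltr_pdivlMr// invrK (mulrC e) -ltr_pdivrMr.
  apply: le_lt_trans h; rewrite expr2 -(mulrA 2) -(mulrA _ _ M) mulrCA.
  by apply: ler_wpM2l; [exact: ltW|rewrite ler_wpM2l// ler_piMl].
rewrite !sqn_wip -RintegralZl//; last by case: hE.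
apply: ae_le_Rintegral => //; first by case: wd.
  by apply: integrableZ_EFin => //; case: hE.
apply: (ae_leb_imp pK) => l pk _.
have -> : (expvec t k - step_fun (sc ++ ss)) l =
    ((cos (t * l) - gc l) +i* (sin (t * l) - gs l)) *: delta_mx k ord0.
  rewrite /step_fun big_cat -[LHS]/(expvec t k l - (step_fun sc l + step_fun ss l)).
  rewrite ec es /expvec scalerA -scalerDl -scalerBl; congr (_ *: _).
  by apply: eq_parts; rewrite !partsE /=; ring.
rewrite -!sqn_bform (sqnZ (psd_sip pk) _ I) /expvec mul0r expi0 scale1r.
apply: ler_wpM2r; first exact: (sqn_ge0 (psd_sip pk) I).
have h1 := hgc l; have h2 := hgs l; rewrite /cabs2 /=.
have sq (x : R) : `|x| <= N.+1%:R^-1 -> x ^+ 2 <= N.+1%:R^-1 ^+ 2.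
  by move=> hx; rewrite -(real_normK (num_real x)) ler_pXn2r// nnegrE ?normr_ge0 ?ltW.
by rewrite mulrDl mul1r lerD ?sq.
Qed.

End step_approximation.

(** * The estimate as a stochastic integral against the sum of the two measures *)

Section stochastic_integral.
Context {R : realType} {d : measure_display} {Omega : measurableType d}.
Variable P : probability Omega R.
Context {n : nat}.
Local Notation RR := (measurableTypeR R).
Variable S : set (measurableTypeR R).
Variables (xi eta : R -> Omega -> 'cV[R[i]]_n) (F G : R -> 'M[R[i]]_n).
Variables (Zxi Zeta : set R -> Omega -> 'cV[R[i]]_n).
Hypotheses (hZxi : orthogonal_measure P Zxi F) (hZeta : orthogonal_measure P Zeta G)
  (hrxi : spectral_representation P xi Zxi F)
  (hreta : spectral_representation P eta Zeta G).
Hypotheses (iF : mxintegrable (leb R) setT F) (iG : mxintegrable (leb R) setT G)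
  (pF : {ae leb R, forall l, psdmx (F l)}) (pG : {ae leb R, forall l, psdmx (G l)}).

Let H l := F l + G l.
Let Zsum := fun (D : set R) w => Zxi D w + Zeta D w.
Let iH : mxintegrable (leb R) setT H := mxintegrable_add iF iG.
Let pH : {ae leb R, forall l, psdmx (H l)} := ae_psd_add pF pG.
Let sipP := rv2_sip P.
Let sipH := wL2_sip (mxintegrable_meas iH) pH.

Let step_int_sum s : step_int Zsum s = step_int Zxi s + step_int Zeta s.
Proof.
rewrite /step_int -big_split; apply: eq_bigr => p _.
by apply/funext => w; rewrite /step_int1 mulmxDr /mx11 mxE.
Qed.

Let rs s : rv2 P (step_int Zsum s).
Proof.
rewrite step_int_sum; exact: (sipD sipP (rv2_step_int hZxi s) (rv2_step_int hZeta s)).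
Qed.

Let sum_lt4 (x y e : R) : x < e / 4 -> y < e / 4 -> 2 * x + 2 * y < e.
Proof. lra. Qed.

Let ws s : wL2 (leb R) H (step_fun s) := wL2_step_fun s iH pH.

Let comb_le (x y u v c : R) : x <= 4 * c * u -> y <= 4 * c * v ->
  2 * x + 2 * y <= 8 * c * (u + v).
Proof. lra. Qed.

Let mul_bounds (u c : R) : 0 <= u -> 0 < c ->
  u <= u * (1 + 8 * c) /\ 8 * c * u <= u * (1 + 8 * c).
Proof. by move=> u0 c0; split; nra. Qed.

(** The pairs approximated simultaneously by one step function and its integral. Unlike
    [is_stoch_int] it is phrased with lists, which makes stability under sums, multiples and limits
    immediate; [step_limit_stoch_int] translates back. *)
Definition step_limit (Y : Omega -> R[i]) (q : R -> 'cV[R[i]]_n) : Prop :=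
  [/\ rv2 P Y, wL2 (leb R) H q & forall e : R, 0 < e -> exists s,
    sqn (wip (leb R) H) (q - step_fun s) < e /\ sqn (corr P) (Y - step_int Zsum s) < e].

(** The representations of signal and noise may come with different step functions. One s close to
    the exponential in L_2(H) is close in L_2(F) and in L_2(G), and [stoch_int_le] makes it good for
    both measures. *)
Lemma step_limit_obs t k : step_limit (obs xi eta t k) (expvec t k).
Proof.
have hx := hrxi t k; have he := hreta t k.
have rx : rv2 P (coord xi t k) by case: hx.
have re : rv2 P (coord eta t k) by case: he.
have wE := wL2_expvec t k iH.
split=> [||e e0]; [exact: (sipD sipP rx re)|exact: wE|].
have k0 : 0 < (2 * pi)^-1 :> R by rewrite invr_gt0 mulr_gt0// pi_gt0.
set c := (2 * pi)^-1 in k0 *.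
(* The errors 4c|.|_F^2 and 4c|.|_G^2 are doubled on addition and sum to 8c|.|_H^2; the 1 accounts
   for the distance in L_2(H) itself. *)
have c0 : 0 < 1 + 8 * c by nra.
have [s hs] := expvec_approx t k iH pH (divr_gt0 e0 c0).
exists s; set u := sqn _ _ in hs *; have wd := sipB sipH wE (ws s).
have u0 : 0 <= u by exact: (sqn_ge0 sipH wd).
have [wdF wdG] := wL2_addl iF iG pF pG wd.
have ue : u = sqn (wip (leb R) F) (expvec t k - step_fun s) +
    sqn (wip (leb R) G) (expvec t k - step_fun s).
  by rewrite /u {1}/sqn (wip_add iF iG pF pG wd wd) Re_add.
rewrite ltr_pdivlMr// in hs.
have [le1 le2] := mul_bounds u0 k0.
split; first exact: le_lt_trans le1 hs.
have -> : obs xi eta t k - step_int Zsum s =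
    (coord xi t k - step_int Zxi s) + (coord eta t k - step_int Zeta s).
  by rewrite step_int_sum opprD addrACA.
have r1 := sipB sipP rx (rv2_step_int hZxi s).
have r2 := sipB sipP re (rv2_step_int hZeta s).
apply: (le_lt_trans (sqnDr_le sipP r1 r2)).
have h1 := stoch_int_le hZxi iF pF s hx; have h2 := stoch_int_le hZeta iG pG s he.
rewrite -/c in h1 h2; apply: le_lt_trans hs.
apply: (le_trans _ le2).
by rewrite ue; exact: comb_le h1 h2.
Qed.

Lemma step_limitD Y q Y' q' : step_limit Y q -> step_limit Y' q' ->
  step_limit (Y + Y') (q + q').
Proof.
move=> [rY wq h] [rY' wq' h']; split=> [||e e0]; [exact: (sipD sipP)|exact: (sipD sipH)|].
have e4 : 0 < e / 4 by rewrite divr_gt0.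
have [s [h1 h2]] := h _ e4; have [s' [h1' h2']] := h' _ e4.
exists (s ++ s'); split.
  have -> : q + q' - step_fun (s ++ s') = (q - step_fun s) + (q' - step_fun s').
    by rewrite /step_fun big_cat opprD addrACA.
  apply: (le_lt_trans (sqnDr_le sipH (sipB sipH wq (ws s)) (sipB sipH wq' (ws s')))).
  exact: sum_lt4 h1 h1'.
have -> : Y + Y' - step_int Zsum (s ++ s') = (Y - step_int Zsum s) + (Y' - step_int Zsum s').
  by rewrite /step_int big_cat opprD addrACA.
apply: (le_lt_trans (sqnDr_le sipP (sipB sipP rY (rs s)) (sipB sipP rY' (rs s')))).
exact: sum_lt4 h2 h2'.
Qed.

Lemma step_limitZ z Y q : step_limit Y q -> step_limit (z *: Y) (z *: q).
Proof.
move=> [rY wq h]; split=> [||e e0]; [exact: (sipZ sipP)|exact: (sipZ sipH)|].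
have z0 : 0 < 1 + cabs2 z by rewrite ltr_wpDr// cabs2_ge0.
have [s [h1 h2]] := h _ (divr_gt0 e0 z0).
have e1 : step_fun [seq (p.1, z *: p.2) | p <- s] = z *: step_fun s.
  rewrite /step_fun big_map scaler_sumr; apply: eq_bigr => p _.
  by apply/funext => l; rewrite /step1 -[RHS]/(z *: (_ *: _)) !scalerA mulrC.
have e2 : step_int Zsum [seq (p.1, z *: p.2) | p <- s] = z *: step_int Zsum s.
  rewrite /step_int big_map scaler_sumr; apply: eq_bigr => p _.
  apply/funext => w; rewrite -[RHS]/(z * step_int1 _ _ _ _) /step_int1 linearZ /=.
  by rewrite -scalemxAl /mx11 mxE.
have key (x : R) : 0 <= x -> x < e / (1 + cabs2 z) -> cabs2 z * x < e.
  by rewrite ltr_pdivlMr// => x0; apply: le_lt_trans; rewrite mulrC ler_wpM2l// lerDr.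
exists [seq (p.1, z *: p.2) | p <- s]; rewrite e1 e2 -!scalerBr.
have wd := sipB sipH wq (ws s); have rd := sipB sipP rY (rs s).
rewrite (sqnZ sipH _ wd) (sqnZ sipP _ rd); split; apply: key => //.
  exact: (sqn_ge0 sipH wd).
exact: (sqn_ge0 sipP rd).
Qed.

Lemma step_limit0 : step_limit 0 0.
Proof.
split=> [||e e0]; [exact: (sip0 sipP)|exact: (sip0 sipH)|].
exists [::]; rewrite /step_fun /step_int !big_nil !subr0 /sqn.
by rewrite (ip0l sipH (sip0 sipH)) (ip0l sipP (sip0 sipP)).
Qed.

Lemma step_limit_pair Y q : obs_pair S xi eta Y q -> step_limit Y q.
Proof.
move=> [m [t [k [z [_ -> ->]]]]].
elim/big_rec2: _ => [|j Y' q' _ ih]; first exact: step_limit0.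
by apply: step_limitD => //; apply: step_limitZ; exact: step_limit_obs.
Qed.

Lemma step_limit_closed Y q : rv2 P Y -> wL2 (leb R) H q ->
  (forall e : R, 0 < e -> exists Y' q', [/\ step_limit Y' q',
    sqn (wip (leb R) H) (q - q') < e & sqn (corr P) (Y - Y') < e]) ->
  step_limit Y q.
Proof.
move=> rY wq h; split=> // e e0; have e4 : 0 < e / 4 by rewrite divr_gt0.
have [Y' [q' [[rY' wq' h'] h1 h2]]] := h _ e4; have [s [h1' h2']] := h' _ e4.
exists s; split.
  apply: (le_lt_trans (sqn_trans sipH wq wq' (ws s))).
  exact: sum_lt4 h1 h1'.
apply: (le_lt_trans (sqn_trans sipP rY rY' (rs s))).
exact: sum_lt4 h2 h2'.
Qed.

Lemma step_limit_stoch_int Y q : step_limit Y q ->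
  is_stoch_int P (fun D w => Zxi D w + Zeta D w) (fun l => F l + G l) q Y.
Proof.
move=> [rY wq h]; split=> //.
  by split; [case: wq|rewrite (wL2_sqnE wq) ltry].
move=> e e0; have [s [h1 h2]] := h e e0.
exists (size s), (fun j => sval (tnth (in_tuple s) j).1), (fun j => (tnth (in_tuple s) j).2).
split; first by move=> j; exact: (svalP (tnth (in_tuple s) j).1).
  have wd := sipB sipH wq (ws s).
  apply: (@le_lt_trans _ _ (\int[leb R]_l (qform (H l) ((q - step_fun s) l))%:E)%E);
    last by rewrite (wL2_sqnE wd) lte_fin.
  rewrite le_eqVlt; apply/orP; left; apply/eqP; apply: eq_integral => l _.
  have e2 : step_fun s l = \sum_j (\1_(sval (tnth (in_tuple s) j).1) l : R)%:C *:
      (tnth (in_tuple s) j).2.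
    by rewrite /step_fun big_tnth fct_sumE.
  by rewrite -[(q - step_fun s) l]/(q l - step_fun s l) e2.
have -> : (fun w => \sum_j mx11 ((tnth (in_tuple s) j).2^T *m
    (Zxi (sval (tnth (in_tuple s) j).1) w + Zeta (sval (tnth (in_tuple s) j).1) w))) =
    step_int Zsum s.
  by apply/funext => w; apply: esym; rewrite /step_int big_tnth fct_sumE.
by rewrite (msdistE rY (rs s)) lte_fin.
Qed.

End stochastic_integral.

(** * The set S and the final statement *)

Lemma finite_union_itv {R : realType} s (M N : 'I_s -> R) (S : set R) :
  S = \bigcup_l `[- M l - N l, - M l]%classic ->
  [/\ measurable (S : set (measurableTypeR R)), closed S & (leb R S < +oo)%E].
Proof.
have -> : \bigcup_l `[- M l - N l, - M l]%classic =
    \big[setU/set0]_(l < s) `[- M l - N l, - M l]%classic.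
  rewrite -bigcup_seq; apply: eq_bigcupl; split=> l _ //=; exact: mem_index_enum.
move=> ->; elim/big_ind: _ => [|A B [mA cA fA] [mB cB fB]|l _].
- by split; [exact: measurable0|exact: closed0|rewrite measure0 ltry].
- split; [exact: measurableU|exact: closedU|].
  by rewrite (le_lt_trans (measureU2 _ _ _))//; exact: lte_add_pinfty.
- split; [exact: measurable_itv|exact: interval_closed|].
  by rewrite lebesgue_measure_itv /=; case: ifP => _; rewrite -?EFinB ltry.
Qed.

Theorem theorem2p1 (R : realType) (d : measure_display)
    (Omega : measurableType d) (P : probability Omega R)
    (T : nat) (hT : (1 <= T)%N)
    (s : nat) (M N : 'I_s -> R)
    (hN : forall l, 0 < N l)
    (hoverlap : forall l l', l != l' ->
       `]- M l - N l, - M l[%classic `&` `]- M l' - N l', - M l'[%classic = set0)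
    (S : set R) (hS : S = \bigcup_l `[- M l - N l, - M l]%classic)
    (xi eta : R -> Omega -> 'cV[R[i]]_T)
    (Rxi Reta F G : R -> 'M[R[i]]_T)
    (hxi : stationary P xi Rxi) (heta : stationary P eta Reta)
    (hxic : ms_continuous P xi) (hetac : ms_continuous P eta)
    (hunc : uncorrelated P xi eta)
    (hF : spectral_density F Rxi) (hG : spectral_density G Reta)
    (Zxi Zeta : set R -> Omega -> 'cV[R[i]]_T)
    (hZxi : orthogonal_measure P Zxi F) (hZeta : orthogonal_measure P Zeta G)
    (hrxi : spectral_representation P xi Zxi F)
    (hreta : spectral_representation P eta Zeta G)
    (hmin : minimality S F G)
    (a : R -> 'cV[R[i]]_T) (ha : L2S S a)
    (ha1 : (\sum_k \int[leb R]_(t in S) (ComplexField.Normc.normc (a t k ord0))%:E < +oo)%E)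
    (ha2 : (\int[leb R]_(t in S) (`|t| * vnorm2 (a t))%:E < +oo)%E)
    (hB : invertible_op S (graph_B S F G))
    (Ra : R -> 'cV[R[i]]_T) (hRa : graph_R S F G a Ra)
    (c : R -> 'cV[R[i]]_T) (hc : graph_B S F G c Ra) (* c = B_s^{-1} R_s a *)
    (Axi Ahat : Omega -> R[i])
    (hAxi : is_functional P S a xi Axi)
    (hAhat : is_projection P
       (obs_space P S (fun t w => xi t w + eta t w)) Axi Ahat) :
  let A := fourierS S a in
  let C := fourierS S c in
  let V := fun l => invmx (F l + G l) in
  let X1 := fun l => (A l)^T *m G l + (C l)^T in
  let X2 := fun l => (A l)^T *m F l - (C l)^T in
  let Delta := (fine (msdist P Axi Ahat))%:C in
  [/\ is_spectral_characteristic P S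
        (fun D w => Zxi D w + Zeta D w) (fun l => F l + G l) Ahat
        (fun l => ((A l)^T *m F l *m V l - (C l)^T *m V l)^T),
      Delta =
        inv2pi * cint (leb R) setT (fun l =>
          mx11 (X1 l *m V l *m F l *m V l *m adjmx (X1 l))) +
        inv2pi * cint (leb R) setT (fun l =>
          mx11 (X2 l *m V l *m G l *m V l *m adjmx (X2 l))) &
      Delta = innerS S Ra c + innerS S (op_Q S F G a) a].

Proof.
have [mS cS finS] := finite_union_itv hS.
have [uH _] := hmin; have [pF iF _] := hF; have [pG iG _] := hG.
have [rA _] := hAxi; have [[rAh _] _] := hAhat.
have pH := ae_psd_add pF pG; have iH := mxintegrable_add iF iG.
have sipH := wL2_sip (mxintegrable_meas iH) pH.
have sipP := rv2_sip P.
move=> A C V X1 X2 Delta.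
set h := fun l => (_ - _)^T.
have eh : h = spectral_char S F G a c by apply/funext => l; rewrite spectral_charE.
have wh := wL2_spectral_char mS finS iF iG pF pG uH ha hc; rewrite -eh in wh.
have eD : Delta = (sqn (corr P) (Axi - Ahat))%:C by rewrite /Delta (msdistE rA rAh).
(* The stochastic integral requires one combination that is close to h and, with the same
   coefficients, close to the estimate; hence a common index for the two rates. *)
have approx (e : R) : 0 < e -> exists Y q, [/\ obs_pair S xi eta Y q,
    sqn (wip (leb R) (fun l => F l + G l)) (h - q) < e & sqn (corr P) (Ahat - Y) < e].
  move=> e0.
  have [Y [q [K [op hY hq]]]] :=
    spectral_limit mS finS hxi heta hunc hF hG ha hAxi uH cS hRa hc hAhat.
  have c1 : K * 2^-1 ^+ i @[i --> \oo] --> (0 : R).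
    by apply: cvg_geometric; rewrite ger0_norm ?invr_ge0// invf_lt1// ltr1n.
  have c2 : (2 * pi)^-1 * 4^-1 ^+ i @[i --> \oo] --> (0 : R).
    by apply: cvg_geometric; rewrite ger0_norm ?invr_ge0// invf_lt1// ltr1n.
  have /cvgrPdist_lt/(_ e e0)[n1 _ h1] := c1.
  have /cvgrPdist_lt/(_ e e0)[n2 _ h2] := c2.
  pose i := maxn n1 n2; exists (Y i), (q i); split=> //.
    rewrite (sqnC sipH wh (obs_pair_wL2 hF hG (op i))) eh.
    apply: (le_lt_trans (hq i)); apply: le_lt_trans (h1 i (leq_maxl _ _)).
    by rewrite sub0r normrN ler_norm.
  rewrite (sqnC sipP rAh (obs_pair_rv2 hxi heta (op i))).
  apply: (le_lt_trans (hY i)); apply: le_lt_trans (h2 i (leq_maxr _ _)).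
  by rewrite sub0r normrN ler_norm.
have err := mean_square_error mS finS hxi heta hunc hF hG ha hAxi uH cS hRa hc hAhat.
split.
- split.
    split; first by split; [case: wh|rewrite (wL2_sqnE wh) ltry].
    move=> e e0; have [Y [q [op hq _]]] := approx e e0.
    have [m [t [k [z [St _ eq]]]]] := op; exists m, t, k, z; split=> //.
    have wq := obs_pair_wL2 hF hG op.
    move: hq; rewrite -lte_fin -(wL2_sqnE (sipB sipH wh wq)); apply: le_lt_trans.
    rewrite le_eqVlt; apply/orP; left; apply/eqP; apply: eq_integral => l _.
    by rewrite -[(h - q) l]/(h l - q l) eq fct_sumE.
  (* Each observation is the integral of its exponential, and this correspondence passes to
     combinations and then to the limit. *)
  apply: (step_limit_stoch_int hZxi hZeta iF iG pF pG).
  apply: (step_limit_closed hZxi hZeta iF iG pF pG rAh wh) => e e0.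
  have [Y [q [op hq hY]]] := approx e e0.
  exists Y, q; split=> //.
  exact: (step_limit_pair hZxi hZeta hrxi hreta iF iG pF pG op).
- rewrite eD (mean_square_error_split mS finS hxi heta hunc hF hG ha hAxi uH cS hRa hc hAhat).
  rewrite (error_signal mS finS iF iG pF pG uH ha hc).
  by rewrite (error_noise mS finS iF iG pF pG uH ha hc).
- by rewrite eD err (error_operators mS finS iF iG pF pG uH ha hRa hc).
Qed.
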